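(* Let $g:[0,1)\to(0,1]$ be a nonincreasing function with $\lim_{x\to1}g(x)=0$, and let $\tilde g(\lambda):=\log\frac{1}{g(1-2^{-\lambda})}$ for $\lambda\ge 0$. Let $v=\{v_n\}_{n\ge0}$ and $w=\{w_n\}_{n\ge0}$ be nonincreasing bounded sequences of nonnegative numbers with $\sum_{n=0}^\infty v_n=\infty$ and $\sum_{n=0}^\infty w_n=\infty$. Then: (1) $g$ is an essential minorant for the class $\mathcal S_w$ if and only if $$\sum_{n=0}^\infty \frac{w_n}{\tilde g(n)}<\infty .$$ (2) $g$ is an essential minorant for the class $\mathcal L_v$ if and only if for every subset $E$ of $\mathbb Z_+$ such that $\sum_{n\in E}v_n<\infty$, and for every positive integer $C$, $$\limsup_{n\to\infty,\ n\notin E}\ \tilde g\!\left(\left[\tfrac nC\right]\right)v_n=\infty .$$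
   Context: $\mathbb D$ is the open unit disk, $H^\infty$ is the space of bounded holomorphic functions on $\mathbb D$, $\mathbb Z_+=\{0,1,2,\dots\}$, $[x]$ is the largest integer $\le x$, and $|\cdot|$ denotes linear (arc-length) measure of subsets of $\partial\mathbb D$. A number $\alpha>0$ is fixed once and for all. The Stolz angle with vertex $e^{i\theta}$ is $\Gamma_\alpha(e^{i\theta}):=\{\zeta\in\mathbb D: |1-\zeta e^{-i\theta}|<(1+\alpha)(1-|\zeta|)\}$. For a sequence $a=\{a_k\}$ of points of $\mathbb D$, set $\phi_a(e^{i\theta}):=\#\big(\{a_k\}\cap\Gamma_\alpha(e^{i\theta})\big)\in\{0,1,2,\dots\}\cup\{\infty\}$ and $m_a(n):=|\{\zeta\in\partial\mathbb D:\phi_a(\zeta)\ge n\}|$ for $n\in\mathbb Z_+$. A sequence $a=\{a_k\}$ in $\mathbb D$ is separated if $\inf_{j\ne k}\left|\frac{a_k-a_j}{1-\bar a_k a_j}\right|>0$. Classes of sequences: $\mathcal S_w:=\{a\text{ separated}:\sum_{n=0}^\infty m_a(n)w_n=\infty\}$ and $\mathcal L_v:=\{a\text{ separated}:\liminf_{n\to\infty}m_a(n)/v_n>0\}$. A nonincreasing function $g:[0,1)\to(0,1]$ tending to $0$ at $1$ is an essential minorant for a class $\mathcal S$ of sequences in $\mathbb D$ if, for every sequence $a=\{a_k\}$ in $\mathcal S$, every $f\in H^\infty$ satisfying $|f(a_k)|\le g(|a_k|)$ for all $k$ must vanish identically. Convention: in the series $\sum_n w_n/\tilde g(n)$, the (at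 most finitely many) terms with $\tilde g(n)=0$ are omitted. *)

(* Defs.v *)
From HB Require Import structures.
From mathcomp Require Import all_boot all_order all_algebra.
From mathcomp Require Import all_classical all_reals all_analysis.
From mathcomp Require Import complex.

Set Implicit Arguments.
Unset Strict Implicit.
Unset Printing Implicit Defensive.

Import Order.TTheory GRing.Theory Num.Theory.
Import numFieldNormedType.Exports.

Local Open Scope classical_set_scope.
Local Open Scope ring_scope.

(* The R-valued modulus; the norm `|z| on R[i] takes its values in R[i]. *)
Notation normc := ComplexField.Normc.normc.

Section EssentialMinorants.
Variable R : realType.
Implicit Types (z : R[i]) (a : nat -> R[i]) (f : R[i] -> R[i]) (g : R -> R).

Definition disk : set R[i] := [set z | normc z < 1].

(* For the normed space R[i]^o over the field R[i], differentiability in the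
   direction 1 is complex differentiability.  Values off the disk are
   irrelevant. *)
Definition Hinfty : set (R[i] -> R[i]) :=
  [set f | (forall z, disk z -> derivable (f : R[i]^o -> R[i]^o) z 1) /\
           (exists M : R, forall z, disk z -> normc (f z) <= M)].

Definition expi (t : R) : R[i] := Complex (cos t) (sin t).

Definition stolz (alpha t : R) : set R[i] :=
  [set z | disk z /\
           normc (1 - z * expi (- t)) < (1 + alpha) * (1 - normc z)].

Definition phi (alpha : R) a (t : R) : \bar R :=
  counting (range a `&` stolz alpha t).

(* Arc length on the unit circle is Lebesgue measure in the angle, taken over
   one period. *)
Definition m (alpha : R) a (n : nat) : \bar R :=
  @lebesgue_measure R
    [set t | 0 <= t < 2 * pi /\ (n%:R%:E <= phi alpha a t)%E].

Definition separated a : Prop :=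
  0 < inf [set normc ((a jk.1 - a jk.2) / (1 - conjc (a jk.1) * a jk.2))
            | jk in [set jk : nat * nat | jk.1 != jk.2]].

(* Only infinite sequences are needed: a finite one has m_a(n) = 0 for all
   large n, so it lies in neither of the classes below. *)
Definition separated_in_disk : set (nat -> R[i]) :=
  [set a | (forall k, disk (a k)) /\ separated a].

Definition class_S (alpha : R) (w : nat -> R) : set (nat -> R[i]) :=
  [set a | separated_in_disk a /\
           (\sum_(0 <= n <oo) (m alpha a n * (w n)%:E) = +oo)%E].

Definition class_L (alpha : R) (v : nat -> R) : set (nat -> R[i]) :=
  [set a | separated_in_disk a /\
           (0 < limn_einf (fun n => m alpha a n * ((v n)^-1)%:E))%E].

(* A function g : [0,1) -> (0,1] is represented by the restriction to [0,1)
   of a function on R. *)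
Definition minorant_function g : Prop :=
  [/\ forall x : R, 0 <= x < 1 -> 0 < g x <= 1,
      forall x y : R, 0 <= x -> x <= y -> y < 1 -> g y <= g x
    & g x @[x --> 1^'-] --> (0 : R)].

Definition essential_minorant g (S : set (nat -> R[i])) : Prop :=
  minorant_function g /\
  forall a, S a -> forall f, Hinfty f ->
    (forall k, normc (f (a k)) <= g (normc (a k))) ->
    forall z, disk z -> f z = 0.

Definition gtilde g (lambda : R) : R := ln (1 / g (1 - 2 `^ (- lambda))).

End EssentialMinorants.

(* Main.v *)
Require Import Defs.
From mathcomp Require Import all_boot all_order all_algebra.
From mathcomp Require Import all_classical all_reals all_analysis.
From mathcomp Require Import measurable_realfun.
From mathcomp Require Import complex.
From mathcomp Require Import ring lra zify.

Set Implicit Arguments.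
Unset Strict Implicit.
Unset Printing Implicit Defensive.

Import Order.TTheory GRing.Theory Num.Theory.
Import numFieldNormedType.Exports.

Local Open Scope classical_set_scope.
Local Open Scope ring_scope.

(** Let f be bounded by 1 and not identically zero, say f z0 <> 0, and let a be a
    separated sequence with |f (a k)| <= g |a k|.  The sufficiency of both criteria
    comes from one estimate of the counting function (sufficiency_core):

      m n <= K / gtilde (n / C) + e n  with e n >= 0 and a convergent sum of e n.

    A separated sequence has O(j) points of depth at least 2^-j in a Stolz angle
    (stolz_count), so an angle with n points either has at least n / 2 points that
    are close, in the pseudohyperbolic metric, to a zero of f, or contains a point b
    of depth at most 2^-j, j = n / C, without zeros of f nearby.  The points of the
    first kind inherit the Blaschke condition from the zeros of f
    (unclear_blaschke), so the number of their shadows over a point of the circle is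
    integrable: this gives e n (layer_cake).  At the points of the second kind
    log 1/|f| is at least gtilde j, and the measure of the union of their shadows is
    O(1 / gtilde j), a weak-type inequality (weak_measure).  To prove it, select
    greedily a subfamily of well separated points that still controls the union.
    Harnack's inequality carries the smallness of f from b to a small circle around
    b, where the Blaschke product B of the subfamily is bounded below by a packing
    argument.  So |f|^N <= |B|^M on these circles, with M / N comparable to gtilde j,
    hence also at z0 by the maximum principle (blprod_compare), and this bounds the
    sum of 1 - |b| over the subfamily.  The two criteria follow by summation: the
    terms e n cost a convergent part of the sum of m n * w n, respectively a set E
    over which v is summable.

    For necessity, let p be a sequence of exponents that grows by at most one per
    step.  A dyadic mass distribution on an arc, which at the steps where p grows is
    pushed onto every second interval, lives at level j on a set of measure 2^-(p j),
    where it has density 2^(p j).  The sequence consists of a few points above each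
    interval that carries mass; it is separated, and the Stolz angles at the
    surviving set contain L j of its points of level at most j.  The singular inner
    function of the limit of these masses is at most exp (- c 2^(p j)) at the points
    of level j (herglotz_limit), which is below the decay g wherever gtilde j is
    O(2^(p j)).  At the other levels a Blaschke product vanishes, which is possible
    when the sum of 2^-(p j) over them converges (invisible_sequence).  If a
    criterion fails, then exponents that dominate gtilde, respectively 1 / v, followed
    at unit speed (speed_limit) make the sequence a member of the class: while p is
    slower than its target, it grows at every step, so that such levels have a
    convergent sum.

    All the function theory rests on the maximum principle.  It comes from Goursat's
    theorem on rectangles, read in logarithmic polar coordinates. *)

(** * Complex differentiability *)

Section ComplexBasics.
Variable R : realType.
Implicit Types (z w : R[i]) (f g : R[i] -> R[i]).

Lemma normc_ge0 z : 0 <= normc z.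
Proof. by case: z => x y; exact: sqrtr_ge0. Qed.

Lemma normcE (z : R[i]) : `|z| = (normc z)%:C%C.
Proof. by case: z. Qed.

Lemma normc_eq0 z : (normc z == 0) = (z == 0).
Proof.
apply/eqP/eqP => [/ComplexField.Normc.eq0_normc //|->].
exact: ComplexField.Normc.normc0.
Qed.

Lemma normc_gt0 z : (0 < normc z) = (z != 0).
Proof. by rewrite lt_def normc_eq0 normc_ge0 andbT. Qed.

Lemma normc0 : normc (0 : R[i]) = 0.
Proof. exact: ComplexField.Normc.normc0. Qed.

Lemma normc1 : normc (1 : R[i]) = 1.
Proof. exact: ComplexField.Normc.normc1. Qed.

Lemma normcM z w : normc (z * w) = normc z * normc w.
Proof. exact: ComplexField.Normc.normcM. Qed.

Lemma normcV z : normc z^-1 = (normc z)^-1.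
Proof. exact: ComplexField.Normc.normcV. Qed.

Lemma normcf_div z w : normc (z / w) = normc z / normc w.
Proof. by rewrite normcM normcV. Qed.

Lemma normcN z : normc (- z) = normc z.
Proof. exact: complex.normcN. Qed.

Lemma normcD z w : normc (z + w) <= normc z + normc w.
Proof. exact: complex.le_normcD. Qed.

Lemma normcB z w : normc (z - w) <= normc z + normc w.
Proof. by rewrite -(normcN w); exact: normcD. Qed.

Lemma normc_sub z w : normc (z - w) = normc (w - z).
Proof. by rewrite -normcN opprB. Qed.

Lemma normc_tri z w u : normc (z - u) <= normc (z - w) + normc (w - u).
Proof. by rewrite (_ : z - u = (z - w) + (w - u)) ?normcD //; ring. Qed.

Lemma normc_lower z w : normc z - normc w <= normc (z - w).
Proof. by rewrite lerBlDr -{1}(subrK w z) normcD. Qed.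

Lemma normc_dist z w : `|normc z - normc w| <= normc (z - w).
Proof.
rewrite ler_norml normc_lower andbT lerNl opprB normc_sub.
exact: normc_lower.
Qed.

Lemma normcX z n : normc (z ^+ n) = normc z ^+ n.
Proof. by elim: n => [|n IH]; rewrite ?expr0 ?normc1 // !exprS normcM IH. Qed.

Lemma normc_real (x : R) : normc (x%:C)%C = `|x|.
Proof. by rewrite /= expr0n addr0 sqrtr_sqr. Qed.

Lemma normc_conj z : normc (conjc z) = normc z.
Proof. by case: z => x y /=; rewrite sqrrN. Qed.

Lemma normc_sqr z : normc z ^+ 2 = complex.Re z ^+ 2 + complex.Im z ^+ 2.
Proof. by case: z => x y /=; rewrite sqr_sqrtr // addr_ge0 ?sqr_ge0. Qed.

Lemma normc_leRe z : `|complex.Re z| <= normc z.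
Proof.
by case: z => x y /=; rewrite -sqrtr_sqr ler_wsqrtr // lerDl sqr_ge0.
Qed.

Lemma normc_leIm z : `|complex.Im z| <= normc z.
Proof.
by case: z => x y /=; rewrite -sqrtr_sqr ler_wsqrtr // lerDr sqr_ge0.
Qed.

Lemma normc_le_ReIm z : normc z <= `|complex.Re z| + `|complex.Im z|.
Proof.
rewrite -(@ler_pXn2r _ 2) ?nnegrE ?normc_ge0 ?addr_ge0 //.
rewrite normc_sqr sqrrD !real_normK ?num_real //.
have := mulr_ge0 (normr_ge0 (complex.Re z)) (normr_ge0 (complex.Im z)); lra.
Qed.

Lemma Complex_eta z : z = Complex (complex.Re z) (complex.Im z).
Proof. by case: z. Qed.

Lemma gt0_complex (e : R[i]) : 0 < e -> exists2 e' : R, 0 < e' & e = (e'%:C)%C.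
Proof. by case: e => x y; rewrite ltcE /= => /andP[/eqP -> x0]; exists x. Qed.

Definition ccont f z := forall e : R, 0 < e -> exists2 r : R, 0 < r &
  forall w, normc (w - z) < r -> normc (f w - f z) < e.

Lemma ccont_continuous f z :
  ccont f z <-> {for z, continuous (f : R[i]^o -> R[i]^o)}.
Proof.
split=> [H|fc e e0].
  apply: (proj2 (@cvgrPdist_lt _ R[i]^o _ (nbhs (z : R[i]^o)) _ f (f z))).
  move=> e /gt0_complex[e' /H[r r0 rP] ->].
  apply/nbhs_ballP; exists (r%:C)%C => /=; first by rewrite ltcR.
  move=> w; rewrite /ball /= normcE ltcR (normc_sub z) => /rP.
  by rewrite normcE ltcR (normc_sub (f z)).
have e0' : 0 < (e%:C)%C by rewrite ltcR.
move/cvgrPdist_lt : fc => /(_ _ e0')/nbhs_ballP[r /= r0 rP].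
have [r' r'0 rE] := gt0_complex r0; exists r' => // w wz.
have := rP w; rewrite /ball /= rE !normcE !ltcR (normc_sub z) => /(_ wz).
by rewrite (normc_sub (f z)).
Qed.

Lemma ccont_cst (k : R[i]) z : ccont (fun=> k) z.
Proof. by move=> e e0; exists 1 => // w _; rewrite subrr normc0. Qed.

Lemma ccont_id z : ccont id z.
Proof. by move=> e e0; exists e. Qed.

Lemma ccontD f g z : ccont f z -> ccont g z -> ccont (fun w => f w + g w) z.
Proof.
move=> fc gc e e0; have e2 : 0 < e / 2 by rewrite divr_gt0.
have [r r0 rP] := fc _ e2; have [s s0 sP] := gc _ e2.
exists (Num.min r s); first by rewrite lt_min r0.
move=> w; rewrite lt_min => /andP[/rP fw /sP gw].
have -> : f w + g w - (f z + g z) = (f w - f z) + (g w - g z) by ring.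
by apply: le_lt_trans (normcD _ _) _; lra.
Qed.

Lemma ccontM f g z : ccont f z -> ccont g z -> ccont (fun w => f w * g w) z.
Proof.
move=> /ccont_continuous fc /ccont_continuous gc; apply/ccont_continuous.
exact: (@cvgM R[i] R[i]^o (nbhs (z : R[i]^o)) _ f g).
Qed.

Lemma ccontV f z : f z != 0 -> ccont f z -> ccont (fun w => (f w)^-1) z.
Proof.
move=> fz /ccont_continuous fc; apply/ccont_continuous.
exact: (@cvgV R[i] R[i]^o (nbhs (z : R[i]^o)) _ f).
Qed.

Lemma ccont_comp f g z : ccont f z -> ccont g (f z) -> ccont (g \o f) z.
Proof.
by move=> fc gc e /gc[d d0 dP]; have [r r0 rP] := fc _ d0; exists r => // w /rP/dP.
Qed.

(** Caratheodory's form of complex differentiability, chosen because sums,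
    products, inverses and compositions reduce to continuity statements. *)
Definition cdiff f z := exists2 q, ccont q z &
  forall w, f w - f z = q w * (w - z).

Lemma cdiff_cont f z : cdiff f z -> ccont f z.
Proof.
move=> [q qc qE].
have -> : f = fun w => q w * (w - z) + f z.
  by apply/funext => w; rewrite -qE subrK.
apply: ccontD; last exact: ccont_cst.
apply: ccontM => //; apply: ccontD; last exact: ccont_cst.
exact: ccont_id.
Qed.

Lemma cdiff_cst (k : R[i]) z : cdiff (fun=> k) z.
Proof.
by exists (fun=> 0) => [|w]; [exact: ccont_cst|rewrite subrr mul0r].
Qed.

Lemma cdiff_id z : cdiff id z.
Proof. by exists (fun=> 1) => [|w]; [exact: ccont_cst|rewrite mul1r]. Qed.

Lemma cdiffD f g z : cdiff f z -> cdiff g z -> cdiff (fun w => f w + g w) z.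
Proof.
move=> [p pc pE] [q qc qE]; exists (fun w => p w + q w); first exact: ccontD.
by move=> w; rewrite mulrDl -pE -qE; ring.
Qed.

Lemma cdiffM f g z : cdiff f z -> cdiff g z -> cdiff (fun w => f w * g w) z.
Proof.
move=> fd gd; have fc := cdiff_cont fd; case: fd gd => [p pc pE] [q qc qE].
exists (fun w => f w * q w + p w * g z).
  by apply: ccontD; apply: ccontM => //; exact: ccont_cst.
move=> w; have -> : (f w * q w + p w * g z) * (w - z) =
  f w * (q w * (w - z)) + (p w * (w - z)) * g z by ring.
by rewrite -pE -qE; ring.
Qed.

Lemma cdiffN f z : cdiff f z -> cdiff (fun w => - f w) z.
Proof.
move=> fd; have := cdiffM (cdiff_cst (-1) z) fd.
by congr (cdiff _ _); apply/funext => w; rewrite mulN1r.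
Qed.

Lemma cdiffB f g z : cdiff f z -> cdiff g z -> cdiff (fun w => f w - g w) z.
Proof. by move=> fd /cdiffN; exact: cdiffD. Qed.

Lemma cdiffV f z : f z != 0 -> cdiff f z -> cdiff (fun w => (f w)^-1) z.
Proof.
move=> fz fd; have fc := cdiff_cont fd; case: fd => [p pc pE].
have nfz : 0 < normc (f z) by rewrite normc_gt0.
have [r r0 rP] := fc _ nfz.
have fN w : normc (w - z) < r -> f w != 0.
  move=> /rP; apply: contraTneq => ->.
  by rewrite sub0r normcN ltxx.
pose q w := - p w * ((f w)^-1 * (f z)^-1).
exists (fun w => if normc (w - z) < r then q w else
  ((f w)^-1 - (f z)^-1) / (w - z)).
  have qc : ccont q z.
    apply: ccontM; last by apply: ccontM; [exact: ccontV|exact: ccont_cst].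
    have := ccontM (ccont_cst (-1) z) pc.
    by congr (ccont _ _); apply/funext => w; rewrite mulN1r.
  move=> e /qc[s s0 sP].
  exists (Num.min r s); first by rewrite lt_min r0.
  by move=> w; rewrite lt_min => /andP[-> /sP]; rewrite subrr normc0 r0.
move=> w; case: ifPn => [wr|].
  rewrite /q.
  have -> : - p w * ((f w)^-1 * (f z)^-1) * (w - z) =
    - (p w * (w - z)) * ((f w)^-1 * (f z)^-1) by ring.
  by rewrite -pE; field; rewrite fz fN.
by rewrite -leNgt => rw; rewrite divfK // -normc_gt0 (lt_le_trans r0).
Qed.

Lemma cdiffX f z n : cdiff f z -> cdiff (fun w => f w ^+ n) z.
Proof.
move=> fd; elim: n => [|n IH]; first exact: cdiff_cst.
have := cdiffM fd IH.
by congr (cdiff _ _); apply/funext => w; rewrite exprS.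
Qed.

Lemma cdiff_comp f g z : cdiff f z -> cdiff g (f z) -> cdiff (g \o f) z.
Proof.
move=> fd [q qc qE]; have fc := cdiff_cont fd; case: fd => [p pc pE].
exists (fun w => q (f w) * p w).
  by apply: ccontM => //; exact: (ccont_comp fc qc).
by move=> w /=; rewrite qE pE mulrA.
Qed.

Lemma cdiff_prod (I : Type) (s : seq I) (F : I -> R[i] -> R[i]) z :
  (forall i, cdiff (F i) z) -> cdiff (fun w => \prod_(i <- s) F i w) z.
Proof.
move=> Fd; elim: s => [|i s IH].
  have := cdiff_cst 1 z.
  by congr (cdiff _ _); apply/funext => w; rewrite big_nil.
have := cdiffM (Fd i) IH.
by congr (cdiff _ _); apply/funext => w; rewrite big_cons.
Qed.

Lemma cdiff_eps f z d :
  (forall e : R, 0 < e -> exists2 r : R, 0 < r & forall w, normc (w - z) < r ->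
    normc (f w - f z - d * (w - z)) <= e * normc (w - z)) -> cdiff f z.
Proof.
move=> H; exists (fun w => if w == z then d else (f w - f z) / (w - z)).
  move=> e e0; have [|r r0 rP] := H (e / 2); first by rewrite divr_gt0.
  exists r => // w /rP; rewrite eqxx.
  case: ifPn => [_ _|wz]; first by rewrite subrr normc0.
  have wz0 : w - z != 0 by rewrite subr_eq0.
  have -> : f w - f z - d * (w - z) = ((f w - f z) / (w - z) - d) * (w - z).
    by field.
  rewrite normcM ler_pM2r ?normc_gt0 // => /le_lt_trans; apply.
  by rewrite ltr_pdivrMr // mulr_natr mulr2n ltrDl.
move=> w; case: ifPn => [/eqP ->|wz]; first by rewrite !subrr mulr0.
by rewrite divfK // subr_eq0.
Qed.

Lemma cdiff_epsP f z : cdiff f z -> exists d,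
  forall e : R, 0 < e -> exists2 r : R, 0 < r & forall w, normc (w - z) < r ->
    normc (f w - f z - d * (w - z)) <= e * normc (w - z).
Proof.
move=> [q qc qE]; exists (q z) => e /qc[r r0 rP].
exists r => // w /rP /ltW qw.
by rewrite qE -mulrBl normcM ler_wpM2r // normc_ge0.
Qed.

Lemma cdiffP f z : derivable (f : R[i]^o -> R[i]^o) z 1 <-> cdiff f z.
Proof.
split.
  move=> /cvg_ex[d /= fd]; apply: (@cdiff_eps _ _ d) => e e0.
  have e0' : 0 < (e%:C)%C by rewrite ltcR.
  move/cvgrPdist_lt : fd => /(_ _ e0').
  rewrite /prop_near1 /dnbhs /= /within /=.
  move=> /nbhs_ballP[r /= r0 rP].
  have [r' r'0 rE] := gt0_complex r0; exists r' => // w wz.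
  have [->|wNz] := eqVneq w z; first by rewrite !subrr mulr0 subrr normc0 mulr0.
  have wz0 : w - z != 0 by rewrite subr_eq0.
  have := rP (w - z); rewrite /ball /= sub0r.
  rewrite normcE normcN rE ltcR => /(_ wz wz0).
  have -> : (w - z) *: 1 + z = w by rewrite [_ *: 1]mulr1 subrK.
  rewrite normcE ltcR => H.
  have -> : f w - f z - d * (w - z) = ((w - z)^-1 * (f w - f z) - d) * (w - z).
    by field.
  by rewrite normcM ler_pM2r ?normc_gt0 // normc_sub ltW.
move=> [q qc qE]; apply/cvg_ex; exists (q z).
apply/cvgrPdist_lt => e /gt0_complex[e' /qc[r r0 rP] ->].
apply/nbhs_ballP; exists (r%:C)%C => /=; first by rewrite ltcR.
move=> h; rewrite /ball /= sub0r normcE normcN ltcR => hr h0.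
have -> : h *: 1 + z = h + z by rewrite [_ *: 1]mulr1.
rewrite qE addrK.
have -> : h^-1 *: (q (h + z) * h) = q (h + z).
  by rewrite [LHS]mulrCA mulVf // mulr1.
by rewrite normcE ltcR normc_sub rP // addrK.
Qed.

End ComplexBasics.

(** * Goursat's theorem on rectangles *)

Section Goursat.
Variable R : realType.

Definition RI (f : R -> R) (a b : R) : R :=
  (\int[@lebesgue_measure R]_(x in `[a, b]) f x)%R.

Definition cont_on (f : R -> R) (a b : R) :=
  forall x, a <= x <= b -> {for x, continuous f}.

Lemma cont_on_integrable f (a b : R) : cont_on f a b ->
  (@lebesgue_measure R).-integrable `[a, b] (EFin \o f).
Proof.
move=> fc; apply: continuous_compact_integrable; first exact: segment_compact.
apply: continuous_in_subspaceT => x; rewrite inE /= in_itv /=; exact: fc.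
Qed.

Lemma RI_split f (a m b : R) : a <= m -> m <= b -> cont_on f a b ->
  RI f a b = RI f a m + RI f m b.
Proof.
move=> am mb fc; rewrite /RI.
have fi := cont_on_integrable fc.
have fi2 : (@lebesgue_measure R).-integrable `]m, b] (EFin \o f).
  by apply: integrableS fi => //; apply: subset_itvr; rewrite bnd_simp.
rewrite -(@Rintegral_itv_obnd_cbnd _ m) //.
by rewrite -(Rintegral_itvB fi) ?bnd_simp // addrC subrK.
Qed.

Lemma RI_B f g (a b : R) : cont_on f a b -> cont_on g a b ->
  RI (fun x => f x - g x) a b = RI f a b - RI g a b.
Proof. by move=> fc gc; rewrite /RI RintegralB //; exact: cont_on_integrable. Qed.

Lemma RI_cst (k a b : R) : a <= b -> RI (fun=> k) a b = k * (b - a).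
Proof.
move=> ab; rewrite /RI Rintegral_cst //; congr (_ * _).
have := @lebesgue_measure_itv R `[a, b]; rewrite /= lte_fin => ->.
by case: ltgtP ab => // -> _; rewrite subrr.
Qed.

Lemma RI_le f g (a b : R) : cont_on f a b -> cont_on g a b ->
  (forall x, a <= x <= b -> f x <= g x) -> RI f a b <= RI g a b.
Proof.
by move=> fc gc fg; apply: le_Rintegral => //; exact: cont_on_integrable.
Qed.

Lemma cont_on_cst (k a b : R) : cont_on (fun=> k) a b.
Proof. by move=> x _; exact: cst_continuous. Qed.

Lemma RI_approx f (k e a b : R) : a <= b -> cont_on f a b ->
  (forall x, a <= x <= b -> `|f x - k| <= e) ->
  `|RI f a b - k * (b - a)| <= e * (b - a).
Proof.
move=> ab fc fk.
have up : RI f a b <= (k + e) * (b - a).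
  rewrite -RI_cst //; apply: RI_le => // [|x /fk]; first exact: cont_on_cst.
  by rewrite ler_norml; lra.
have dn : (k - e) * (b - a) <= RI f a b.
  rewrite -RI_cst //; apply: RI_le => // [|x /fk]; first exact: cont_on_cst.
  by rewrite ler_norml; lra.
by rewrite ler_norml; move: up dn; rewrite mulrDl mulrBl; lra.
Qed.

Variables (V U : R -> R -> R) (S0 : R).

(** First-order expansions of the coefficients of the form V ds + U dt; the
    shared coefficient q says that the form is closed. *)
Hypothesis VU_diff : forall s t, s < S0 -> exists p q r : R,
  forall e : R, 0 < e -> exists2 d : R, 0 < d & forall s' t',
    `|s' - s| < d -> `|t' - t| < d ->
    `|V s' t' - V s t - (p * (s' - s) + q * (t' - t))|
      <= e * (`|s' - s| + `|t' - t|) /\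
    `|U s' t' - U s t - (q * (s' - s) + r * (t' - t))|
      <= e * (`|s' - s| + `|t' - t|).

Lemma lin_approx_cont (f : R -> R) (x p : R) :
  (exists2 d : R, 0 < d & forall y, `|y - x| < d ->
    `|f y - f x - p * (y - x)| <= `|y - x|) -> {for x, continuous f}.
Proof.
move=> [d d0 H]; apply/cvgrPdist_lt => e e0.
have p0 : 0 < `|p| + 1 by rewrite ltr_pwDr.
have de : 0 < Num.min d (e / (`|p| + 1)) by rewrite lt_min d0 divr_gt0.
apply/nbhs_ballP; exists (Num.min d (e / (`|p| + 1))) => //= y.
rewrite /ball /= lt_min distrC => /andP[yd ye].
have := H y yd; move: ye; rewrite ltr_pdivlMr // mulrDr mulr1 => ye Hy.
rewrite distrC -(subrK (p * (y - x)) (f y - f x)).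
apply: le_lt_trans (ler_normD _ _) _; rewrite normrM; apply: le_lt_trans ye.
by rewrite addrC [_ * `|p|]mulrC lerD2l.
Qed.

Lemma V_cont_s s t : s < S0 -> {for s, continuous (V^~ t)}.
Proof.
move=> /(@VU_diff s t)[p [q [r /(_ 1 ltr01)[d d0 H]]]].
apply: (@lin_approx_cont _ _ p); exists d => // y yd.
have := H y t yd; rewrite subrr normr0 mulr0 !addr0 mul1r => /(_ d0)[].
by [].
Qed.

Lemma U_cont_t s t : s < S0 -> {for t, continuous (U s)}.
Proof.
move=> /(@VU_diff s t)[p [q [r /(_ 1 ltr01)[d d0 H]]]].
apply: (@lin_approx_cont _ _ r); exists d => // y yd.
have := H s y; rewrite subrr normr0 !mulr0 !add0r mul1r => /(_ d0 yd)[].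
by [].
Qed.

(** The integral of V ds + U dt around the rectangle [a, b] x [c, d], clockwise. *)
Definition circ (a b c d : R) : R :=
  RI (fun s => V s d - V s c) a b - RI (fun t => U b t - U a t) c d.

Lemma V_cont_on a b t : b < S0 -> cont_on (V^~ t) a b.
Proof. by move=> bS x /andP[_ xb]; apply: V_cont_s; exact: le_lt_trans bS. Qed.

Lemma U_cont_on s c d : s < S0 -> cont_on (U s) c d.
Proof. by move=> sS x _; exact: U_cont_t. Qed.

Lemma circE a b c d : a <= b -> b < S0 -> circ a b c d =
  RI (V^~ d) a b - RI (V^~ c) a b - (RI (U b) c d - RI (U a) c d).
Proof.
move=> ab bS; have aS := le_lt_trans ab bS.
by rewrite /circ !RI_B //; (try exact: V_cont_on); exact: U_cont_on.
Qed.

(** The circulation is additive under subdivision: the inner edges cancel. *)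
Lemma circ_quarter a b c d : a <= b -> b < S0 -> c <= d ->
  let m := (a + b) / 2 in let n := (c + d) / 2 in
  circ a b c d = circ a m c n + circ m b c n + circ a m n d + circ m b n d.
Proof.
move=> ab bS cd m n.
have [am mb cn nd] : [/\ a <= m, m <= b, c <= n & n <= d].
  by rewrite /m /n; split; lra.
have mS := le_lt_trans mb bS; have aS := le_lt_trans ab bS.
rewrite !circE //.
do 2 (rewrite (RI_split am mb); last exact: V_cont_on).
do 2 (rewrite (RI_split cn nd); last exact: U_cont_on).
ring.
Qed.

Lemma circ_step a b c d : a <= b -> b < S0 -> c <= d ->
  exists x : R * R * R * R, let: (a', b', c', d') := x in
  [/\ a <= a' /\ b' <= b, c <= c' /\ d' <= d, b' - a' = (b - a) / 2,
      d' - c' = (d - c) / 2 & `|circ a b c d| <= 4 * `|circ a' b' c' d'|].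
Proof.
move=> ab bS cd; have := circ_quarter ab bS cd.
set m := (a + b) / 2; set n := (c + d) / 2 => /= E.
have [am mb cn nd] : [/\ a <= m, m <= b, c <= n & n <= d].
  by rewrite /m /n; split; lra.
have hm1 : m - a = (b - a) / 2 by rewrite /m; field.
have hm2 : b - m = (b - a) / 2 by rewrite /m; field.
have hn1 : n - c = (d - c) / 2 by rewrite /n; field.
have hn2 : d - n = (d - c) / 2 by rewrite /n; field.
set g := `|circ a b c d|.
have [H|h1] := leP g (4 * `|circ a m c n|); first by exists (a, m, c, n).
have [H|h2] := leP g (4 * `|circ m b c n|); first by exists (m, b, c, n).
have [H|h3] := leP g (4 * `|circ a m n d|); first by exists (a, m, n, d).
have [H|h4] := leP g (4 * `|circ m b n d|); first by exists (m, b, n, d).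
exfalso; have : g <= `|circ a m c n| + `|circ m b c n| + `|circ a m n d| +
  `|circ m b n d|.
  rewrite /g E; do 2 (apply: le_trans (ler_normD _ _) _; rewrite lerD2r).
  exact: ler_normD.
lra.
Qed.

(** Near a point the form is affine up to an error e times the distance.  The
    affine part has circulation zero, since its cross coefficients agree. *)
Lemma circ_local a b c d s t p q r e dl : a <= b -> b < S0 -> c <= d ->
  a <= s <= b -> c <= t <= d -> 0 <= e ->
  (forall s' t', `|s' - s| < dl -> `|t' - t| < dl ->
    `|V s' t' - V s t - (p * (s' - s) + q * (t' - t))|
      <= e * (`|s' - s| + `|t' - t|) /\
    `|U s' t' - U s t - (q * (s' - s) + r * (t' - t))|
      <= e * (`|s' - s| + `|t' - t|)) ->
  b - a < dl -> d - c < dl ->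
  `|circ a b c d| <= 2 * e * ((b - a) + (d - c)) ^+ 2.
Proof.
move=> ab bS cd /andP[as_ sb] /andP[ct td] e0 H h1 h2.
have aS := le_lt_trans ab bS.
have ds x : a <= x <= b -> `|x - s| <= b - a by rewrite ler_norml; lra.
have dt x : c <= x <= d -> `|x - t| <= d - c by rewrite ler_norml; lra.
have dsl x : a <= x <= b -> `|x - s| < dl by move=> /ds /le_lt_trans; apply.
have dtl x : c <= x <= d -> `|x - t| < dl by move=> /dt /le_lt_trans; apply.
set h := (b - a) + (d - c).
have bnd x y : a <= x <= b -> c <= y <= d ->
  e * (`|x - s| + `|y - t|) <= e * h.
  by move=> /ds ? /dt ?; rewrite ler_wpM2l // lerD.
have A : `|RI (fun s => V s d - V s c) a b - (q * (d - c)) * (b - a)| <=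
   (2 * e * h) * (b - a).
  apply: RI_approx => //.
    move=> x /andP[ax xb]; have xS := le_lt_trans xb bS.
    by apply: cvgB; exact: V_cont_s.
  move=> x xab; have dd : c <= d <= d by rewrite cd lexx.
  have cc : c <= c <= d by rewrite cd lexx.
  have [+ _] := H x d (dsl _ xab) (dtl _ dd).
  have [+ _] := H x c (dsl _ xab) (dtl _ cc).
  have := bnd _ _ xab dd; have := bnd _ _ xab cc.
  move: (e * (`|x - s| + `|c - t|)) (e * (`|x - s| + `|d - t|)) => e1 e2.
  by rewrite -(mulrA 2); move: (e * h) => eh; rewrite !ler_norml; lra.
have B : `|RI (fun t => U b t - U a t) c d - (q * (b - a)) * (d - c)| <=
   (2 * e * h) * (d - c).
  apply: RI_approx => //.
    by move=> x _; apply: cvgB; exact: U_cont_t.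
  move=> x xcd; have bb : a <= b <= b by rewrite ab lexx.
  have aa : a <= a <= b by rewrite ab lexx.
  have [_ +] := H b x (dsl _ bb) (dtl _ xcd).
  have [_ +] := H a x (dsl _ aa) (dtl _ xcd).
  have := bnd _ _ bb xcd; have := bnd _ _ aa xcd.
  move: (e * (`|b - s| + `|x - t|)) (e * (`|a - s| + `|x - t|)) => e1 e2.
  by rewrite -(mulrA 2); move: (e * h) => eh; rewrite !ler_norml; lra.
rewrite /circ.
move: A B; rewrite !ler_norml.
move: (RI _ a b) (RI _ c d) => I1 I2.
have -> : 2 * e * h ^+ 2 = 2 * e * h * (b - a) + 2 * e * h * (d - c).
  by rewrite /h; ring.
have -> : q * (d - c) * (b - a) = q * (b - a) * (d - c) by ring.
move: (2 * e * h * (b - a)) (2 * e * h * (d - c)) (q * (b - a) * (d - c)).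
by move=> ? ? ?; lra.
Qed.

(** Goursat's theorem for a rectangle: repeated quartering follows a nested
    sequence of rectangles on which the circulation loses at most a factor 4
    per step, while the expansion at the common point makes it an arbitrarily
    small multiple of the squared diameter. *)
Lemma circ0 a b c d : a <= b -> b < S0 -> c <= d -> circ a b c d = 0.
Proof.
move=> ab bS cd.
pose valid (x : R * R * R * R) := let: (a, b, c, d) := x in
  [/\ a <= b, b < S0 & c <= d].
pose good (x y : R * R * R * R) :=
  let: (a, b, c, d) := x in let: (a', b', c', d') := y in
  [/\ a <= a' /\ b' <= b, c <= c' /\ d' <= d, b' - a' = (b - a) / 2,
      d' - c' = (d - c) / 2 & `|circ a b c d| <= 4 * `|circ a' b' c' d'|].
have [F FP] : exists F : R * R * R * R -> R * R * R * R,
    forall x, valid x -> good x (F x).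
  suff /choice[F FP] : forall x, exists y, valid x -> good x y by exists F.
  move=> [[[a1 b1] c1] d1].
  have [v|nv] := pselect (valid (a1, b1, c1, d1)).
    by case: (v) => v1 v2 v3; have [y yP] := circ_step v1 v2 v3; exists y.
  by exists (0, 0, 0, 0) => /nv.
have Fv x : valid x -> valid (F x).
  move=> xv; have := FP _ xv.
  case: x xv => [[[a1 b1] c1] d1] [v1 v2 v3].
  case: (F _) => [[[a2 b2] c2] d2] [[? ?] [? ?] ? ? _]; split; lra.
pose X n := iter n F (a, b, c, d).
pose An n := (X n).1.1.1; pose Bn n := (X n).1.1.2.
pose Cn n := (X n).1.2; pose Dn n := (X n).2.
have XE n : X n = (An n, Bn n, Cn n, Dn n).
  by rewrite /An /Bn /Cn /Dn; case: (X n) => [[[? ?] ?] ?].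
have Xv n : valid (X n) by elim: n => [|n IH] //=; exact: Fv.
have [v1 v2 v3] : [/\ forall n, An n <= Bn n, forall n, Bn n < S0 &
    forall n, Cn n <= Dn n].
  by split=> n; have := Xv n; rewrite XE => -[].
have Xg n : good (X n) (X n.+1) by exact: FP.
have Amono n : An n <= An n.+1 by have := Xg n; rewrite !XE => -[[]].
have Bmono n : Bn n.+1 <= Bn n by have := Xg n; rewrite !XE => -[[]].
have Cmono n : Cn n <= Cn n.+1 by have := Xg n; rewrite !XE => -[_ []].
have Dmono n : Dn n.+1 <= Dn n by have := Xg n; rewrite !XE => -[_ []].
have Alen n : Bn n - An n = (b - a) / 2 ^+ n.
  elim: n => [|n IH]; first by rewrite expr0 divr1.
  have := Xg n; rewrite !XE => -[_ _ -> _ _]; rewrite IH exprSr invfM mulrA //.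
have Clen n : Dn n - Cn n = (d - c) / 2 ^+ n.
  elim: n => [|n IH]; first by rewrite expr0 divr1.
  have := Xg n; rewrite !XE => -[_ _ _ -> _]; rewrite IH exprSr invfM mulrA //.
have circn n : `|circ a b c d| <= 4 ^+ n * `|circ (An n) (Bn n) (Cn n) (Dn n)|.
  elim: n => [|n IH]; first by rewrite expr0 mul1r.
  apply: (le_trans IH); have := Xg n; rewrite !XE => -[_ _ _ _ H].
  by rewrite exprSr -mulrA ler_wpM2l // exprn_ge0.
have nested (f g : nat -> R) : (forall n, f n <= g n) ->
    (forall n, f n <= f n.+1) -> (forall n, g n.+1 <= g n) ->
    exists x, forall n, f n <= x <= g n.
  move=> fg fm gm.
  have fm' i j : (i <= j)%N -> f i <= f j by move/(homo_leq (@lexx _ R) le_trans fm).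
  have gm' i j : (i <= j)%N -> g j <= g i.
    have tr (y x z : R) : y <= x -> z <= y -> z <= x by move=> yx zy; exact: le_trans yx.
    by move/(homo_leq (r := fun x y => y <= x) (@lexx _ R) tr gm).
  have ub n : ubound (range f) (g n).
    move=> _ [m _ <-]; have [mn|/ltnW nm] := leqP m n.
      exact: le_trans (fm' _ _ mn) (fg n).
    exact: le_trans (fg m) (gm' _ _ nm).
  exists (sup (range f)) => n; apply/andP; split.
    by apply: ub_le_sup; [exists (g 0%N); exact: ub|exists n].
  by apply: ge_sup; [exists (f 0%N), 0%N|exact: ub].
have [s sP] := nested An Bn v1 Amono Bmono.
have [t tP] := nested Cn Dn v3 Cmono Dmono.
have sS : s < S0 by have /andP[_] := sP 0%N; move=> /le_lt_trans; apply.
have [p [q [r pqr]]] := @VU_diff s t sS.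
apply/normr0_eq0; apply/eqP; rewrite eq_le normr_ge0 andbT.
apply/ler_addgt0Pr => e e0; rewrite add0r.
pose h0 := (b - a) + (d - c).
have h0g : 0 <= h0 by rewrite /h0; lra.
have e1 : 0 < e / (2 * (h0 + 1) ^+ 2).
  by rewrite divr_gt0 // mulr_gt0 // exprn_gt0 // ltr_wpDl.
have [dl dl0 H] := pqr _ e1.
have [n nP] : exists n, h0 / 2 ^+ n < dl.
  have := @cvg_geometric R h0 (2^-1).
  rewrite ger0_norm ?invr_ge0 // invf_lt1 // ltr1n => /(_ isT).
  move/cvgrPdist_lt => /(_ _ dl0)[n _ /(_ n (leqnn n))].
  rewrite /geometric /= sub0r normrN ger0_norm ?mulr_ge0 ?exprn_ge0 ?invr_ge0 //.
  by rewrite exprVn => ?; exists n.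
have p2 : 0 < 2 ^+ n :> R by rewrite exprn_gt0.
have w1 : (b - a) / 2 ^+ n < dl.
  by apply: le_lt_trans nP; rewrite ler_wpM2r ?invr_ge0 ?(ltW p2) // /h0; lra.
have w2 : (d - c) / 2 ^+ n < dl.
  by apply: le_lt_trans nP; rewrite ler_wpM2r ?invr_ge0 ?(ltW p2) // /h0; lra.
have := @circ_local (An n) (Bn n) (Cn n) (Dn n) s t p q r _ dl (v1 n) (v2 n)
  (v3 n) (sP n) (tP n) (ltW e1) H.
rewrite Alen Clen -mulrDl -/h0 => /(_ w1 w2) Hn.
apply: le_trans (circn n) _.
apply: le_trans (ler_wpM2l _ Hn) _; first by rewrite exprn_ge0.
have -> : 4 ^+ n * (2 * (e / (2 * (h0 + 1) ^+ 2)) * (h0 / 2 ^+ n) ^+ 2) =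
    e * (h0 / (h0 + 1)) ^+ 2.
  have -> : 4 = 2 ^+ 2 :> R by rewrite -natrX.
  have n1 : h0 + 1 != 0 by rewrite lt0r_neq0 // ltr_wpDl.
  rewrite -exprM mulnC exprM; move: (2 ^+ n) p2 => P p2.
  by field; rewrite n1 lt0r_neq0.
rewrite ler_piMr ?(ltW e0) //; apply: exprn_ile1.
  by rewrite divr_ge0 // addr_ge0.
by rewrite ler_pdivrMr ?ltr_wpDl // mul1r lerDl.
Qed.

End Goursat.

(** * The mean value property and the maximum principle *)

(* Keeps moduli from being expanded into square roots of sums of squares. *)
Arguments ComplexField.Normc.normc : simpl never.

Section MeanValue.
Variable R : realType.
Implicit Types (z w : R[i]) (f g : R[i] -> R[i]).

Lemma is_derive_eps (f : R -> R) (x d : R) : is_derive x 1 f d ->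
  forall e : R, 0 < e -> exists2 r : R, 0 < r & forall h, `|h| < r ->
    `|f (x + h) - f x - d * h| <= e * `|h|.
Proof.
move=> [fd dE] e e0; move: fd => /cvg_ex[l /= fl].
have lE : l = d by rewrite -dE /derive; apply/esym/cvg_lim.
rewrite {}lE in fl.
move/cvgrPdist_le : fl => /(_ _ e0).
rewrite /prop_near1 /dnbhs /= /within /=.
move=> /nbhs_ballP[r /= r0 rP]; exists r => // h hr.
have [->|h0] := eqVneq h 0; first by rewrite addr0 subrr mulr0 subrr normr0 mulr0.
have := rP h; rewrite /ball /= sub0r normrN => /(_ hr h0).
have -> : h *: 1 + x = x + h by rewrite [_ *: 1]mulr1 addrC.
rewrite distrC -[h^-1 *: _]/(h^-1 * _) => H.
have -> : f (x + h) - f x - d * h = (h^-1 * (f (x + h) - f x) - d) * h.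
  by field.
by rewrite normrM ler_wpM2r.
Qed.

Lemma expi0 : expi (0 : R) = 1.
Proof. by rewrite /expi cos0 sin0. Qed.

Lemma expiD (s t : R) : expi (s + t) = expi s * expi t.
Proof. by rewrite /expi cosD sinD; congr Complex; rewrite addrC. Qed.

Lemma normc_expi (t : R) : normc (expi t) = 1.
Proof.
apply/eqP; rewrite -(@eqrXn2 _ 2) ?normc_ge0 // normc_sqr /= cos2Dsin2.
by rewrite expr1n.
Qed.

Lemma normc_imag (y : R) : normc (Complex 0 y) = `|y|.
Proof.
apply/eqP; rewrite -(@eqrXn2 _ 2) ?normc_ge0 // normc_sqr /= expr0n add0r.
by rewrite real_normK // num_real.
Qed.

Lemma expi2pi : expi (2 * pi) = 1 :> R[i].
Proof. by rewrite /expi mulr_natl cos2pi sin2pi. Qed.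

Definition cexp z : R[i] := (expR (complex.Re z))%:C%C * expi (complex.Im z).

Lemma cexpD z w : cexp (z + w) = cexp z * cexp w.
Proof.
by case: z w => [a b] [c d]; rewrite /cexp /= expRD expiD rmorphM /=; ring.
Qed.

Lemma normc_cexp z : normc (cexp z) = expR (complex.Re z).
Proof. by rewrite normcM normc_expi mulr1 normc_real ger0_norm ?expR_ge0. Qed.

Lemma cexp_neq0 z : cexp z != 0.
Proof. by rewrite -normc_gt0 normc_cexp expR_gt0. Qed.

Lemma expi_small (e : R) : 0 < e -> exists2 r : R, 0 < r & forall y, `|y| < r ->
  normc (expi y - 1 - Complex 0 y) <= e * `|y|.
Proof.
move=> e0; have e2 : 0 < e / 2 by rewrite divr_gt0.
have [r r0 rP] := is_derive_eps (is_derive_cos (0 : R)) e2.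
have [s s0 sP] := is_derive_eps (is_derive_sin (0 : R)) e2.
exists (Num.min r s); first by rewrite lt_min r0.
move=> y; rewrite lt_min => /andP[/rP c /sP d].
move: c d; rewrite !add0r cos0 sin0 !oppr0 mul0r mul1r !oppr0 !addr0 => c d.
apply: le_trans (normc_le_ReIm _) _ => /=.
rewrite !oppr0 !addr0.
by have : e * `|y| = e / 2 * `|y| + e / 2 * `|y|; [field|lra].
Qed.

Lemma cdiff_cexp z : cdiff cexp z.
Proof.
apply: (@cdiff_eps _ _ _ (cexp z)) => e e0.
pose k := e / (4 * (normc (cexp z))).
have nz : 0 < normc (cexp z) by rewrite normc_gt0 cexp_neq0.
have k0 : 0 < k by rewrite divr_gt0 // mulr_gt0.
pose m := Num.min 1 k.
have m0 : 0 < m by rewrite lt_min ltr01.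
have m1 : m <= 1 by rewrite ge_min lexx.
have mk : m <= k by rewrite ge_min lexx orbT.
have [r r0 rP] := is_derive_eps (is_derive_expR (0 : R)) m0.
have [s s0 sP] := expi_small m0.
exists (Num.min (Num.min r s) (m / 2)).
  by rewrite !lt_min r0 s0 divr_gt0.
move=> w; rewrite !lt_min => /andP[/andP[wr ws] w2].
set h := w - z.
have -> : w = z + h by rewrite addrC subrK.
rewrite cexpD.
have -> : cexp z * cexp h - cexp z - cexp z * h = cexp z * (cexp h - 1 - h) by ring.
rewrite normcM.
have hx := normc_leRe h; have hy := normc_leIm h.
set x := complex.Re h in hx *; set y := complex.Im h in hy *.
have -> : cexp h - 1 - h = (expR x - 1 - x)%:C%C * expi y +
   (expi y - 1 - Complex 0 y) + x%:C%C * (expi y - 1).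
  have hE : h = x%:C%C + Complex 0 y.
    by rewrite [LHS]Complex_eta; congr Complex => /=; rewrite ?addr0 ?add0r.
  by rewrite {2}hE /cexp !rmorphB /= -/x -/y; ring.
have := rP x (le_lt_trans hx wr); rewrite add0r expR0 mul1r => E1.
have E2 := sP y (le_lt_trans hy ws).
have E3 : normc (expi y - 1) <= 2 * normc h.
  rewrite -(subrK (Complex 0 y) (expi y - 1)).
  apply: le_trans (normcD _ _) _; rewrite normc_imag.
  have : m * `|y| <= `|y| by rewrite ler_piMl.
  lra.
have nh := normc_ge0 h.
have B : normc ((expR x - 1 - x)%:C%C * expi y +
   (expi y - 1 - Complex 0 y) + x%:C%C * (expi y - 1)) <= 4 * k * normc h.
  apply: le_trans (normcD _ _) _.
  apply: le_trans (lerD (normcD _ _) (lexx _)) _.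
  rewrite !normcM normc_expi mulr1 !normc_real.
  have F1 : m * `|x| <= k * normc h by rewrite ler_pM // ltW.
  have F2 : m * `|y| <= k * normc h by rewrite ler_pM // ltW.
  have F3 : `|x| * normc (expi y - 1) <= 2 * k * normc h.
    apply: le_trans (_ : (m / 2) * (2 * normc h) <= _).
      rewrite ler_pM ?normc_ge0 //.
      exact: le_trans hx (ltW w2).
    have -> : m / 2 * (2 * normc h) = m * normc h by field.
    rewrite ler_wpM2r //; lra.
  lra.
apply: le_trans (ler_wpM2l (ltW nz) B) _.
rewrite /k.
have -> : normc (cexp z) * (4 * (e / (4 * normc (cexp z))) * normc h) = e * normc h.
  by field; rewrite lt0r_neq0.
exact: lexx.
Qed.

(** The mean value property of Re f over circles, in the weak form that suffices
    for the maximum principle.  In the coordinates c + exp (s + i t) circles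
    around c become vertical segments, so Goursat on a rectangle of height 2 pi
    shows that the mean over a circle does not depend on its radius. *)
Lemma mean_value f c (r rho eta : R) :
  (forall w, normc (w - c) < r -> cdiff f w) -> 0 < rho < r -> 0 < eta ->
  exists t, complex.Re (f c) - eta < complex.Re (f (c + rho%:C%C * expi t)).
Proof.
move=> fd /andP[rho0 rhor] eta0; apply: contrapT => /forallNP no.
have r0 := lt_trans rho0 rhor.
have {no} no t : complex.Re (f (c + rho%:C%C * expi t)) <= complex.Re (f c) - eta.
  by rewrite leNgt; apply/negP; exact: no.
(* The real and imaginary parts of F are the coefficients of a closed form by the
   Cauchy-Riemann equations. *)
pose F z := f (c + cexp z).
pose V s t := complex.Im (F (Complex s t)).
pose U s t := complex.Re (F (Complex s t)).
have Fd s t : s < ln r -> cdiff F (Complex s t).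
  move=> sr; apply: (@cdiff_comp _ (fun z => c + cexp z) f).
    by apply: cdiffD; [exact: cdiff_cst|exact: cdiff_cexp].
  apply: fd; rewrite addrC addKr normc_cexp /=.
  by rewrite -ltr_ln ?posrE ?expR_gt0 // expRK.
have VU s t : s < ln r -> exists p q r : R,
  forall e : R, 0 < e -> exists2 d : R, 0 < d & forall s' t',
    `|s' - s| < d -> `|t' - t| < d ->
    `|V s' t' - V s t - (p * (s' - s) + q * (t' - t))|
      <= e * (`|s' - s| + `|t' - t|) /\
    `|U s' t' - U s t - (q * (s' - s) + r * (t' - t))|
      <= e * (`|s' - s| + `|t' - t|).
  move=> /(Fd _ t)/cdiff_epsP[[d1 d2] dP].
  exists d2, d1, (- d2) => e e0; have [d d0 H] := dP e e0.
  exists (d / 2); first by rewrite divr_gt0.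
  move=> s' t' sd td.
  have hn : normc (Complex s' t' - Complex s t) <= `|s' - s| + `|t' - t|.
    exact: normc_le_ReIm.
  have hd : normc (Complex s' t' - Complex s t) < d by lra.
  have := H _ hd; set D := F _ - F _ - _ => HD.
  have le2 : normc D <= e * (`|s' - s| + `|t' - t|).
    by apply: le_trans HD _; rewrite ler_wpM2l // ltW.
  split.
    suff -> : V s' t' - V s t - (d2 * (s' - s) + d1 * (t' - t)) = complex.Im D.
      exact: le_trans (normc_leIm _) le2.
    rewrite /D /V; case: (F (Complex s' t')) (F (Complex s t)) => [? ?] [? ?] /=.
    by ring.
  suff -> : U s' t' - U s t - (d1 * (s' - s) + - d2 * (t' - t)) = complex.Re D.
    exact: le_trans (normc_leRe _) le2.
  rewrite /D /U; case: (F (Complex s' t')) (F (Complex s t)) => [? ?] [? ?] /=.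
  by ring.
have fcc : ccont f c by apply: cdiff_cont; apply: fd; rewrite subrr normc0.
have eta2 : 0 < eta / 2 by rewrite divr_gt0.
have [d d0 dP] := fcc _ eta2.
pose b := ln rho; pose a := Num.min b (ln (d / 2)).
have ab : a <= b by rewrite ge_min lexx.
have br : b < ln r by rewrite ltr_ln.
have pi0 : 0 <= 2 * pi :> R by rewrite mulr_ge0 // pi_ge0.
have := circ0 VU ab br pi0; rewrite /circ.
(* The horizontal edges cancel because F has period 2 pi i; the left edge is so far
   to the left that f is within eta / 2 of f c on it. *)
have -> : (fun s => V s (2 * pi) - V s 0) = fun=> 0.
  apply/funext => s; rewrite /V /F /cexp /=.
  by rewrite expi2pi expi0 subrr.
rewrite RI_cst // mul0r sub0r => /eqP; rewrite oppr_eq0 => /eqP I0.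
have : RI (fun t => U b t - U a t) 0 (2 * pi) <= - (eta / 2) * (2 * pi - 0).
  rewrite -RI_cst //; apply: RI_le => //.
  - move=> t _; apply: cvgB; first exact: (U_cont_t VU).
    exact: (U_cont_t VU (le_lt_trans ab br)).
  - exact: cont_on_cst.
  move=> t _; have Ub : U b t <= complex.Re (f c) - eta.
    by have := no t; rewrite /U /F /cexp /= /b lnK ?posrE.
  have := dP (c + cexp (Complex a t)); rewrite addrC addKr normc_cexp /=.
  have -> : (expR a < d) = true.
    apply: le_lt_trans (_ : expR (ln (d / 2)) < d).
      by rewrite ler_expR ge_min lexx orbT.
    by rewrite lnK ?posrE ?divr_gt0 // ltr_pdivrMr // mulr_natr mulr2n ltrDl.
  move=> /(_ isT) Ha.
  have : `|complex.Re (f (c + cexp (Complex a t)) - f c)| < eta / 2.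
    exact: le_lt_trans (normc_leRe _) Ha.
  rewrite raddfB /= ltr_norml /U /F => /andP[Hl _].
  lra.
rewrite I0 subr0; have := pi_gt0 R; nra.
Qed.

Definition cclosed (K : set R[i]) := forall z, ~ K z ->
  exists2 r : R, 0 < r & forall w, normc (w - z) < r -> ~ K w.

Lemma cEVT (K : set R[i]) (r : R) (u : R[i] -> R) : K !=set0 ->
  (forall z, K z -> normc z <= r) -> cclosed K ->
  (forall z, K z -> forall e : R, 0 < e -> exists2 d : R, 0 < d & forall w,
    normc (w - z) < d -> `|u w - u z| < e) ->
  exists2 z, K z & forall w, K w -> u w <= u z.
Proof.
move=> [z0 Kz0] Kr Kc uc.
pose T := (R * R)%type.
pose c (p : T) := Complex p.1 p.2.
pose K' : set T := [set p | K (c p)].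
have small (p : T) (d : R) : 0 < d -> \forall q \near p, normc (c q - c p) < d.
  move=> d0; apply/nbhs_ballP; exists (d / 2) => /=; first by rewrite divr_gt0.
  move=> q [] /=; rewrite /ball /= => q1 q2.
  apply: le_lt_trans (normc_le_ReIm _) _ => /=.
  by rewrite (distrC q.1) (distrC q.2); lra.
have K'c : compact K'.
  apply: (@subclosed_compact _ K' (`[(- r), r] `*` `[(- r), r])).
  - rewrite -openC openE => p /= /Kc[d d0 dP].
    by apply: filterS (small p d d0) => q; exact: dP.
  - by apply: compact_setX; exact: segment_compact.
  - move=> [x y] /Kr; rewrite /c /= => nr.
    have := normc_leRe (Complex x y); have := normc_leIm (Complex x y).
    rewrite /= => h1 h2; split; rewrite /= in_itv /= -ler_norml.
      exact: le_trans h2 nr.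
    exact: le_trans h1 nr.
have uK : {within K', continuous (u \o c)}.
  apply: continuous_in_subspaceT => p; rewrite inE => /uc H.
  apply/cvgrPdist_lt => e /H[d d0 dP].
  by apply: filterS (small p d d0) => q; rewrite distrC; exact: dP.
have [p pK pmax] := compact_EVT_max (ex_intro _ (complex.Re z0, complex.Im z0)
  (eq_ind _ K Kz0 _ (Complex_eta z0))) K'c uK.
rewrite inE in pK.
exists (c p) => // w Kw.
have := pmax (complex.Re w, complex.Im w); rewrite inE /K' /c /= -Complex_eta.
by apply.
Qed.

(** Maximum modulus principle on a compact set.  A maximum point of
    |F|^2 + e |z|^2 off the set where |F| <= M would violate the mean value
    property of the holomorphic function conj (F z0) F + e conj z0 z, whose real
    part dips quadratically away from z0. *)
Lemma max_principle (K : set R[i]) (r M : R) (F : R[i] -> R[i]) :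
  0 <= M -> (forall z, K z -> normc z <= r) -> cclosed K ->
  (forall z, K z -> cdiff F z) ->
  (forall z, K z -> normc (F z) <= M \/
     exists2 d : R, 0 < d & forall w, normc (w - z) < d -> K w) ->
  forall z, K z -> normc (F z) <= M.
Proof.
move=> M0 Kr Kc Fd bd z Kz.
have r0 : 0 <= r by exact: le_trans (normc_ge0 z) (Kr z Kz).
rewrite -ler_sqr ?nnegrE ?normc_ge0 //; apply/ler_addgt0Pr => e' e'0.
pose e := e' / (r ^+ 2 + 1).
have r1 : 0 < r ^+ 2 + 1 by rewrite ltr_wpDl // sqr_ge0.
have e0 : 0 < e by rewrite divr_gt0.
have er : e * r ^+ 2 <= e'.
  rewrite /e mulrAC ler_pdivrMr // ler_wpM2l ?ltW //; lra.
pose u w := normc (F w) ^+ 2 + e * normc w ^+ 2.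
have sqc (f : R[i] -> R[i]) x : ccont f x -> forall k : R, 0 < k ->
  exists2 d : R, 0 < d & forall w, normc (w - x) < d ->
    `|normc (f w) ^+ 2 - normc (f x) ^+ 2| < k.
  move=> fc k k0; pose h w := f w * conjc (f w).
  have cc : ccont (fun w => conjc (f w)) x.
    move=> k' /fc[d d0 dP]; exists d => // w /dP.
    by rewrite -rmorphB normc_conj.
  have [d d0 dP] := ccontM fc cc k0.
  exists d => // w /dP; apply: le_lt_trans.
  have hE (y : R[i]) : normc y ^+ 2 = complex.Re (y * conjc y).
    by rewrite normc_sqr; case: y => p q /=; ring.
  by rewrite !hE -raddfB; exact: normc_leRe.
have uc x : K x -> forall k : R, 0 < k -> exists2 d : R, 0 < d & forall w,
    normc (w - x) < d -> `|u w - u x| < k.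
  move=> /Fd/cdiff_cont Fc k k0; have k2 : 0 < k / 2 by rewrite divr_gt0.
  have k2e : 0 < k / 2 / e by rewrite divr_gt0.
  have [d d0 dP] := sqc _ _ Fc _ k2.
  have [s s0 sP] := sqc _ _ (@ccont_id _ x) _ k2e.
  exists (Num.min d s); first by rewrite lt_min d0.
  move=> w; rewrite lt_min => /andP[/dP h1 /sP].
  rewrite ltr_pdivlMr // => h2.
  have -> : u w - u x = (normc (F w) ^+ 2 - normc (F x) ^+ 2) +
    e * (normc w ^+ 2 - normc x ^+ 2) by rewrite /u; ring.
  apply: le_lt_trans (ler_normD _ _) _.
  by rewrite normrM (gtr0_norm e0); move: h1 h2; rewrite [_ * e]mulrC /=; lra.
have [y Ky ymax] := cEVT (ex_intro _ z Kz) Kr Kc uc.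
have uz : normc (F z) ^+ 2 <= u z.
  by rewrite /u lerDl mulr_ge0 ?sqr_ge0 // ltW.
apply: (le_trans uz); apply: (le_trans (ymax _ Kz)).
have ey : e * normc y ^+ 2 <= e'.
  apply: le_trans er; rewrite ler_wpM2l ?(ltW e0) // ler_sqr ?nnegrE ?normc_ge0 //.
  exact: Kr.
have [FyM|[d d0 dP]] := bd y Ky.
  by rewrite /u lerD // ler_sqr ?nnegrE ?normc_ge0.
exfalso; pose G w := conjc (F y) * F w + (e%:C)%C * conjc y * w.
have Gd w : normc (w - y) < d -> cdiff G w.
  move=> /dP/Fd Fw; apply: cdiffD; apply: cdiffM => //; try exact: cdiff_cst.
  exact: cdiff_id.
have d2 : 0 < d / 2 < d by rewrite divr_gt0 //= ltr_pdivrMr // mulr_natr mulr2n ltrDl.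
have q0 : 0 < e * (d / 2) ^+ 2 / 4.
  by rewrite divr_gt0 // mulr_gt0 // exprn_gt0 //; case/andP: d2.
have [t tP] := mean_value Gd d2 q0.
set w := y + _ in tP.
have Kw : K w.
  apply: dP; rewrite /w addrC addKr normcM normc_expi mulr1 normc_real.
  by case/andP: d2 => ? ?; rewrite gtr0_norm.
have := ymax _ Kw; rewrite /u !normc_sqr; move: tP; rewrite /G.
have wE : normc (w - y) ^+ 2 = (d / 2) ^+ 2.
  rewrite /w addrC addKr normcM normc_expi mulr1 normc_real.
  by rewrite real_normK // num_real.
move: wE; rewrite normc_sqr; move: q0.
rewrite !raddfB /=; case: (F y) (F w) => [a b] [c g].
case: (w) => x v; case: (y) => p q /= q0.
set D := (d / 2) ^+ 2 in q0 * => wE tP; have {}q0 : 0 < e * D by lra.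
have : e * ((x - p) ^+ 2 + (v - q) ^+ 2) = e * D by rewrite wE.
have := sqr_ge0 (a - c); have := sqr_ge0 (b - g).
move: tP; lra.
Qed.

End MeanValue.

(** * Finite Blaschke products and zero-free functions *)

Section Blaschke.
Variable R : realType.
Implicit Types (z w b : R[i]) (f g : R[i] -> R[i]) (s : seq R[i]).

(** The Moebius factor with zero b; its modulus is the pseudohyperbolic distance
    between z and b. *)
Definition bl b z : R[i] := (z - b) / (1 - conjc b * z).

Definition blprod s z : R[i] := \prod_(b <- s) bl b z.

Lemma bl_den_ge b z : normc z <= 1 -> 1 - normc b <= normc (1 - conjc b * z).
Proof.
move=> z1; apply: le_trans (normc_lower _ _); rewrite normc1 normcM normc_conj.
by rewrite lerB // ler_piMr ?normc_ge0.
Qed.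

Lemma bl_den_ge_sym b z : normc b <= 1 -> 1 - normc z <= normc (1 - conjc b * z).
Proof.
move=> z1; apply: le_trans (normc_lower _ _); rewrite normc1 normcM normc_conj.
by rewrite lerB // ler_piMl ?normc_ge0.
Qed.

Lemma bl_den_neq0 b z : normc b < 1 -> normc z <= 1 -> 1 - conjc b * z != 0.
Proof.
move=> b1 z1; rewrite -normc_gt0; apply: lt_le_trans (bl_den_ge b z1).
by rewrite subr_gt0.
Qed.

Lemma bl_den_le b z : normc b <= 1 -> normc z <= 1 -> normc (1 - conjc b * z) <= 2.
Proof.
move=> b1 z1; apply: le_trans (normcB _ _) _; rewrite normc1 normcM normc_conj.
by have : normc b * normc z <= 1; [rewrite mulr_ile1 ?normc_ge0|lra].
Qed.

(** Divided by |1 - conj b z|^2, this is the formula for 1 - |bl b z|^2 from which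
    the size estimates of Blaschke factors follow. *)
Lemma bl_id b z : normc (1 - conjc b * z) ^+ 2 - normc (z - b) ^+ 2 =
  (1 - normc z ^+ 2) * (1 - normc b ^+ 2).
Proof. by rewrite !normc_sqr; case: b z => [p q] [x y] /=; ring. Qed.

Lemma bl_sqr b z : normc b < 1 -> normc z <= 1 -> 1 - normc (bl b z) ^+ 2 =
  (1 - normc z ^+ 2) * (1 - normc b ^+ 2) / normc (1 - conjc b * z) ^+ 2.
Proof.
move=> b1 z1; rewrite -bl_id normcf_div expr_div_n mulrBl divff //.
by rewrite expf_neq0 // normc_eq0 bl_den_neq0.
Qed.

Lemma sqr_lt1 (x : R) : 0 <= x -> x < 1 -> x ^+ 2 < 1.
Proof. by move=> x0 x1; rewrite expr_lt1. Qed.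

Lemma sqr_le1 (x : R) : 0 <= x -> x <= 1 -> x ^+ 2 <= 1.
Proof. by move=> x0 x1; rewrite expr_le1. Qed.

Lemma bl_le1 b z : normc b < 1 -> normc z <= 1 -> normc (bl b z) <= 1.
Proof.
move=> b1 z1; rewrite -(@expr_le1 _ 2) ?normc_ge0 // -subr_ge0 bl_sqr //.
rewrite divr_ge0 ?sqr_ge0 // mulr_ge0 // subr_ge0 sqr_le1 ?normc_ge0 //.
exact: ltW.
Qed.

Lemma bl_eq0 b z : normc b < 1 -> normc z <= 1 -> (bl b z == 0) = (z == b).
Proof.
move=> b1 z1; rewrite /bl mulf_eq0 invr_eq0.
by rewrite (negbTE (bl_den_neq0 b1 z1)) orbF subr_eq0.
Qed.

Lemma bl_dist_le b z : normc b < 1 -> normc z <= 1 ->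
  normc (bl b z) <= normc (z - b) / (1 - normc b).
Proof.
move=> b1 z1; rewrite normcf_div ler_wpM2l ?normc_ge0 //.
rewrite lef_pV2 ?posrE ?subr_gt0 //; first exact: bl_den_ge.
by rewrite normc_gt0 bl_den_neq0.
Qed.

Lemma bl_dist_ge b z : normc b < 1 -> normc z <= 1 ->
  normc (z - b) / 2 <= normc (bl b z).
Proof.
move=> b1 z1; rewrite normcf_div ler_wpM2l ?normc_ge0 //.
rewrite lef_pV2 ?posrE //; first by rewrite bl_den_le // ltW.
by rewrite normc_gt0 bl_den_neq0.
Qed.

Lemma cdiff_bl b z : normc b < 1 -> normc z <= 1 -> cdiff (bl b) z.
Proof.
move=> b1 z1; apply: cdiffM.
  by apply: cdiffB; [exact: cdiff_id|exact: cdiff_cst].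
apply: cdiffV; first exact: bl_den_neq0.
apply: cdiffB; first exact: cdiff_cst.
by apply: cdiffM; [exact: cdiff_cst|exact: cdiff_id].
Qed.

Definition in_disk s := forall b, b \in s -> normc b < 1.

Lemma in_disk_cons b s : in_disk (b :: s) -> normc b < 1 /\ in_disk s.
Proof.
move=> H; split; first by apply: H; rewrite mem_head.
by move=> c cs; apply: H; rewrite inE cs orbT.
Qed.

Lemma cdiff_blprod s z : in_disk s -> normc z <= 1 -> cdiff (blprod s) z.
Proof.
move=> + z1; elim: s => [_|b s IH /in_disk_cons[b1 /IH sd]].
  have -> : blprod [::] = fun=> 1 by apply/funext => w; rewrite /blprod big_nil.
  exact: cdiff_cst.
have -> : blprod (b :: s) = fun w => bl b w * blprod s w.
  by apply/funext => w; rewrite /blprod big_cons.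
by apply: cdiffM => //; exact: cdiff_bl.
Qed.

Lemma blprod_neq0 s z : in_disk s -> normc z <= 1 -> z \notin s ->
  blprod s z != 0.
Proof.
move=> + z1; elim: s => [_ _|b s IH /in_disk_cons[b1 /IH sd]].
  by rewrite /blprod big_nil oner_eq0.
rewrite inE negb_or => /andP[zb /sd]; rewrite /blprod big_cons => h.
by rewrite mulf_neq0 // bl_eq0.
Qed.

Lemma blprod_le1 s z : in_disk s -> normc z <= 1 -> normc (blprod s z) <= 1.
Proof.
move=> + z1; elim: s => [_|b s IH /in_disk_cons[b1 /IH sd]].
  by rewrite /blprod big_nil normc1.
by rewrite /blprod big_cons normcM mulr_ile1 ?normc_ge0 // bl_le1.
Qed.

(** A finite product is close to 1 in modulus near the circle, with a linear rate
    that replaces boundary values in the maximum principle. *)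
Lemma blprod_boundary s n : in_disk s -> exists2 C : R, 0 <= C &
  forall w, normc w < 1 -> 1 - C * (1 - normc w) <= normc (blprod s w) ^+ n.
Proof.
have step (u v : R[i] -> R) :
    (forall w, normc w < 1 -> 0 <= u w <= 1) ->
    (exists2 C : R, 0 <= C & forall w, normc w < 1 -> 1 - C * (1 - normc w) <= u w) ->
    (exists2 C : R, 0 <= C & forall w, normc w < 1 -> 1 - C * (1 - normc w) <= v w) ->
    exists2 C : R, 0 <= C & forall w, normc w < 1 -> 1 - C * (1 - normc w) <= u w * v w.
  move=> u01 [C C0 CP] [D D0 DP]; exists (C + D) => [|w w1]; first exact: addr_ge0.
  have /andP[u0 u1] := u01 w w1; have := CP w w1; have := DP w w1 => h1 h2.
  have x0 : 0 <= 1 - normc w by rewrite subr_ge0 ltW.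
  have Dx : 0 <= D * (1 - normc w) by rewrite mulr_ge0.
  have := ler_wpM2l u0 h1; have := ler_wpM2r Dx u1.
  rewrite !mulrBr mulr1; lra.
move=> sd.
have one w : normc w < 1 -> 0 <= normc (blprod s w) <= 1.
  by move=> /ltW w1; rewrite normc_ge0 blprod_le1.
have base : exists2 C : R, 0 <= C &
    forall w, normc w < 1 -> 1 - C * (1 - normc w) <= normc (blprod s w).
  elim: s sd {one} => [_|b s IH /in_disk_cons[b1 sd]].
    by exists 0 => // w w1; rewrite /blprod big_nil normc1 mul0r subr0.
  have A1 w : normc w < 1 -> 0 <= normc (bl b w) <= 1.
    by move=> /ltW w1; rewrite normc_ge0 bl_le1.
  have A2 : exists2 C : R, 0 <= C & forall w, normc w < 1 ->
      1 - C * (1 - normc w) <= normc (bl b w).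
    have b2 : 0 < 1 - normc b by rewrite subr_gt0.
    exists (4 / (1 - normc b) ^+ 2) => [|w w1].
      by rewrite divr_ge0 // sqr_ge0.
    have bb : normc (bl b w) ^+ 2 <= normc (bl b w).
      by rewrite expr2 ler_piMl ?normc_ge0 // bl_le1 // ltW.
    apply: le_trans bb; rewrite lerBlDr -lerBlDl bl_sqr ?(ltW w1) // [leRHS]mulrAC.
    have n0 := normc_ge0 w; have nb := normc_ge0 b.
    apply: ler_pM.
    - by apply: mulr_ge0; rewrite subr_ge0 sqr_le1 // ltW.
    - by rewrite invr_ge0 sqr_ge0.
    - have e1 : 1 - normc w ^+ 2 <= 2 * (1 - normc w) by nra.
      have e2 : 1 - normc b ^+ 2 <= 2 by nra.
      have e3 : 0 <= 1 - normc w ^+ 2 by rewrite subr_ge0 sqr_le1 // ltW.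
      nra.
    rewrite lef_pV2 ?posrE ?exprn_gt0 //; last first.
      by rewrite normc_gt0 bl_den_neq0 // ltW.
    rewrite ler_sqr ?nnegrE ?(ltW b2) ?normc_ge0 //.
    by rewrite bl_den_ge // ltW.
  have [C C0 CP] := step _ (fun w => normc (blprod s w)) A1 A2 (IH sd).
  by exists C => // w /CP; rewrite /blprod big_cons normcM.
elim: n => [|n [C C0 CP]].
  by exists 0 => // w w1; rewrite mul0r subr0 expr0.
have [C' C'0 CP'] := step _ (fun w => normc (blprod s w) ^+ n) one base
  (ex_intro2 _ _ C C0 CP).
by exists C' => // w /CP'; rewrite exprS.
Qed.

Lemma seq_min_pos (T : eqType) (s : seq T) (u : T -> R) :
  (forall x, x \in s -> 0 < u x) ->
  exists2 d : R, 0 < d & forall x, x \in s -> d <= u x.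
Proof.
elim: s => [_|b s IH H]; first by exists 1.
have [|d d0 dP] := IH; first by move=> c cs; apply: H; rewrite inE cs orbT.
exists (Num.min d (u b)); first by rewrite lt_min d0 H ?mem_head.
move=> c; rewrite inE => /predU1P[->|/dP cd].
  by rewrite ge_min lexx orbT.
by rewrite ge_min cd.
Qed.

(** Comparison of f with a finite Blaschke product off small holes around its
    zeros: f^N / B^M is holomorphic there, its modulus is at most 1 on the
    boundaries of the holes by hypothesis, and asymptotically at most 1 at the
    unit circle because |B| tends to 1. *)
Lemma blprod_compare s f (eta : R[i] -> R) N M : in_disk s ->
  (forall z, normc z < 1 -> cdiff f z) ->
  (forall z, normc z < 1 -> normc (f z) <= 1) ->
  (forall b, b \in s -> 0 < eta b) ->
  (forall b z, b \in s -> normc z < 1 -> normc (z - b) = eta b ->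
     normc (f z) ^+ N <= normc (blprod s z) ^+ M) ->
  forall z, normc z < 1 -> (forall b, b \in s -> eta b <= normc (z - b)) ->
     normc (f z) ^+ N <= normc (blprod s z) ^+ M.
Proof.
move=> sd fd f1 eta0 hole z z1 zout.
have [C C0 CP] := blprod_boundary M sd.
apply/ler_addgt0Pr => e e0.
have C1 : 0 < C + 1 by rewrite ltr_wpDl.
(* The circle of radius 1 - x, on which |B|^M is at least 1 - C x, has to surround z
   and to make the loss C x at most e. *)
pose x := Num.min (1 - normc z) (Num.min (e / (C + 1)) (1 / (C + 1) / 2)).
have x0 : 0 < x by rewrite !lt_min subr_gt0 z1 !divr_gt0.
have xz : x <= 1 - normc z by rewrite ge_min lexx.
have xe : x <= e / (C + 1) by rewrite !ge_min lexx orbT.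
have xC : x <= 1 / (C + 1) / 2 by rewrite !ge_min lexx !orbT.
pose r := 1 - x.
pose K : set R[i] := [set w | normc w <= r /\ forall b, b \in s -> eta b <= normc (w - b)].
have Cx : 0 < 1 - C * x.
  have : x * (C + 1) <= 1 / 2.
    by rewrite -ler_pdivlMr // mulrAC.
  lra.
pose k := (1 - C * x)^-1.
have k1 : 1 <= k.
  rewrite -invr_le1 ?unitfE ?invr_gt0 ?invrK ?gt_eqF ?invr_gt0 //.
  by rewrite gerBl mulr_ge0 // ltW.
have K1 w : K w -> normc w < 1 by move=> [wr _]; apply: le_lt_trans wr _; rewrite /r; lra.
have Ks w : K w -> w \notin s.
  by move=> [_ wo]; apply/negP => /[dup]/wo + /eta0; rewrite subrr normc0; lra.
pose F w := f w ^+ N / blprod s w ^+ M.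
have KF w : K w -> normc (F w) = normc (f w) ^+ N / normc (blprod s w) ^+ M.
  by move=> _; rewrite normcf_div !normcX.
have Bpos w : K w -> 0 < normc (blprod s w) ^+ M.
  move=> Kw; rewrite exprn_gt0 // normc_gt0 blprod_neq0 ?Ks //.
  by rewrite ltW ?K1.
have := @max_principle R K r k F (le_trans ler01 k1) _ _ _ _ z.
rewrite KF; last by split => //; rewrite /r; lra.
have Kz : K z by split => //; rewrite /r; lra.
have fz1 : normc (f z) ^+ N <= 1 by rewrite exprn_ile1 ?normc_ge0 ?f1.
rewrite ler_pdivrMr ?Bpos // => /(_ _ _ _ _ Kz)/wrap[||||].
- by move=> w [].
- move=> w; rewrite /K /= => /not_andP[/negP|].
    rewrite -ltNge => rw; exists (normc w - r); first by rewrite subr_gt0.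
    move=> y yw [yr _].
    have := normc_lower w y; rewrite normc_sub; lra.
  move=> /existsNP[b /not_implyP[bs /negP]]; rewrite -ltNge => wb.
  exists (eta b - normc (w - b)); first by rewrite subr_gt0.
  move=> y yw [_ /(_ _ bs)]; have := normc_tri y w b; lra.
- move=> w Kw; apply: cdiffM; first by apply: cdiffX; apply: fd; exact: K1.
  apply: cdiffV; first by rewrite expf_neq0 // blprod_neq0 ?Ks // ltW ?K1.
  by apply: cdiffX; apply: cdiff_blprod => //; rewrite ltW ?K1.
- move=> w Kw; rewrite KF //.
  have fw1 : normc (f w) ^+ N <= 1 by rewrite exprn_ile1 ?normc_ge0 ?f1 ?K1.
  have [wr|wr] := eqVneq (normc w) r.
    left; rewrite ler_pdivrMr ?Bpos //; apply: (le_trans fw1).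
    rewrite -ler_pdivrMl ?invr_gt0 // invrK mulr1.
    by have := CP w (K1 w Kw); rewrite wr /r (_ : 1 - (1 - x) = x) //; ring.
  have [[b bs wb]|no] := pselect (exists2 b, b \in s & normc (w - b) = eta b).
    left; rewrite ler_pdivrMr ?Bpos //.
    apply: le_trans (hole _ _ bs (K1 w Kw) wb) _.
    by rewrite ler_peMl // ltW ?Bpos.
  right; case: (Kw) => wr' wo.
  have [b bs|d d0 dP] := @seq_min_pos _ s (fun b => normc (w - b) - eta b).
    rewrite subr_gt0 lt_neqAle wo // andbT.
    by apply/negP => /eqP E; apply: no; exists b.
  exists (Num.min d (r - normc w)).
    by rewrite lt_min d0 subr_gt0 lt_neqAle wr wr'.
  move=> y; rewrite lt_min => /andP[yd yr]; split.
    have := normc_lower y w; lra.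
  move=> b bs; have := dP b bs; have := normc_tri w y b.
  by rewrite (normc_sub w y); lra.
move=> H.
have {H} : normc (f z) ^+ N * (1 - C * x) <= normc (blprod s z) ^+ M.
  by rewrite -ler_pdivlMr // mulrC.
have : normc (f z) ^+ N * (C * x) <= e.
  apply: le_trans (_ : C * x <= e).
    by rewrite ler_piMl // mulr_ge0 // ltW.
  move: xe; rewrite ler_pdivlMr // => xe; apply: le_trans xe; nra.
by rewrite mulrBr mulr1; lra.
Qed.

Lemma pow_le_limit (x y : R) : 0 <= x -> 0 <= y ->
  (forall n, x ^+ n.+1 <= y ^+ n) -> x <= y.
Proof.
move=> x0 y0 H; rewrite leNgt; apply/negP => yx.
have xp : 0 < x by apply: le_lt_trans yx.
have q1 : `|y / x| < 1.
  by rewrite ger0_norm ?divr_ge0 // ltr_pdivrMr // mul1r.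
have /cvgrPdist_lt/(_ _ xp)[n _ /(_ n (leqnn n))] := @cvg_geometric R 1 _ q1.
rewrite /geometric /= mul1r sub0r normrN ger0_norm ?exprn_ge0 ?divr_ge0 //.
rewrite expr_div_n ltr_pdivrMr ?exprn_gt0 // -exprS ltNge.
by rewrite H.
Qed.

(** The Schwarz lemma for several zeros.  Comparing f^(n+1) with B^n makes the
    quotient small near the zeros, so that no removable singularity is needed;
    then n tends to infinity. *)
Lemma blprod_zeros s f : in_disk s -> uniq s ->
  (forall z, normc z < 1 -> cdiff f z) ->
  (forall z, normc z < 1 -> normc (f z) <= 1) ->
  (forall b, b \in s -> f b = 0) ->
  forall z, normc z < 1 -> normc (f z) <= normc (blprod s z).
Proof.
move=> sd us fd f1 f0 z z1.
have [/f0 ->|zs] := boolP (z \in s); first by rewrite normc0 normc_ge0.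
apply: pow_le_limit; rewrite ?normc_ge0 // => n.
have near b : b \in s -> exists2 e : R, 0 < e <= normc (z - b) &
    forall w, normc w < 1 -> normc (w - b) = e ->
      normc (f w) ^+ n.+1 <= normc (blprod s w) ^+ n.
  move=> bs; have b1 := sd b bs.
  have [q qc qE] := fd b b1; rewrite f0 // in qE.
  have [r r0 rP] := qc _ ltr01.
  have sE w : blprod s w = bl b w * blprod (rem b s) w.
    by rewrite /blprod (perm_big _ (perm_to_rem bs)) big_cons.
  have rd : in_disk (rem b s) by move=> c /mem_rem; exact: sd.
  have Bb : blprod (rem b s) b != 0.
    by rewrite blprod_neq0 ?(ltW b1) // mem_rem_uniqF.
  have nB : 0 < normc (blprod (rem b s) b) by rewrite normc_gt0.
  have nB2 : 0 < normc (blprod (rem b s) b) / 2 by rewrite divr_gt0.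
  have [t t0 tP] := cdiff_cont (cdiff_blprod rd (ltW b1)) nB2.
  pose C := normc (q b) + 1; pose c := normc (blprod (rem b s) b) / 4.
  have C0 : 0 < C by rewrite ltr_wpDl ?normc_ge0.
  have c0 : 0 < c by rewrite divr_gt0.
  have zb : 0 < normc (z - b).
    by rewrite normc_gt0 subr_eq0; apply: contraNneq zs => ->.
  (* f vanishes to first order at b and B exactly to first order, so the power n + 1
   of f wins over the power n of B at a small distance e. *)
  pose e := Num.min (Num.min (r / 2) (t / 2)) (Num.min (normc (z - b)) (c ^+ n / C ^+ n.+1)).
  have e0 : 0 < e by rewrite !lt_min zb !divr_gt0 ?exprn_gt0.
  exists e; first by rewrite e0 !ge_min lexx !orbT.
  move=> w w1 we.
  have wr : normc (w - b) < r.
    rewrite we; apply: le_lt_trans (_ : r / 2 < r); last by lra.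
    by rewrite !ge_min lexx.
  have wt : normc (w - b) < t.
    rewrite we; apply: le_lt_trans (_ : t / 2 < t); last by lra.
    by rewrite !ge_min lexx orbT.
  have fw : normc (f w) <= C * e.
    have := qE w; rewrite subr0 => ->; rewrite normcM we ler_wpM2r ?(ltW e0) //.
    have := rP w wr; have := normc_lower (q w) (q b); rewrite /C; lra.
  have Bw : c * e <= normc (blprod s w).
    rewrite sE normcM mulrC -we.
    have h1 := bl_dist_ge b1 (ltW w1).
    have h2 : 2 * c <= normc (blprod (rem b s) w).
      have := tP w wt; have := normc_lower (blprod (rem b s) b) (blprod (rem b s) w).
      by rewrite normc_sub /c; lra.
    have h10 : 0 <= normc (w - b) / 2 by rewrite divr_ge0 // normc_ge0.
    have h20 : 0 <= 2 * c by rewrite mulr_ge0 // ltW.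
    by have := ler_pM h10 h20 h1 h2; rewrite mulrA divfK.
  apply: le_trans (_ : (C * e) ^+ n.+1 <= _).
    by rewrite lerXn2r ?nnegrE ?normc_ge0 // mulr_ge0 // ltW.
  apply: le_trans (_ : (c * e) ^+ n <= _); last first.
    by rewrite lerXn2r ?nnegrE ?normc_ge0 // mulr_ge0 // ltW.
  rewrite !exprMn exprSr (exprSr e) [_ * (e ^+ n * e)]mulrCA mulrC.
  rewrite ler_wpM2r ?exprn_ge0 ?(ltW e0) //.
  rewrite -exprSr mulrC -ler_pdivlMr ?exprn_gt0 //.
  by rewrite -exprMn -/c !ge_min lexx !orbT.
have [eta etaP] : exists eta : R[i] -> R, forall b, b \in s ->
    0 < eta b <= normc (z - b) /\ forall w, normc w < 1 -> normc (w - b) = eta b ->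
      normc (f w) ^+ n.+1 <= normc (blprod s w) ^+ n.
  suff /choice[eta etaP] : forall b, exists e : R, b \in s ->
      0 < e <= normc (z - b) /\ forall w, normc w < 1 -> normc (w - b) = e ->
      normc (f w) ^+ n.+1 <= normc (blprod s w) ^+ n by exists eta.
  move=> b; have [bs|] := boolP (b \in s); last by exists 0.
  by have [e e0 eP] := near b bs; exists e.
apply: (@blprod_compare s f eta) => //.
- by move=> b /etaP[/andP[]].
- by move=> b w /etaP[_]; apply.
- by move=> b /etaP[/andP[]].
Qed.

Lemma schwarz f : (forall z, normc z < 1 -> cdiff f z) ->
  (forall z, normc z < 1 -> normc (f z) <= 1) -> f 0 = 0 ->
  forall z, normc z < 1 -> normc (f z) <= normc z.
Proof.
move=> fd f1 f0 z z1; have := @blprod_zeros [:: 0] f _ isT fd f1 _ z z1.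
rewrite /blprod big_seq1 /bl rmorph0 mul0r !subr0 divr1; apply.
  by move=> b; rewrite inE => /eqP ->; rewrite normc0.
by move=> b; rewrite inE => /eqP ->.
Qed.

(** The Schwarz lemma for (f - f w) / 2, with the zero w. *)
Lemma bounded_lipschitz f : (forall z, normc z < 1 -> cdiff f z) ->
  (forall z, normc z < 1 -> normc (f z) <= 1) ->
  forall z w, normc z < 1 -> normc w < 1 ->
  normc (f z - f w) <= 2 * normc (z - w) / (1 - normc w).
Proof.
move=> fd f1 z w z1 w1; pose g x := 2^-1 * (f x - f w).
have n2 : normc (2^-1 : R[i]) = 2^-1.
  by rewrite normcV -[2 : R[i]](rmorph_nat (real_complex R)) normc_real ger0_norm.
have gd x : normc x < 1 -> cdiff g x.
  move=> x1; apply: cdiffM; first exact: cdiff_cst.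
  by apply: cdiffB; [exact: fd|exact: cdiff_cst].
have g1 x : normc x < 1 -> normc (g x) <= 1.
  move=> x1; rewrite normcM n2; have := normcB (f x) (f w).
  by have := f1 x x1; have := f1 w w1; lra.
have := @blprod_zeros [:: w] g _ isT gd g1 _ z z1.
rewrite /blprod big_seq1 normcM n2 => H.
have {H} H : 2^-1 * normc (f z - f w) <= normc (bl w z).
  apply: H => b; rewrite inE => /eqP -> //.
  by rewrite /g subrr mulr0.
have := bl_dist_le w1 (ltW z1); rewrite -mulrA; lra.
Qed.

(** The Schwarz lemma for the composition of f with the Moebius factor of f 0. *)
Lemma schwarz_pick_quarter f : (forall z, normc z < 1 -> cdiff f z) ->
  (forall z, normc z < 1 -> normc (f z) <= 1) -> normc (f 0) <= 1 / 4 ->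
  forall z, normc z <= 1 / 2 -> normc (f z) <= 7 / 8.
Proof.
move=> fd f1 f0 z z2; have z1 : normc z < 1 by lra.
have f01 : normc (f 0) < 1 by lra.
have := @schwarz (bl (f 0) \o f) _ _ _ z z1.
rewrite /= {3}/bl subrr mul0r => /(_ _ _ erefl)/wrap[||].
- move=> w w1; apply: cdiff_comp; first exact: fd.
  by apply: cdiff_bl => //; exact: f1.
- by move=> w w1; apply: bl_le1 => //; exact: f1.
move=> H; have fz1 := f1 z z1.
have nd : 0 < normc (1 - conjc (f 0) * f z) by rewrite normc_gt0 bl_den_neq0.
have {H} : normc (f z - f 0) <= normc z * normc (1 - conjc (f 0) * f z).
  by rewrite -ler_pdivrMr // -normcf_div.
have h1 := normcB 1 (conjc (f 0) * f z).
rewrite normc1 normcM normc_conj in h1.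
have h2 := normc_lower (f z) (f 0).
have h3 : normc (f 0) * normc (f z) <= 1 / 4.
  have := ler_pM (normc_ge0 _) (normc_ge0 _) f0 fz1; lra.
have : normc z * normc (1 - conjc (f 0) * f z) <= 1 / 2 * (5 / 4).
  rewrite ler_pM ?normc_ge0 //; lra.
lra.
Qed.

Lemma Re_sqrtc_ge0 z : 0 <= complex.Re (sqrtc z).
Proof. by case: z => a b; exact: sqrtr_ge0. Qed.

Lemma Re_sqrtc_gt0 z : 0 < complex.Re z -> 0 < complex.Re (sqrtc z).
Proof.
case: z => a b /= a0; rewrite sqrtr_gt0 divr_gt0 //.
by rewrite ltr_wpDl // sqrtr_ge0.
Qed.

Lemma cdiff_sqrtc z : 0 < complex.Re z -> cdiff (@sqrtc R) z.
Proof.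
move=> z0; have s0 := Re_sqrtc_gt0 z0.
have sN w : complex.Re (sqrtc z) <= normc (sqrtc w + sqrtc z).
  apply: le_trans (normc_leRe _); apply: le_trans (ler_norm _).
  by rewrite raddfD /= lerDr Re_sqrtc_ge0.
have s1 w : sqrtc w + sqrtc z != 0.
  by rewrite -normc_gt0; apply: lt_le_trans (sN w).
have E w : sqrtc w - sqrtc z = (sqrtc w + sqrtc z)^-1 * (w - z).
  have -> : w - z = sqrtc w ^+ 2 - sqrtc z ^+ 2 by rewrite !sqr_sqrtc.
  by rewrite subr_sqr mulrC mulfK.
exists (fun w => (sqrtc w + sqrtc z)^-1) => //.
apply: ccontV => //; apply: ccontD; last exact: ccont_cst.
move=> e e0; exists (e * complex.Re (sqrtc z)); first exact: mulr_gt0.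
move=> w wz; rewrite E normcM normcV mulrC ltr_pdivrMr ?normc_gt0 //.
by apply: lt_le_trans wz _; rewrite ler_wpM2l // ltW.
Qed.

(** Along each radius of the smaller disk h is a product of finitely many ratios
    h((k+1)z/N) / h(kz/N), all close to 1, where the principal branch of the square
    root applies. *)
Lemma holo_sqrt (r r' : R) h : 0 < r' < r ->
  (forall z, normc z < r -> cdiff h z) ->
  (forall z, normc z < r -> normc (h z) <= 1) ->
  (forall z, normc z < r -> h z != 0) ->
  exists s : R[i] -> R[i], forall z, normc z < r' ->
    cdiff s z /\ s z ^+ 2 = h z.
Proof.
move=> /andP[r'0 rr] hd h1 h0.
have r0 := lt_trans r'0 rr.
pose K : set R[i] := [set z | normc z <= r'].
have Kr z : K z -> normc z < r by move=> Kz; exact: le_lt_trans Kz rr.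
have K0 : K !=set0 by exists 0; rewrite /K /= normc0 ltW.
have Kc : cclosed K.
  move=> z /negP; rewrite -ltNge => zr; exists (normc z - r').
    by rewrite subr_gt0.
  move=> w wz; rewrite /K /= => wr.
  have := normc_lower z w; rewrite normc_sub; lra.
have uc z : K z -> forall e : R, 0 < e -> exists2 d : R, 0 < d & forall w,
    normc (w - z) < d -> `|- normc (h w) - - normc (h z)| < e.
  move=> /Kr/hd/cdiff_cont hc e /hc[d d0 dP]; exists d => // w /dP.
  have -> : - normc (h w) - - normc (h z) = - (normc (h w) - normc (h z)) by ring.
  by rewrite normrN => /(le_lt_trans (normc_dist _ _)).
have [y Ky ymax] := cEVT K0 (fun z => id) Kc uc.
pose c := normc (h y).
have c0 : 0 < c by rewrite normc_gt0; apply: h0; exact: Kr.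
have hc z : normc z <= r' -> c <= normc (h z) by move=> /ymax; rewrite lerN2.
have lip z w : normc z <= r' -> normc w <= r' ->
    normc (h z - h w) <= 2 / (r - r') * normc (z - w).
  move=> zr wr; pose g x := h (r%:C%C * x).
  have gr x : normc x < 1 -> normc (r%:C%C * x) < r.
    by move=> x1; rewrite normcM normc_real (gtr0_norm r0) gtr_pMr.
  have gd x : normc x < 1 -> cdiff g x.
    move=> x1; apply: (@cdiff_comp _ (fun x => r%:C%C * x) h).
      by apply: cdiffM; [exact: cdiff_cst|exact: cdiff_id].
    by apply: hd; exact: gr.
  have g1 x : normc x < 1 -> normc (g x) <= 1 by move=> /gr; exact: h1.
  have rC : (r%:C%C : R[i]) != 0 by rewrite -normc_gt0 normc_real (gtr0_norm r0).
  have nr x : normc (x / r%:C%C) = normc x / r.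
    by rewrite normcf_div normc_real (gtr0_norm r0).
  have [z1 w1] : normc (z / r%:C%C) < 1 /\ normc (w / r%:C%C) < 1.
    by rewrite !nr !ltr_pdivrMr // !mul1r; split; apply: le_lt_trans rr.
  have := bounded_lipschitz gd g1 z1 w1.
  rewrite /g !(mulrC r%:C%C) !divfK // -mulrBl !nr => /le_trans; apply.
  have rw : 0 < r - normc w by lra.
  have -> : 2 * (normc (z - w) / r) / (1 - normc w / r) =
      2 / (r - normc w) * normc (z - w).
    by field; rewrite !gt_eqF.
  rewrite ler_wpM2r ?normc_ge0 // ler_pM2l // lef_pV2 ?posrE //; lra.
pose L := 2 / (r - r').
have L0 : 0 < L by rewrite divr_gt0 // subr_gt0.
have [N N0 NP] : exists2 N : nat, (0 < N)%N & L * r' / c < N%:R.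
  have := archi_boundP (ltW (divr_gt0 (mulr_gt0 L0 r'0) c0)).
  by exists (Num.bound (L * r' / c)).+1 => //; rewrite -natr1; lra.
have N0' : 0 < N%:R :> R by rewrite ltr0n.
pose p (k : nat) : R[i] := (k%:R / N%:R : R)%:C%C.
have np k z : (k <= N)%N -> normc (p k * z) <= normc z.
  move=> kN; rewrite normcM normc_real ger0_norm ?divr_ge0 //.
  by rewrite ler_piMl ?normc_ge0 // ler_pdivrMr // mul1r ler_nat.
pose q k z := h (p k.+1 * z) / h (p k * z).
have hz k z : (k <= N)%N -> normc z < r' -> h (p k * z) != 0.
  by move=> kN zr; apply: h0; apply: le_lt_trans (np _ _ kN) _; exact: lt_trans rr.
have qRe k z : (k < N)%N -> normc z < r' -> 0 < complex.Re (q k z).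
  move=> kN zr; have kN' := ltnW kN.
  have zk := le_trans (np k z kN') (ltW zr).
  have zk1 := le_trans (np k.+1 z kN) (ltW zr).
  have : normc (q k z - 1) < 1.
    have -> : q k z - 1 = (h (p k.+1 * z) - h (p k * z)) / h (p k * z).
      by rewrite /q mulrBl divff // hz.
    rewrite normcf_div ltr_pdivrMr ?normc_gt0 ?hz // mul1r.
    apply: lt_le_trans (hc _ zk); apply: le_lt_trans (lip _ _ zk1 zk) _.
    have -> : p k.+1 * z - p k * z = (N%:R^-1 : R)%:C%C * z.
      rewrite -mulrBl /p -rmorphB /= -mulrBl -natr1.
      by rewrite addrC addKr mul1r.
    rewrite normcM normc_real ger0_norm ?invr_ge0 // -/L.
    move: NP; rewrite ltr_pdivrMr // => NP.
    apply: le_lt_trans (_ : L * (N%:R^-1 * r') < c).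
      by rewrite ler_pM2l // ler_pM2l ?invr_gt0 // ltW.
    by rewrite mulrCA mulrC ltr_pdivrMr // [ltRHS]mulrC.
  have := normc_leRe (q k z - 1); rewrite raddfB /= ler_norml => /andP[+ _]; lra.
pose s z := sqrtc (h 0) * \prod_(k < N) sqrtc (q k z).
exists s => z zr; split.
  apply: cdiffM; first exact: cdiff_cst.
  apply: (@cdiff_prod _ _ _ (fun (k : 'I_N) w => sqrtc (q k w))) => k.
  apply: (@cdiff_comp _ (q k) (@sqrtc R)); last first.
    by apply: cdiff_sqrtc; exact: qRe.
  have hp j : (j <= N)%N -> cdiff (fun w => h (p j * w)) z.
    move=> jN; apply: (@cdiff_comp _ (fun x => p j * x) h).
      by apply: cdiffM; [exact: cdiff_cst|exact: cdiff_id].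
    by apply: hd; apply: le_lt_trans (np _ _ jN) _; exact: lt_trans rr.
  apply: cdiffM; first exact: hp.
  apply: cdiffV; first by rewrite hz // ltnW.
  by apply: hp; rewrite ltnW.
rewrite /s exprMn sqr_sqrtc -prodrXl.
under eq_bigr do rewrite sqr_sqrtc.
have tele n : (n <= N)%N -> h 0 * \prod_(k < n) q k z = h (p n * z).
  elim: n => [_|n IH nN].
    have p0 : p 0%N = 0 by rewrite /p mul0r.
    by rewrite big_ord0 mulr1 p0 mul0r.
  by rewrite big_ord_recr /= mulrA IH ?(ltnW nN) // /q mulrC divfK // hz // ltnW.
by rewrite tele // /p divff ?gt_eqF // mul1r.
Qed.

(** Harnack's inequality for log |h|, h zero-free: after k square roots the value
    at the centre is at most 1/4 in modulus, where the Schwarz-Pick estimate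
    applies. *)
Lemma harnack_zero_free k (r : R) h : 1 < r ->
  (forall z, normc z < r -> cdiff h z) ->
  (forall z, normc z < r -> normc (h z) <= 1) ->
  (forall z, normc z < r -> h z != 0) ->
  normc (h 0) <= (1 / 4) ^+ (2 ^ k) ->
  forall z, normc z <= 1 / 2 -> normc (h z) <= (7 / 8) ^+ (2 ^ k).
Proof.
elim: k r h => [|k IH] r h r1 hd h1 h0 hh z z2.
  apply: (@schwarz_pick_quarter h) => // w w1.
    by apply: hd; exact: lt_trans r1.
  by apply: h1; exact: lt_trans r1.
have rr : 0 < (1 + r) / 2 < r by apply/andP; split; lra.
have [s sP] := holo_sqrt rr hd h1 h0.
have rle w : normc w < (1 + r) / 2 -> normc w < r by lra.
have sq w : normc w < (1 + r) / 2 -> normc (s w) ^+ 2 = normc (h w).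
  by move=> /sP[_ <-]; rewrite normcX.
have z3 : normc z < (1 + r) / 2 by lra.
have p2 : (2 ^ k.+1 = 2 ^ k * 2)%N by rewrite expnS mulnC.
rewrite -sq // p2 exprM ler_sqr ?nnegrE ?normc_ge0 ?exprn_ge0 //.
apply: (IH ((1 + r) / 2) s) => //; first by lra.
- by move=> w /sP[].
- move=> w wr; rewrite -(@expr_le1 _ 2) ?normc_ge0 // sq //.
  by apply: h1; exact: rle.
- move=> w wr; have [_ sw] := sP w wr.
  by apply: contraNneq (h0 w (rle w wr)) => s0; rewrite -sw s0 expr0n.
rewrite -ler_sqr ?nnegrE ?normc_ge0 ?exprn_ge0 // -exprM -p2 sq // normc0.
by lra.
Qed.

End Blaschke.

(** * Angles and chords *)

Section Trigonometry.
Variable R : realType.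

Lemma sin_mvt (x : R) : exists2 c, `|c| <= `|x| & sin x = cos c * x.
Proof.
suff H (y : R) : 0 <= y -> exists2 c, `|c| <= `|y| & sin y = cos c * y.
  have [/H //|/ltW x0] := leP 0 x.
  have [|c c1 c2] := H (- x); first by rewrite oppr_ge0.
  exists c; first by rewrite normrN in c1.
  by move: c2; rewrite sinN mulrN => /oppr_inj.
move=> y0.
have [c cI E] := @MVT_segment R sin cos 0 y y0
  (fun x _ => is_derive_sin x) (continuous_subspaceT (@continuous_sin R)).
move: cI; rewrite in_itv /= => /andP[c0 cy]; rewrite sin0 !subr0 in E.
by exists c => //; rewrite !ger0_norm.
Qed.

Lemma sin_le (x : R) : `|sin x| <= `|x|.
Proof.
have [c _ ->] := sin_mvt x; rewrite normrM ler_piMl //.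
exact: cos_max.
Qed.

Lemma cos_piquarter_ge : 1 / 2 <= cos (pi / 4) :> R.
Proof.
have := cos_mulr2n (pi / 4 : R).
have -> : pi / 4 *+ 2 = pi / 2 :> R by rewrite mulr2n; field.
rewrite cos_pihalf => E.
have : 0 <= cos (pi / 4 : R).
  by apply: cos_ge0_pihalf; have := pi_gt0 R; lra.
by move: E; rewrite mulr2n; nra.
Qed.

Lemma sin_ge (x : R) : 0 <= x -> x <= 1 / 2 -> x / 2 <= sin x.
Proof.
move=> x0 x1; have [c + ->] := sin_mvt x; rewrite (ger0_norm x0) => cx.
have := pi_ge2 R => pi2.
have : cos (pi / 4) <= cos c.
  rewrite -[leRHS]cos_norm; have c0 := normr_ge0 c.
  have [->|ne] := eqVneq `|c| (pi / 4); first exact: lexx.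
  have lt : `|c| < pi / 4 by rewrite lt_neqAle ne; lra.
  apply: ltW; rewrite ltr_cos // in_itv /=; apply/andP; split=> //; lra.
by have := cos_piquarter_ge; nra.
Qed.

Lemma normc_expiB (s t : R) : normc (expi s - expi t) = 2 * `|sin ((s - t) / 2)|.
Proof.
apply/eqP; rewrite -(@eqrXn2 _ 2) ?normc_ge0 ?mulr_ge0 //; apply/eqP.
rewrite normc_sqr exprMn real_normK ?num_real // sin2cos2 /=.
have : cos (s - t) = cos ((s - t) / 2) ^+ 2 *+ 2 - 1.
  by rewrite -cos_mulr2n; congr cos; rewrite mulr2n; field.
rewrite mulr2n cosB; have := cos2Dsin2 s; have := cos2Dsin2 t.
by move=> h1 h2 h3; lra.
Qed.

Lemma normc_expiB_le (s t : R) : normc (expi s - expi t) <= `|s - t|.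
Proof.
rewrite normc_expiB; have := sin_le ((s - t) / 2).
rewrite normrM (ger0_norm (_ : 0 <= 2^-1)) ?invr_ge0 //; lra.
Qed.

Lemma normc_expiB_ge (s t : R) : `|s - t| <= 1 ->
  `|s - t| / 2 <= normc (expi s - expi t).
Proof.
move=> st; rewrite normc_expiB.
wlog : s t st / t <= s => [H|ts].
  have [/H->//|/ltW/H] := leP t s; rewrite distrC => /(_ st).
  by rewrite -[sin ((t - s) / 2)]opprK -sinN normrN -mulNr opprB.
have st0 : 0 <= s - t by rewrite subr_ge0.
move: st; rewrite (ger0_norm st0) => st.
have := @sin_ge ((s - t) / 2); have := ler_norm (sin ((s - t) / 2)); lra.
Qed.

Lemma polar (z : R[i]) : exists2 t, 0 <= t < 2 * pi & z = (normc z)%:C%C * expi t.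
Proof.
have pi0 := pi_gt0 R.
have [->|z0] := eqVneq z 0.
  exists 0; first by rewrite lexx mulr_gt0.
  by rewrite normc0 mul0r.
have nz : 0 < normc z by rewrite normc_gt0.
pose x := complex.Re z / normc z; pose y := complex.Im z / normc z.
have xy : x ^+ 2 + y ^+ 2 = 1.
  rewrite /x /y !expr_div_n -mulrDl -normc_sqr divff // expf_neq0 //.
  by rewrite gt_eqF.
have x1 : -1 <= x <= 1.
  have := sqr_ge0 y => y0; apply/andP; split; nra.
have zE : z = (normc z)%:C%C * Complex x y.
  rewrite {1}[z]Complex_eta.
  by congr Complex; rewrite /x /y; field; rewrite gt_eqF.
have s1 : sin (acos x) = `|y|.
  by rewrite sin_acos // -xy addrC addKr sqrtr_sqr.
have c1 : cos (acos x) = x by rewrite acosK // in_itv.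
have a0 := acos_ge0 x1; have a1 := acos_lepi x1.
have [y0|y0] := leP 0 y.
  exists (acos x); first by apply/andP; split => //; lra.
  by rewrite {1}zE /expi c1 s1 ger0_norm.
have a2 : 0 < acos x.
  rewrite lt_def a0 andbT; apply/eqP => E.
  by move: s1; rewrite E sin0 => /esym/normr0_eq0 yy; rewrite yy ltxx in y0.
exists (2 * pi - acos x); first by apply/andP; split; lra.
rewrite {1}zE /expi; congr (_ * Complex _ _).
  by rewrite cosB mulr_natl cos2pi sin2pi mul1r mul0r addr0.
by rewrite sinB mulr_natl cos2pi sin2pi mul1r mul0r sub0r s1 ltr0_norm // opprK.
Qed.

End Trigonometry.

(** * Packing and greedy selection *)

Section Packing.
Variables (R : realType) (T : eqType).
Implicit Types (s : seq T) (t d : T -> R).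

Lemma seq_argmin s t : s != [::] -> exists2 x, x \in s & forall y, y \in s -> t x <= t y.
Proof.
elim: s => [//|a s IH _]; have [->|s0] := eqVneq s [::].
  by exists a => [|y]; rewrite inE // => /eqP ->.
have [x xs xm] := IH s0; have [ax|xa] := leP (t a) (t x).
  exists a; first exact: mem_head.
  by move=> y; rewrite inE => /predU1P[->//|/xm]; exact: le_trans ax.
exists x; first by rewrite inE xs orbT.
by move=> y; rewrite inE => /predU1P[->|/xm //]; exact: ltW.
Qed.

(** Disjoint intervals of centre t and radius d in the half-line from D: the sum
    of d / t^2 is dominated by half the integral of 1 / x^2, computed here by
    peeling off the leftmost interval. *)
Lemma packing_side s t d (D : R) : uniq s -> 0 < D ->
  (forall x, x \in s -> 0 < d x) -> (forall x, x \in s -> D + d x <= t x) ->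
  (forall x y, x \in s -> y \in s -> x != y -> d x + d y <= `|t x - t y|) ->
  \sum_(x <- s) d x / t x ^+ 2 <= (2 * D)^-1.
Proof.
elim: {s}(size s) {-2}s (erefl (size s)) D => [|n IH] s sz D us D0 d0 Dt dis.
  by rewrite (size0nil sz) big_nil invr_ge0 mulr_ge0 // ltW.
have [|x xs xm] := @seq_argmin s t; first by rewrite -size_eq0 sz.
rewrite (perm_big _ (perm_to_rem xs)) big_cons /=.
have sub y : y \in rem x s -> y \in s by exact: mem_rem.
have dx := d0 x xs; have Dx := Dt x xs.
have ne y : y \in rem x s -> x != y.
  by move=> yr; apply: contraTneq yr => <-; rewrite mem_rem_uniqF.
have H : \sum_(y <- rem x s) d y / t y ^+ 2 <= (2 * (t x + d x))^-1.
  apply: IH; rewrite ?size_rem ?sz ?rem_uniq //; first by lra.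
  - by move=> y /sub/d0.
  - move=> y yr; have := dis x y xs (sub y yr) (ne y yr).
    have := xm y (sub y yr); rewrite distrC => h.
    by rewrite ger0_norm ?subr_ge0 //; lra.
  - by move=> y z /sub ys /sub zs; exact: dis.
have tx : 0 < t x - d x by lra.
have txp : 0 < t x + d x by lra.
have tx0 : 0 < t x by lra.
have step : d x / t x ^+ 2 <= (2 * (t x - d x))^-1 - (2 * (t x + d x))^-1.
  have -> : (2 * (t x - d x))^-1 - (2 * (t x + d x))^-1 =
     d x / ((t x - d x) * (t x + d x)) by field; rewrite !gt_eqF.
  rewrite ler_pM2l // lef_pV2 ?posrE ?mulr_gt0 ?exprn_gt0 //.
  by rewrite -subr_sqr gerBl sqr_ge0.
have : (2 * (t x - d x))^-1 <= (2 * D)^-1.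
  rewrite lef_pV2 ?posrE ?mulr_gt0 //; lra.
lra.
Qed.

(** The two sides of the interval of x are two applications of the half-line bound
    with D = d x. *)
Lemma packing_line s t d x : uniq s -> x \in s ->
  (forall y, y \in s -> 0 < d y) ->
  (forall y z, y \in s -> z \in s -> y != z -> d y + d z <= `|t y - t z|) ->
  \sum_(y <- s | y != x) d x * d y / (t y - t x) ^+ 2 <= 1.
Proof.
move=> us xs d0 dis; have dx := d0 x xs.
have side (e : R) : e = 1 \/ e = -1 ->
    \sum_(y <- s | (y != x) && (0 < e * (t y - t x))) d x * d y / (t y - t x) ^+ 2 <= 2^-1.
  move=> e1; have e2 : e ^+ 2 = 1 by case: e1 => ->; rewrite ?sqrrN expr1n.
  have ne : `|e| = 1 by case: e1 => ->; rewrite ?normrN normr1.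
  rewrite -big_filter; set s' := [seq y <- s | _].
  have s'P y : y \in s' -> [/\ y \in s, y != x & 0 < e * (t y - t x)].
    by rewrite mem_filter => /andP[/andP[? ?] ?].
  have H : \sum_(y <- s') d y / (e * (t y - t x)) ^+ 2 <= (2 * d x)^-1.
    apply: packing_side => //; first exact: filter_uniq.
    - by move=> y /s'P[/d0].
    - move=> y /s'P[ys yx ey]; rewrite -(gtr0_norm ey) normrM ne mul1r addrC.
      exact: dis.
    - move=> y z /s'P[ys _ _] /s'P[zs _ _] yz.
      rewrite -mulrBr normrM ne mul1r (_ : t y - t x - (t z - t x) = t y - t z).
        exact: dis.
      by ring.
  rewrite (eq_bigr (fun y => d x * (d y / (e * (t y - t x)) ^+ 2))) => [|y _].
    rewrite -mulr_sumr; apply: le_trans (ler_wpM2l (ltW dx) H) _.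
    by rewrite invfM mulrCA divff ?mulr1 // gt_eqF.
  by rewrite exprMn e2 mul1r mulrA.
rewrite (bigID (fun y => 0 < 1 * (t y - t x))) /=.
have -> : \sum_(y <- s | (y != x) && ~~ (0 < 1 * (t y - t x)))
    d x * d y / (t y - t x) ^+ 2 =
  \sum_(y <- s | (y != x) && (0 < -1 * (t y - t x))) d x * d y / (t y - t x) ^+ 2.
  rewrite big_seq_cond [RHS]big_seq_cond; apply: eq_bigl => y.
  case ys: (y \in s) => //=; case yx: (y != x) => //=.
  have := dis y x ys xs yx; have := d0 y ys.
  rewrite mul1r mulN1r opprB !subr_gt0 -leNgt => dy.
  by case: (ltgtP (t y) (t x)) => // ->; rewrite subrr normr0; lra.
have := side 1 (or_introl erefl); have := side (-1) (or_intror erefl); lra.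
Qed.

(** Greedy (Vitali-type) selection: the element of largest radius absorbs
    everything within 4 times its radius. *)
Lemma greedy s (dist : T -> T -> R) d :
  (forall x y, dist x y = dist y x) -> (forall x, dist x x = 0) ->
  (forall x, x \in s -> 0 < d x) ->
  exists s', [/\ uniq s', {subset s' <= s},
    forall x y, x \in s' -> y \in s' -> x != y -> 4 * Num.max (d x) (d y) <= dist x y &
    forall y, y \in s -> exists2 x, x \in s' & dist x y < 4 * d x /\ d y <= d x].
Proof.
move=> dC d0; elim: {s}(size s) {-2}s (leqnn (size s)) => [|n IH] s sz pos.
  move: sz; rewrite leqn0 => /eqP/size0nil ->; exists [::]; split => //.
have [->|s0] := eqVneq s [::]; first by exists [::]; split.
have [x xs xm] := seq_argmin (fun y => - d y) s0.
pose s1 := [seq y <- s | 4 * d x <= dist x y].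
have dx := pos x xs.
have s1P y : y \in s1 = (4 * d x <= dist x y) && (y \in s) by rewrite mem_filter.
have sz1 : (size s1 <= n)%N.
  rewrite -ltnS; apply: leq_trans sz; rewrite /s1 size_filter.
  rewrite -[ltnRHS](count_predC (fun y => 4 * d x <= dist x y)) -[ltnLHS]addn0.
  rewrite ltn_add2l -has_count; apply/hasP; exists x => //=; rewrite d0; lra.
have [|s' [us' ss' sep cov]] := IH s1 sz1.
  by move=> y; rewrite s1P => /andP[_ /pos].
exists (x :: s'); split.
- rewrite /= us' andbT; apply/negP => /ss'; rewrite s1P d0; lra.
- by move=> y; rewrite inE => /predU1P[->//|/ss']; rewrite s1P => /andP[].
- have sepx y : y \in s' -> 4 * Num.max (d x) (d y) <= dist x y.
    move=> /ss'; rewrite s1P => /andP[xy ys].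
    have := xm y ys; rewrite lerN2 => yx.
    by rewrite max_l.
  move=> y z; rewrite !inE => /predU1P[->|ys] /predU1P[->|zs].
  + by rewrite eqxx.
  + by move=> _; exact: sepx.
  + by move=> _; rewrite dC maxC; exact: sepx.
  + exact: sep.
- move=> y ys; have [xy|yx] := ltP (dist x y) (4 * d x).
    exists x; first exact: mem_head.
    by split => //; have := xm y ys; rewrite lerN2.
  have [|z zs zP] := cov y; first by rewrite s1P yx.
  by exists z; rewrite ?inE ?zs ?orbT.
Qed.

End Packing.

(** * Blaschke sums and spread families *)

Section WeakType.
Variables (R : realType) (f : R[i] -> R[i]) (z0 : R[i]).
Hypothesis fd : forall z, normc z < 1 -> cdiff f z.
Hypothesis f1 : forall z, normc z < 1 -> normc (f z) <= 1.
Hypothesis z01 : normc z0 < 1.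
Hypothesis fz0 : f z0 != 0.
Implicit Types (s : seq R[i]) (b z : R[i]).

(** A rate at which the factor of b is small at z0: 1 - |bl b z0|^2 is at least
    (1 - |z0|^2) (1 - |b|) / 4, and the square costs another factor 2. *)
Definition base_cst : R := (1 - normc z0 ^+ 2) / 8.

Lemma base_cst_gt0 : 0 < base_cst.
Proof. by rewrite divr_gt0 // subr_gt0 sqr_lt1 ?normc_ge0. Qed.

Lemma bl_base b : normc b < 1 -> normc (bl b z0) <= expR (- (base_cst * (1 - normc b))).
Proof.
move=> b1; have b0 := normc_ge0 b; have w0 := normc_ge0 z0.
have d2 : normc (1 - conjc b * z0) ^+ 2 <= 4.
  have -> : 4 = 2 ^+ 2 :> R by rewrite -natrX.
  by rewrite ler_sqr ?nnegrE ?normc_ge0 // bl_den_le // ltW.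
have dp : 0 < normc (1 - conjc b * z0) ^+ 2.
  by rewrite exprn_gt0 // normc_gt0 bl_den_neq0 // ltW.
have z02 : 0 < 1 - normc z0 ^+ 2 by rewrite subr_gt0 sqr_lt1.
have H : (1 - normc z0 ^+ 2) * (1 - normc b) / 4 <= 1 - normc (bl b z0) ^+ 2.
  rewrite bl_sqr ?(ltW z01) //; apply: ler_pM.
  - by rewrite mulr_ge0 ?(ltW z02) // subr_ge0 ltW.
  - by rewrite invr_ge0.
  - by rewrite ler_wpM2l ?(ltW z02) //; nra.
  - by rewrite lef_pV2 ?posrE.
have := @expR_ge1Dx R (- (base_cst * (1 - normc b))).
apply: le_trans; rewrite /base_cst; have := normc_ge0 (bl b z0).
move: H; move: (normc (bl b z0)) => r H r0.
have : r <= (1 + r ^+ 2) / 2 by have := sqr_ge0 (r - 1); lra.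
lra.
Qed.

Lemma blprod_base s : in_disk s ->
  normc (blprod s z0) <= expR (- (base_cst * \sum_(b <- s) (1 - normc b))).
Proof.
elim: s => [_|b s IH /in_disk_cons[b1 /IH sd]].
  by rewrite /blprod !big_nil mulr0 oppr0 expR0 normc1.
rewrite /blprod !big_cons normcM mulrDr opprD expRD.
by rewrite ler_pM ?normc_ge0 // bl_base.
Qed.

Definition log_base : R := - ln (normc (f z0)).

Lemma normc_fz0 : normc (f z0) = expR (- log_base).
Proof. by rewrite /log_base opprK lnK // posrE normc_gt0. Qed.

Lemma log_base_ge0 : 0 <= log_base.
Proof. by rewrite oppr_ge0 ln_le0 // f1. Qed.

(** Converse reading of the bound at z0: a Blaschke product that is not too small
    there has few zeros. *)
Lemma blaschke_sum_from_product s (x : R) : in_disk s ->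
  expR (- x) <= normc (blprod s z0) -> \sum_(b <- s) (1 - normc b) <= x / base_cst.
Proof.
move=> sd h; rewrite ler_pdivlMr ?base_cst_gt0 // mulrC.
have := le_trans h (blprod_base sd); rewrite ler_expR lerN2.
exact.
Qed.

Lemma zeros_blaschke_sum s : uniq s -> in_disk s -> (forall b, b \in s -> f b = 0) ->
  \sum_(b <- s) (1 - normc b) <= log_base / base_cst.
Proof.
move=> us sd sz; apply: blaschke_sum_from_product => //.
by rewrite -normc_fz0 blprod_zeros.
Qed.

(** The families for which the packing bound on the line applies: in a sector of
    opening 1 chords are comparable to angles, and the factor 4 in the separation
    makes the intervals of radius 1 - |b| around the angles disjoint. *)
Definition spread s (tau : R[i] -> R) (th : R) :=
  [/\ uniq s, in_disk s,
   forall b, b \in s -> th <= tau b <= th + 1 /\ b = (normc b)%:C%C * expi (tau b) &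
   forall b c, b \in s -> c \in s -> b != c ->
     4 * Num.max (1 - normc b) (1 - normc c) <= normc (b - c)].

Lemma polar_dist_sqr (p q s t : R) :
  normc (p%:C%C * expi s - q%:C%C * expi t) ^+ 2 =
  (p - q) ^+ 2 + p * q * normc (expi s - expi t) ^+ 2.
Proof.
rewrite !normc_sqr /= !mul0r !subr0 !addr0.
have hs := cos2Dsin2 s; have ht := cos2Dsin2 t.
have -> : (p * cos s - q * cos t) ^+ 2 + (p * sin s - q * sin t) ^+ 2 =
  p ^+ 2 * (cos s ^+ 2 + sin s ^+ 2) + q ^+ 2 * (cos t ^+ 2 + sin t ^+ 2) -
  2 * (p * q) * (cos s * cos t + sin s * sin t) by ring.
have -> : (cos s - cos t) ^+ 2 + (sin s - sin t) ^+ 2 =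
  (cos s ^+ 2 + sin s ^+ 2) + (cos t ^+ 2 + sin t ^+ 2) -
  2 * (cos s * cos t + sin s * sin t) by ring.
by rewrite hs ht; ring.
Qed.

Lemma spread_dist s tau th b c : spread s tau th -> b \in s -> c \in s -> b != c ->
  [/\ (1 - normc b) + (1 - normc c) <= `|tau b - tau c|,
      (tau b - tau c) ^+ 2 / 16 <= normc (b - c) ^+ 2 &
      1 - normc b <= 1 / 2].
Proof.
move=> [_ sd pol sep] bs cs bc.
have [tb bE] := pol b bs; have [tc cE] := pol c cs.
have b1 := sd b bs; have c1 := sd c cs.
have D := sep b c bs cs bc.
have D1 : 4 * (1 - normc b) <= normc (b - c).
  by apply: le_trans D; rewrite ler_pM2l // le_max lexx.
have D2 : 4 * (1 - normc c) <= normc (b - c).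
  by apply: le_trans D; rewrite ler_pM2l // le_max lexx orbT.
have bc2 := normcB b c.
have tt : `|tau b - tau c| <= 1 by rewrite ler_norml; lra.
have up : normc (b - c) <= `|normc b - normc c| + `|tau b - tau c|.
  rewrite {1}bE {1}cE.
  have -> : (normc b)%:C%C * expi (tau b) - (normc c)%:C%C * expi (tau c) =
    (normc b - normc c)%:C%C * expi (tau b) +
    (normc c)%:C%C * (expi (tau b) - expi (tau c)) by rewrite rmorphB /=; ring.
  apply: le_trans (normcD _ _) _; rewrite !normcM !normc_real normc_expi mulr1.
  rewrite lerD2l (ger0_norm (normc_ge0 c)).
  have := normc_expiB_le (tau b) (tau c).
  have := normc_ge0 (expi (tau b) - expi (tau c)); have := normc_ge0 c; nra.
split; last by lra.
  have : `|normc b - normc c| <= Num.max (1 - normc b) (1 - normc c).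
    by rewrite ler_norml le_max; apply/andP; split; [rewrite lerNl le_max|]; lra.
  move: D1 D2 up; lra.
rewrite {2}bE {2}cE polar_dist_sqr.
have := normc_expiB_ge tt; have := normr_ge0 (tau b - tau c) => t0 h.
have hb : 1 / 2 <= normc b by lra.
have hc : 1 / 2 <= normc c by lra.
have h2 : (tau b - tau c) ^+ 2 / 4 <= normc (expi (tau b) - expi (tau c)) ^+ 2.
  have -> : (tau b - tau c) ^+ 2 / 4 = (`|tau b - tau c| / 2) ^+ 2.
    by rewrite expr_div_n real_normK ?num_real // -natrX.
  by rewrite ler_sqr ?nnegrE ?normc_ge0 // divr_ge0.
have := sqr_ge0 (normc b - normc c).
have hbc : 1 / 4 <= normc b * normc c by nra.
have := ler_pM _ (sqr_ge0 (tau b - tau c)) hbc; nra.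
Qed.

(** The packing bound for the angles; the factor 16 is the square of the loss in
    passing from angles to distances. *)
Lemma spread_packing s tau th b : spread s tau th -> b \in s ->
  \sum_(c <- s | c != b) (1 - normc b) * (1 - normc c) / normc (c - b) ^+ 2 <= 16.
Proof.
move=> sp bs; have [us sd _ _] := sp.
have d0 c : c \in s -> 0 < 1 - normc c by move=> /sd; rewrite subr_gt0.
have H := @packing_line R _ s tau (fun c => 1 - normc c) b us bs d0.
apply: le_trans (_ : 16 * \sum_(c <- s | c != b) (1 - normc b) * (1 - normc c) /
  (tau c - tau b) ^+ 2 <= _); last first.
  rewrite -[leRHS]mulr1 ler_wpM2l //; apply: H => c c' cs cs' cc.
  by have [] := spread_dist sp cs cs' cc.
rewrite mulr_sumr big_seq_cond [leRHS]big_seq_cond.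
apply: ler_sum => c /andP[cs cb].
have [h1 h2 _] := spread_dist sp cs bs cb.
have dc := d0 c cs; have db := d0 b bs.
have t0 : 0 < (tau c - tau b) ^+ 2.
  by rewrite -[ltRHS]real_normK ?num_real // exprn_gt0 //; lra.
rewrite [leRHS]mulrCA ler_wpM2l ?mulr_ge0 ?(ltW dc) ?(ltW db) //.
rewrite -[16 in leRHS]invrK -invfM lef_pV2 ?posrE.
- by rewrite mulrC.
- by apply: lt_le_trans h2; rewrite divr_gt0.
- by rewrite mulr_gt0 // invr_gt0.
Qed.

Lemma expR_le_1B (x : R) : 0 <= x -> x <= 1 / 2 -> expR (- (2 * x)) <= 1 - x.
Proof.
move=> x0 x1; rewrite expRN -[leRHS]invrK lef_pV2 ?posrE ?expR_gt0 ?invr_gt0 //; last by lra.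
apply: le_trans (@expR_ge1Dx R (2 * x)).
rewrite -[leRHS]invrK lef_pV2 ?posrE ?invr_gt0; try lra.
rewrite -[leLHS]mul1r ler_pdivrMr; nra.
Qed.

Variable delta : R.
Hypothesis delta0 : 0 < delta.
Hypothesis delta1 : delta <= 1 / 2.

Definition hole b : R := delta / 4 * (1 - normc b).

(** The factor of b itself is at least delta / 12 on the boundary of its hole, and
    the other factors contribute exp (- 80), where 80 is 5 times the packing bound. *)
Definition hole_cst : R := delta / 12 * expR (- 80).

Lemma hole_cst_gt0 : 0 < hole_cst.
Proof. by rewrite mulr_gt0 ?expR_gt0 // divr_gt0. Qed.

(** On the boundary of the hole around one of the points, the factors of the other
    points contribute a bounded amount to -log |B|, by the packing bound. *)
Lemma blprod_hole s tau th b z : spread s tau th -> b \in s ->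
  normc z < 1 -> normc (z - b) = hole b -> hole_cst <= normc (blprod s z).
Proof.
move=> sp bs z1 zb; have [us sd _ sep] := sp; have b1 := sd b bs.
have db : 0 < 1 - normc b by rewrite subr_gt0.
have hb : hole b <= (1 - normc b) / 8.
  by have := ler_wpM2r (ltW db) delta1; rewrite /hole; lra.
have hb0 : 0 < hole b by rewrite mulr_gt0 // divr_gt0.
have zd : 1 - normc z <= 9 / 8 * (1 - normc b).
  have := normc_lower b z; rewrite normc_sub zb; lra.
have sE : blprod s z = bl b z * blprod (rem b s) z.
  by rewrite /blprod (perm_big _ (perm_to_rem bs)) big_cons.
rewrite sE normcM /hole_cst; apply: ler_pM; rewrite ?expR_ge0 ?divr_ge0 //.
- by rewrite ltW.
- rewrite normcf_div zb.
  have den : normc (1 - conjc b * z) <= 3 * (1 - normc b).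
    have -> : 1 - conjc b * z = (1 - conjc b * b) - conjc b * (z - b) by ring.
    apply: le_trans (normcB _ _) _; rewrite normcM normc_conj zb.
    have -> : 1 - conjc b * b = (1 - normc b ^+ 2)%:C%C.
      rewrite normc_sqr; case: (b) => p q; apply/eqP; rewrite eq_complex /=.
      by apply/andP; split; apply/eqP; ring.
    rewrite normc_real ger0_norm ?subr_ge0 ?sqr_le1 ?normc_ge0 ?(ltW b1) //.
    by have := normc_ge0 b; nra.
  have dp : 0 < normc (1 - conjc b * z) by rewrite normc_gt0 bl_den_neq0 // ltW.
  rewrite ler_pdivlMr //; apply: le_trans (ler_wpM2l _ den) _.
    by rewrite divr_ge0 // ltW.
  by rewrite /hole le_eqVlt; apply/orP; left; apply/eqP; field.
have rs : uniq (rem b s) by rewrite rem_uniq.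
pose x c : R := 5 * ((1 - normc b) * (1 - normc c) / normc (c - b) ^+ 2).
have X c : c \in rem b s -> expR (- (2 * x c)) <= normc (bl c z) ^+ 2.
  rewrite mem_rem_uniq // !inE => /andP[cb cs]; have c1 := sd c cs.
  have dc : 0 < 1 - normc c by rewrite subr_gt0.
  have D := sep c b cs bs cb; set D0 := normc (c - b) in D *.
  have D1 : 4 * (1 - normc b) <= D0.
    by apply: le_trans D; rewrite ler_pM2l // le_max lexx orbT.
  have D2 : 4 * (1 - normc c) <= D0.
    by apply: le_trans D; rewrite ler_pM2l // le_max lexx.
  have Dp : 0 < D0 by lra.
  have zc : 31 / 32 * D0 <= normc (1 - conjc c * z).
    apply: le_trans (_ : normc (z - c) <= _).
      have := normc_tri c z b; rewrite zb (normc_sub c z) -/D0; lra.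
    have := bl_le1 c1 (ltW z1); rewrite normcf_div ler_pdivrMr ?mul1r //.
    by rewrite normc_gt0 bl_den_neq0 // ltW.
  have x0 : 0 <= x c.
    by rewrite /x !mulr_ge0 ?invr_ge0 ?exprn_ge0 ?normc_ge0 // ltW.
  have x2 : x c <= 1 / 2.
    rewrite /x -/D0 mulrA ler_pdivrMr ?exprn_gt0 //; nra.
  apply: le_trans (expR_le_1B x0 x2) _.
  rewrite lerBlDr -lerBlDl bl_sqr ?(ltW z1) //.
  rewrite /x mulrA; apply: le_trans (_ : (9 / 4 * (1 - normc b)) * (2 * (1 - normc c)) /
     (31 / 32 * D0) ^+ 2 <= _).
    have nz := normc_ge0 z; have nc := normc_ge0 c.
    apply: ler_pM.
    - by apply: mulr_ge0; rewrite subr_ge0 sqr_le1 // ltW.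
    - by rewrite invr_ge0 sqr_ge0.
    - apply: ler_pM; rewrite ?subr_ge0 ?sqr_le1 ?(ltW z1) ?(ltW c1) //; nra.
    have q0 : 0 < 31 / 32 * D0 by rewrite mulr_gt0.
    rewrite lef_pV2 ?posrE ?exprn_gt0 // ?(lt_le_trans q0) //.
    by rewrite ler_sqr ?nnegrE ?normc_ge0 // ltW.
  rewrite -/D0 exprMn invfM [leLHS]mulrA ler_wpM2r ?invr_ge0 ?sqr_ge0 //.
  have : 0 < (1 - normc b) * (1 - normc c) by rewrite mulr_gt0.
  move: (1 - normc b) (1 - normc c) => u v uv.
  rewrite ler_pdivrMr ?exprn_gt0 ?divr_gt0 //; nra.
have S : \sum_(c <- rem b s) x c <= 80.
  have := spread_packing sp bs.
  rewrite -big_filter -rem_filter // -mulr_sumr; lra.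
rewrite -ler_sqr ?nnegrE ?expR_ge0 ?normc_ge0 //.
apply: le_trans (_ : expR (- (2 * \sum_(c <- rem b s) x c)) <= _).
  by rewrite -expRM_natl ler_expR; lra.
move: X {S}; rewrite /blprod; elim: (rem b s) => [_|c l IH X].
  by rewrite !big_nil mulr0 oppr0 expR0 normc1 expr1n.
rewrite !big_cons mulrDr opprD expRD normcM exprMn ler_pM ?expR_ge0 //.
  by rewrite X ?mem_head.
by apply: IH => y yl; apply: X; rewrite inE yl orbT.
Qed.

(** The weak-type estimate for a spread family: if f has no zero within
    delta (1 - |b|) of b, Harnack makes f exponentially small on the boundary of
    the hole around b, so that |f|^N <= |B|^(2^k) there; evaluating at z0 bounds
    the total size of the family by a multiple of 2^-k. *)
Lemma weak_spread : exists2 C : R, 0 <= C &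
  forall k s tau th, spread s tau th ->
    (forall b, b \in s -> hole b <= normc (z0 - b)) ->
    (forall b, b \in s -> forall z, normc (z - b) < delta * (1 - normc b) -> f z != 0) ->
    (forall b, b \in s -> normc (f b) <= (1 / 4) ^+ (2 ^ k)) ->
    \sum_(b <- s) (1 - normc b) <= C / 2 ^+ k.
Proof.
have [N NP] : exists N, (7 / 8) ^+ N <= hole_cst.
  have q1 : `|7 / 8| < 1 :> R by rewrite ger0_norm ?divr_ge0 //; lra.
  have := @cvg_geometric R 1 _ q1.
  move=> /cvgrPdist_le/(_ _ hole_cst_gt0)[n _ /(_ n (leqnn n))].
  rewrite /geometric /= mul1r sub0r normrN ger0_norm ?exprn_ge0 ?divr_ge0 //.
  by exists n.
exists (N%:R * log_base / base_cst).
  apply: divr_ge0; last exact: ltW base_cst_gt0.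
  by apply: mulr_ge0 => //; exact: log_base_ge0.
move=> k s tau th sp zh nz fs; have [us sd _ _] := sp.
have eta0 b : b \in s -> 0 < hole b.
  by move=> /sd b1; rewrite mulr_gt0 ?divr_gt0 // subr_gt0.
have H : normc (f z0) ^+ N <= normc (blprod s z0) ^+ (2 ^ k).
  apply: (@blprod_compare R s f hole N (2 ^ k)) => // b z bs z1 zb.
  have b1 := sd b bs.
  have db : 0 < 1 - normc b by rewrite subr_gt0.
  (* In the coordinate w = (z - b) / rho the zero-free disk has radius 2 and the
     boundary of the hole has radius 1/2. *)
  pose rho := delta * (1 - normc b) / 2.
  have rho0 : 0 < rho by rewrite divr_gt0 // mulr_gt0.
  pose h w := f (b + rho%:C%C * w).
  have hw w : normc w < 2 -> normc (b + rho%:C%C * w - b) < delta * (1 - normc b).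
    move=> w2; rewrite addrC addKr normcM normc_real gtr0_norm //.
    have -> : delta * (1 - normc b) = rho * 2 by rewrite /rho; field.
    by rewrite ltr_pM2l.
  have hd1 w : normc w < 2 -> normc (b + rho%:C%C * w) < 1.
    move=> /hw; have := normc_lower (b + rho%:C%C * w) b.
    by have := ler_wpM2r (ltW db) delta1; lra.
  have rC : (rho%:C%C : R[i]) != 0 by rewrite -normc_gt0 normc_real gtr0_norm.
  have fz : normc (f z) <= (7 / 8) ^+ (2 ^ k).
    have -> : f z = h ((z - b) / rho%:C%C) by rewrite /h mulrC divfK // addrC subrK.
    apply: (@harnack_zero_free R k 2) => //.
    - by lra.
    - move=> w w2; apply: (@cdiff_comp _ (fun w => b + rho%:C%C * w) f).
        apply: cdiffD; first exact: cdiff_cst.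
        by apply: cdiffM; [exact: cdiff_cst|exact: cdiff_id].
      by apply: fd; exact: hd1.
    - by move=> w /hd1; exact: f1.
    - by move=> w w2; apply: (nz b bs); exact: hw.
    - by rewrite /h mulr0 addr0; exact: fs.
    rewrite normcf_div zb normc_real gtr0_norm // ler_pdivrMr // /hole /rho.
    by rewrite le_eqVlt; apply/orP; left; apply/eqP; field.
  have h1 := blprod_hole sp bs z1 zb.
  apply: le_trans (_ : ((7 / 8) ^+ N) ^+ (2 ^ k) <= _).
    rewrite -exprM mulnC exprM lerXn2r ?nnegrE ?normc_ge0 ?exprn_ge0 ?divr_ge0 //.
  rewrite lerXn2r ?nnegrE ?normc_ge0 ?exprn_ge0 ?divr_ge0 //.
  exact: le_trans NP h1.
have k0 : 0 < 2 ^+ k :> R by rewrite exprn_gt0.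
have e1 : expR (- (N%:R * log_base / 2 ^+ k)) <= normc (blprod s z0).
  rewrite -(@ler_pXn2r _ (2 ^ k)) ?nnegrE ?expR_ge0 ?normc_ge0 ?expn_gt0 //.
  rewrite -expRM_natl natrX mulrN mulrCA divff ?gt_eqF // mulr1.
  by apply: le_trans _ H; rewrite -mulrN expRM_natl normc_fz0.
by have := blaschke_sum_from_product sd e1; rewrite mulrAC.
Qed.

End WeakType.

(** * Shadows of points on the circle *)

Section Shadows.
Variable R : realType.
Notation mu := (@lebesgue_measure R).
Implicit Types (a b c z : R[i]) (t r : R).

Definition period : set R := `[0, 2 * pi[%classic.

Definition arc c r : set R := period `&` [set t | normc (expi t - c) < r].

Lemma lipschitz_continuous (G : R -> R) :
  (forall s t, `|G s - G t| <= `|s - t|) -> continuous G.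
Proof.
move=> H t; apply/cvgrPdist_lt => e e0; apply/nbhs_ballP; exists e => //= s.
by rewrite /ball /= => /(le_lt_trans (H t s)).
Qed.

Lemma measurable_arc c r : measurable (arc c r).
Proof.
apply: measurableI; first exact: measurable_itv.
have Gc : continuous (fun t => normc (expi t - c)).
  apply: lipschitz_continuous => s t; apply: le_trans (normc_dist _ _) _.
  by rewrite opprB addrA subrK; exact: normc_expiB_le.
have -> : [set t | normc (expi t - c) < r] =
    (fun t => normc (expi t - c)) @^-1` [set x | x < r] by [].
apply: measurable_realfun.open_measurable; apply: open_comp => [t _|]; first exact: Gc.
exact: open_lt.
Qed.

Lemma pi_lt4 : pi < 4 :> R.
Proof. have := pihalf_lt2 R; lra. Qed.

Lemma le_itv_measure (A : set R) (x y : R) : measurable A -> x <= y ->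
  A `<=` `[x, y] -> (mu A <= (y - x)%:E)%E.
Proof.
move=> mA xy Axy; apply: le_trans (_ : mu `[x, y] <= _)%E.
  by apply: le_measure; rewrite ?inE.
rewrite lebesgue_measure_itv /= lte_fin.
by case: ltgtP xy => // -> _; rewrite subrr.
Qed.

Lemma period_measure_le (A : set R) : measurable A -> A `<=` period ->
  (mu A <= 8%:E)%E.
Proof.
move=> mA AP; apply: le_trans (_ : (2 * pi - 0)%:E <= _)%E.
  apply: le_itv_measure => //; first by rewrite mulr_ge0 // pi_ge0.
  by move=> t /AP; rewrite /period /= !in_itv /= => /andP[-> /ltW ->].
rewrite lee_fin; have := pi_lt4; lra.
Qed.

Lemma sin_gt_middle t : 1 / 2 <= t -> t <= pi - 1 / 2 -> 1 / 4 <= sin t.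
Proof.
have pi2 := pi_ge2 R.
have half : 1 / 4 <= sin (1 / 2 : R) by have := @sin_ge R (1 / 2); lra.
have low (u : R) : 1 / 2 <= u -> u <= pi / 2 -> 1 / 4 <= sin u.
  move=> u1 u2; have [<-//|ne] := eqVneq (1 / 2) u.
  apply: (le_trans half); apply: ltW.
  rewrite ltr_sin ?in_itv /=; first by rewrite lt_neqAle ne.
    by apply/andP; split; lra.
  by apply/andP; split; lra.
move=> t1 t2; have [/low|/ltW h] := leP t (pi / 2); first exact.
have -> : sin t = sin (pi - t) by rewrite sinB sinpi cospi; ring.
by apply: low; lra.
Qed.

(** Two points of the arc have distance less than 2 r, so for small r their angles are
    within 4 r of each other modulo the period, which leaves at most three
    intervals. *)
Lemma arc_measure c r : (mu (arc c r) <= (32 * r)%:E)%E \/ arc c r = set0.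
Proof.
have [->|/set0P[t0 [t0P t0c]]] := eqVneq (arc c r) set0; first by right.
left; have r0 : 0 < r by apply: le_lt_trans (normc_ge0 _) t0c.
have [r4|r4] := leP (1 / 4) r.
  apply: le_trans (period_measure_le (measurable_arc _ _) _) _; first by move=> t [].
  rewrite lee_fin; lra.
have pi2 := pi_ge2 R.
pose A i := arc c r `&` `[t0 + i - 4 * r, t0 + i + 4 * r]%classic.
have mA i : measurable (A i).
  by apply: measurableI; [exact: measurable_arc|exact: measurable_itv].
have AM i : (mu (A i) <= (8 * r)%:E)%E.
  have -> : 8 * r = (t0 + i + 4 * r) - (t0 + i - 4 * r) by ring.
  by apply: le_itv_measure => //; [lra|move=> t []].
have cov : arc c r = A 0 `|` (A (2 * pi) `|` A (- (2 * pi))).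
  apply/seteqP; split=> [t [tP tc]|t [[]|[[]|[]]] //].
  have := normc_tri (expi t) c (expi t0); rewrite (normc_sub c) => tri.
  have := normc_expiB t t0 => E.
  rewrite /= in t0c tc; have sr : `|sin ((t - t0) / 2)| < r by lra.
  move: t0P tP; rewrite /period /= !in_itv /= => /andP[h1 h2] /andP[h3 h4].
  have key (x : R) : 0 <= x -> x < pi -> sin x < r -> x <= 2 * r \/ pi - x <= 2 * r.
    move=> x0 xp sx; have [x1|x1] := leP x (1 / 2).
      by left; have := sin_ge x0 x1; lra.
    have [x2|x2] := leP x (pi - 1 / 2).
      by have := sin_gt_middle (ltW x1) x2; lra.
    right; have : sin (pi - x) = sin x by rewrite sinB sinpi cospi; ring.
    by have := @sin_ge R (pi - x); lra.
  have mem i : `|t - (t0 + i)| <= 4 * r -> A i t.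
    move=> h; split; first by split=> //; rewrite /period /= in_itv /= h3.
    by rewrite /= in_itv /=; move: h; rewrite ler_norml; lra.
  have [tt|tt] := leP t0 t.
    have : sin ((t - t0) / 2) < r by apply: le_lt_trans sr; exact: ler_norm.
    move=> /key[]; try lra; move=> h; [left|right; left]; apply: mem.
      by rewrite addr0 ler_norml; lra.
    by rewrite ler_norml; lra.
  have : sin ((t0 - t) / 2) < r.
    apply: le_lt_trans sr; rewrite -normrN -sinN -mulNr opprB; exact: ler_norm.
  move=> /key[]; try lra; move=> h; [left|right; right]; apply: mem.
    by rewrite addr0 ler_norml; lra.
  by rewrite ler_norml; lra.
rewrite cov; have mU : measurable (A (2 * pi) `|` A (- (2 * pi))) by exact: measurableU.
apply: (le_trans (measureU2 mu (mA 0) mU)).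
apply: (le_trans (leeD (AM 0) (measureU2 mu (mA _) (mA _)))).
apply: (le_trans (leeD (lexx _) (leeD (AM _) (AM _)))).
rewrite -!EFinD lee_fin; lra.
Qed.

Lemma arc_measure_le c r : 0 <= r -> (mu (arc c r) <= (32 * r)%:E)%E.
Proof.
move=> r0; have [//|->] := arc_measure c r.
by rewrite measure0 lee_fin mulr_ge0.
Qed.

Lemma measure_seq_union (T : eqType) (s : seq T) (A : T -> set R) (u : T -> R) :
  (forall x, measurable (A x)) -> (forall x, x \in s -> (mu (A x) <= (u x)%:E)%E) ->
  (mu [set t | exists2 x, x \in s & A x t] <= (\sum_(x <- s) u x)%:E)%E /\
  measurable [set t | exists2 x, x \in s & A x t].
Proof.
move=> mA; elim: s => [_|x s IH H].
  have -> : [set t | exists2 x, x \in [::] & A x t] = set0.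
    by apply/seteqP; split=> t //= -[x]; rewrite in_nil.
  by rewrite measure0 big_nil.
have -> : [set t | exists2 y, y \in x :: s & A y t] =
    A x `|` [set t | exists2 y, y \in s & A y t].
  apply/seteqP; split=> t /=.
    by move=> [y]; rewrite inE => /predU1P[->|ys] Ay; [left|right; exists y].
  move=> [Ax|[y ys Ay]]; first by exists x; rewrite ?mem_head.
  by exists y; rewrite // inE ys orbT.
have [|h1 h2] := IH; first by move=> y ys; apply: H; rewrite inE ys orbT.
split; last exact: measurableU.
apply: (le_trans (measureU2 mu (mA x) h2)).
rewrite big_cons EFinD; apply: leeD => //; exact: H (mem_head _ _).
Qed.

Variables (alpha : R).
Hypothesis alpha0 : 0 < alpha.

(** The angles whose Stolz angle contains b, see stolzP. *)
Definition shadow b : set R := arc b ((1 + alpha) * (1 - normc b)).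

Lemma stolzP b t : normc b < 1 ->
  stolz alpha t b <-> normc (expi t - b) < (1 + alpha) * (1 - normc b).
Proof.
move=> b1; rewrite /stolz /=.
have -> : normc (1 - b * expi (- t)) = normc (expi t - b).
  rewrite -[RHS]mul1r -(normc_expi (- t)) -normcM mulrBr -expiD addNr expi0.
  by rewrite mulrC.
by split=> [[]|].
Qed.

Lemma shadow_measure b : normc b < 1 ->
  (mu (shadow b) <= (32 * (1 + alpha) * (1 - normc b))%:E)%E.
Proof.
move=> b1; rewrite -mulrA; apply: arc_measure_le.
by rewrite mulr_ge0 // ?subr_ge0 ?ltW //; have := alpha0; lra.
Qed.

Section WeakMeasure.
Variables (f : R[i] -> R[i]) (z0 : R[i]) (delta : R).
Hypothesis fd : forall z, normc z < 1 -> cdiff f z.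
Hypothesis f1 : forall z, normc z < 1 -> normc (f z) <= 1.
Hypothesis z01 : normc z0 < 1.
Hypothesis fz0 : f z0 != 0.
Hypothesis delta0 : 0 < delta.
Hypothesis delta1 : delta <= 1 / 2.

(** The base point z0 is kept away as well, so that the comparison with a Blaschke
    product off the holes can be evaluated there. *)
Definition clear b := normc b < 1 /\
  forall z, normc (z - b) < delta * (1 - normc b) -> f z != 0 /\ z != z0.

(** Weak-type estimate for the shadows of finitely many points: in each sector of
    opening 1 a greedily selected spread subfamily controls all shadows after
    dilation by a constant factor. *)
Lemma weak_measure_seq : exists2 C : R, 0 <= C &
  forall k (s : seq R[i]), (forall b, b \in s -> clear b) ->
    (forall b, b \in s -> normc (f b) <= (1 / 4) ^+ (2 ^ k)) ->
    (mu [set t | exists2 b, b \in s & shadow b t] <= (C / 2 ^+ k)%:E)%E.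
Proof.
have [C C0 CP] := weak_spread fd f1 z01 fz0 delta0 delta1.
pose ka := 32 * (5 + alpha).
have a0 := alpha0; have ka0 : 0 <= ka by rewrite /ka; lra.
exists (8 * (ka * C)); first by apply: mulr_ge0 => //; exact: mulr_ge0.
move=> k s scl sf.
have [tau tauP] : exists tau : R[i] -> R, forall z,
    0 <= tau z < 2 * pi /\ z = (normc z)%:C%C * expi (tau z).
  suff /choice[tau ?] : forall z : R[i], exists t,
      0 <= t < 2 * pi /\ z = (normc z)%:C%C * expi t by exists tau.
  by move=> z; have [t t1 t2] := polar z; exists t.
(* Eight sectors of opening 1 suffice since 2 pi < 8. *)
pose sec (i : nat) := [seq b <- s | i%:R <= tau b < i.+1%:R].
pose U (i : nat) := [set t | exists2 b, b \in sec i & shadow b t].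
have mS b : measurable (shadow b) by exact: measurable_arc.
have inf b : b \in s -> (mu (shadow b) <= 8%:E)%E.
  by move=> _; apply: period_measure_le => // t [].
have Umeas i : (mu (U i) <= (ka * C / 2 ^+ k)%:E)%E.
  have dC (x y : R[i]) : normc (x - y) = normc (y - x) by exact: normc_sub.
  have d0 (x : R[i]) : normc (x - x) = 0 by rewrite subrr normc0.
  have spos b : b \in sec i -> 0 < 1 - normc b.
    by rewrite mem_filter => /andP[_ /scl[b1 _]]; rewrite subr_gt0.
  have [s' [us' ss' sep cov]] := greedy dC d0 spos.
  have s's b : b \in s' -> b \in s by move=> /ss'; rewrite mem_filter => /andP[].
  have sp : spread s' tau i%:R.
    split=> //.
    - by move=> b /s's/scl[].
    - move=> b /ss'; rewrite mem_filter -natr1 => /andP[/andP[h1 h2] _].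
      by rewrite h1 ltW //; split=> //; have [] := tauP b.
  have sum : \sum_(b <- s') (1 - normc b) <= C / 2 ^+ k.
    apply: CP sp _ _ _ => [b /s's/scl[b1 cl]|b /s's/scl[_ cl] z /cl[]//|b /s's/sf //].
    rewrite leNgt; apply/negP => h.
    have [] := cl z0; last by rewrite eqxx.
    apply: lt_trans h _; rewrite /hole ltr_pM2r ?subr_gt0 //.
    by have := delta0; lra.
  (* The aperture 5 + alpha is 1 + alpha plus the factor 4 of the greedy cover. *)
  pose A b := arc b ((5 + alpha) * (1 - normc b)).
  have mA b : measurable (A b) by exact: measurable_arc.
  have AM b : b \in s' -> (mu (A b) <= (ka * (1 - normc b))%:E)%E.
    move=> /s's/scl[b1 _]; rewrite /ka -mulrA; apply: arc_measure_le.
    by rewrite mulr_ge0 // ?subr_ge0 ?ltW //; have := alpha0; lra.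
  have [h mAU] := measure_seq_union mA AM.
  apply: le_trans (_ : mu [set t | exists2 b, b \in s' & A b t] <= _)%E.
    apply: le_measure; rewrite ?inE //.
      by have [] := @measure_seq_union _ (sec i) shadow (fun=> 8) mS
        (fun b bs => inf b (mem_subseq (filter_subseq _ _) bs)).
    move=> t [b bs [tp tb]]; have [x xs' [xb dx]] := cov b bs.
    exists x => //; split=> //.
    have := normc_tri (expi t) b x; rewrite (normc_sub b x).
    move: tb; rewrite /=.
    have := ler_wpM2l (ltW (ltr_wpDr (ltW alpha0) (@ltr01 R))) dx.
    rewrite !mulrDl !mul1r; lra.
  apply: le_trans h _; rewrite lee_fin -mulr_sumr -mulrA ler_wpM2l //.
have mU i : measurable (U i).
  by have [] := @measure_seq_union _ (sec i) shadow (fun=> 8) mS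
        (fun b bs => inf b (mem_subseq (filter_subseq _ _) bs)).
have [h _] := @measure_seq_union _ (iota 0 8) U (fun=> ka * C / 2 ^+ k) mU
  (fun i _ => Umeas i).
have -> : [set t | exists2 b, b \in s & shadow b t] =
    [set t | exists2 i, i \in iota 0 8 & U i t].
  apply/seteqP; split=> t /=.
    move=> [b bs bt]; have [/andP[t0 t1] _] := tauP b.
    exists (Num.truncn (tau b)).
      rewrite -[X in _ \in X]/(iota 0 8) mem_iota /= truncn_lt_nat //.
      by apply: lt_trans t1 _; have := pi_lt4; lra.
    by exists b => //; rewrite mem_filter bs truncn_itv.
  by move=> [i _ [b bi bt]]; exists b => //; move: bi; rewrite mem_filter => /andP[].
apply: le_trans h _; rewrite lee_fin /= !big_cons big_nil; lra.
Qed.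

Lemma bigcup_measure_le (A : nat -> set R) (M : R) :
  (forall k, measurable (A k)) ->
  (forall n, (mu [set t | exists2 k, k \in iota 0 n & A k t] <= M%:E)%E) ->
  (mu [set t | exists k, A k t] <= M%:E)%E /\ measurable [set t | exists k, A k t].
Proof.
move=> mA H; pose F n := [set t | exists2 k, k \in iota 0 n & A k t].
have E : [set t | exists k, A k t] = \bigcup_n F n.
  apply/seteqP; split=> t /=.
    by move=> [k Ak]; exists k.+1 => //; exists k => //; rewrite mem_iota /= add0n.
  by move=> [n _ [k _ Ak]]; exists k.
have FE n : F n = \bigcup_(k in [set k | k \in iota 0 n]) A k.
  by apply/seteqP; split=> t [k kn Ak]; exists k.
have mF n : measurable (F n) by rewrite FE; apply: bigcup_measurable.
have mE : measurable (\bigcup_n F n) by apply: bigcup_measurable.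
rewrite E; split=> //.
have nd : nondecreasing_seq F.
  move=> n m nm; apply/subsetPset => t [k kn Ak]; exists k => //.
  by move: kn; rewrite !mem_iota /= !add0n => /leq_trans; apply.
have cv := @nondecreasing_cvg_mu _ _ _ mu F mF mE nd.
rewrite -(cvg_lim _ cv) //; apply: lime_le.
  by apply/cvg_ex; eexists; exact: cv.
by apply: nearW => n; exact: H.
Qed.

Lemma weak_measure : exists2 C : R, 0 <= C &
  forall k (a : nat -> R[i]) (P : set nat), (forall j, P j -> clear (a j)) ->
    (forall j, P j -> normc (f (a j)) <= (1 / 4) ^+ (2 ^ k)) ->
    (mu [set t | exists j, P j /\ shadow (a j) t] <= (C / 2 ^+ k)%:E)%E /\
    measurable [set t | exists j, P j /\ shadow (a j) t].
Proof.
have [C C0 CP] := weak_measure_seq; exists C => // k a P cl sf.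
have mP j : measurable [set t | P j /\ shadow (a j) t].
  have [Pj|nPj] := pselect (P j).
    have -> : [set t | P j /\ shadow (a j) t] = shadow (a j).
      by apply/seteqP; split=> t [].
    exact: measurable_arc.
  have -> : [set t | P j /\ shadow (a j) t] = set0.
    by apply/seteqP; split=> t [].
  exact: measurable0.
apply: (@bigcup_measure_le (fun j => [set t | P j /\ shadow (a j) t])) => // n.
have H : (mu [set t | exists2 b, b \in [seq a j | j <- iota 0 n & `[< P j >]] &
    shadow b t] <= (C / 2 ^+ k)%:E)%E.
  apply: CP => b /mapP[j]; rewrite mem_filter => /andP[/asboolP Pj _] ->.
    exact: cl.
  exact: sf.
congr (mu _ <= _)%E: H; apply/seteqP; split=> t /=.
  move=> [b /mapP[j]]; rewrite mem_filter => /andP[/asboolP Pj jn ->] sj.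
  by exists j.
move=> [j jn [Pj sj]]; exists (a j) => //; apply/mapP; exists j => //.
by rewrite mem_filter jn andbT; apply/asboolP.
Qed.

End WeakMeasure.
End Shadows.

(** * Points in Stolz angles *)

Section Counting.
Variable R : realType.
Notation mu := (@lebesgue_measure R).
Implicit Types (a : nat -> R[i]) (b c z : R[i]).

Lemma counting_list (T : choiceType) (X : set T) (n : nat) :
  (n%:R%:E <= @counting T R X)%E ->
  exists s : seq T, [/\ uniq s, size s = n & forall x, x \in s -> X x].
Proof.
have fin (B : finmap.finSet T) : (forall x, x \in finmap.enum_fset B -> X x) -> (n <= size (finmap.enum_fset B))%N ->
    exists s : seq T, [/\ uniq s, size s = n & forall x, x \in s -> X x].
  move=> BX nB; exists (take n (finmap.enum_fset B)); split.
  - by rewrite take_uniq.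
  - by rewrite size_take; move: nB; rewrite leq_eqVlt => /predU1P[->|->]; rewrite ?ltnn.
  - by move=> x /mem_take xB; exact: BX.
rewrite /counting; case: ifPn => [/asboolP fX|/asboolPn iX _].
  rewrite lee_fin ler_nat; apply: fin => x /=.
  by rewrite in_fset_set // inE.
by have [B BX] := infinite_set_fset n iX; apply: fin => x xB; exact: BX.
Qed.

Lemma list_counting (T : choiceType) (X : set T) (s : seq T) :
  uniq s -> (forall x, x \in s -> X x) -> ((size s)%:R%:E <= @counting T R X)%E.
Proof.
move=> us sX; rewrite /counting; case: ifPn => [/asboolP fX|_]; last by rewrite leey.
rewrite lee_fin ler_nat; apply: uniq_leq_size => // x xs.
by rewrite in_fset_set // inE; exact: sX.
Qed.

Lemma separated_gap a : separated_in_disk a -> exists2 sg : R, 0 < sg &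
  forall j k, j != k -> sg * normc (1 - conjc (a j) * a k) <= normc (a j - a k).
Proof.
move=> [ad E0]; eexists; first exact: E0.
move=> j k jk.
have dn : 0 < normc (1 - conjc (a j) * a k).
  by rewrite normc_gt0 bl_den_neq0 //; [exact: ad|exact: ltW (ad k)].
rewrite -ler_pdivlMr // -normcf_div; apply: ge_inf; last by exists (j, k).
by exists 0 => _ [jk' _ <-]; exact: normc_ge0.
Qed.

Lemma pow2_gt0 (n : nat) : 0 < 2 ^+ n :> R.
Proof. by rewrite exprn_gt0. Qed.

Lemma dyadic_level (x : R) j : (2 ^+ j)^-1 < x -> x <= 1 ->
  exists i, [/\ (i < j)%N, (2 ^+ i.+1)^-1 < x & x <= (2 ^+ i)^-1].
Proof.
elim: j => [|j IH]; first by rewrite expr0 invr1; lra.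
move=> xj x1; have [/IH/(_ x1)[i [ij h1 h2]]|xj'] := ltP (2 ^+ j)^-1 x.
  by exists i; split=> //; exact: ltnW.
by exists j.
Qed.

(** Pigeonhole in each of the j dyadic layers, on a grid of side comparable to the
    distance to the circle: the layers hold boundedly many points each. *)
Lemma stolz_count (alpha sg : R) : 0 < alpha -> 0 < sg -> exists C0 : nat,
  forall t j (s : seq R[i]), uniq s ->
    (forall b, b \in s -> [/\ normc b < 1,
       normc (expi t - b) < (1 + alpha) * (1 - normc b) &
       (2 ^+ j)^-1 < 1 - normc b]) ->
    (forall b c, b \in s -> c \in s -> b != c ->
       sg * normc (1 - conjc b * c) <= normc (b - c)) ->
    (size s <= C0 * j)%N.
Proof.
move=> alpha0 sg0; pose A := 1 + alpha; pose ep := sg / 4.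
have A0 : 0 < A by rewrite /A; lra.
have ep0 : 0 < ep by rewrite divr_gt0.
pose B := Num.truncn (2 * A / ep).
exists (B.+1 * B.+1)%N => t j s us sP sep.
case: j sP => [|j] sP.
  case: s us sP sep => // b s _ /(_ b (mem_head _ _))[_ _ h].
  by move: h; rewrite expr0 invr1; have := normc_ge0 b; lra.
have [lev levP] : exists lev : R[i] -> nat, forall b, b \in s ->
    [/\ (lev b < j.+1)%N, (2 ^+ (lev b).+1)^-1 < 1 - normc b &
        1 - normc b <= (2 ^+ (lev b))^-1].
  suff /choice[lev ?] : forall b, exists i, b \in s ->
    [/\ (i < j.+1)%N, (2 ^+ i.+1)^-1 < 1 - normc b & 1 - normc b <= (2 ^+ i)^-1].
    by exists lev.
  move=> b; have [bs|_] := boolP (b \in s); last by exists 0%N.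
  have [_ _ h] := sP b bs; have := normc_ge0 b => nb.
  by have [|i iP] := dyadic_level h; [lra|exists i].
(* Rescaled by its layer, the part of the Stolz angle in one layer has bounded size. *)
pose u b : R[i] := (2 ^+ lev b)%:C%C * (expi t - b).
have uA b : b \in s -> normc (u b) < A.
  move=> bs; have [b1 h _] := sP b bs; have [_ _ h2] := levP b bs.
  rewrite normcM normc_real ger0_norm ?exprn_ge0 // mulrC.
  rewrite -ltr_pdivlMr ?pow2_gt0 //; apply: lt_le_trans h _.
  by rewrite ler_wpM2l // ltW.
pose q (x : R) := Num.truncn ((x + A) / ep).
have qP (x : R) : `|x| < A -> (q x < B.+1)%N /\ (q x)%:R <= (x + A) / ep < (q x).+1%:R.
  rewrite ltr_norml => /andP[x1 x2].
  have h0 : 0 <= (x + A) / ep by rewrite divr_ge0 ?(ltW ep0) //; lra.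
  split; last exact: truncn_itv.
  rewrite ltnS /B truncn_ge_nat; last by rewrite divr_ge0 ?(ltW ep0) //; lra.
  have /andP[h _] := truncn_itv h0; apply: (le_trans h).
  rewrite ler_pM2r ?invr_gt0 //; lra.
have qeq (x y : R) : `|x| < A -> `|y| < A -> q x = q y -> `|x - y| < ep.
  move=> /qP[_ /andP[h1 h2]] /qP[_ /andP[h3 h4]] E.
  move: h1 h2 h3 h4; rewrite E -natr1 !ler_pdivlMr // !ltr_pdivrMr // mulrDl mul1r.
  by rewrite ltr_norml; lra.
pose code b : 'I_j.+1 * ('I_B.+1 * 'I_B.+1) :=
  (inord (lev b), (inord (q (complex.Re (u b))), inord (q (complex.Im (u b))))).
have inj : {in s &, injective code}.
  move=> b c bs cs; rewrite /code.
  have [lb lb1 lb2] := levP b bs; have [lc lc1 lc2] := levP c cs.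
  have ub := uA b bs; have uc := uA c cs.
  have r1 := le_lt_trans (normc_leRe _) ub; have r2 := le_lt_trans (normc_leRe _) uc.
  have i1 := le_lt_trans (normc_leIm _) ub; have i2 := le_lt_trans (normc_leIm _) uc.
  move=> E; have := congr1 (fun x => val x.1) E.
  have := congr1 (fun x => val x.2.1) E; have := congr1 (fun x => val x.2.2) E.
  rewrite /= !inordK ?(proj1 (qP _ _)) // => E1 E2 E3.
  have dR := qeq _ _ r1 r2 E2; have dI := qeq _ _ i1 i2 E1.
  apply/eqP; apply/negPn/negP => bc.
  have b1 : normc b < 1 by have [] := sP b bs.
  have c1 : normc c < 1 by have [] := sP c cs.
  have := sep b c bs cs bc; apply/negP; rewrite -ltNge.
  have uE : u b - u c = (2 ^+ lev b)%:C%C * (c - b).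
    by rewrite /u E3 -mulrBr; congr (_ * _); ring.
  have : normc (u b - u c) < 2 * ep.
    apply: le_lt_trans (normc_le_ReIm _) _; rewrite !raddfB /=; lra.
  rewrite uE normcM normc_real ger0_norm ?exprn_ge0 // normc_sub => h.
  have den := bl_den_ge b (ltW c1).
  have p0 := pow2_gt0 (lev b).
  have lb3 : 1 < 2 * 2 ^+ lev b * (1 - normc b).
    by move: lb1; rewrite exprS -[_^-1]div1r ltr_pdivrMr ?mulr_gt0 // mulrC.
  rewrite -(ltr_pM2l p0); apply: lt_trans h _; rewrite /ep.
  have : sg * 1 < sg * (2 * 2 ^+ lev b * (1 - normc b)) by rewrite ltr_pM2l.
  have : 2 ^+ lev b * (sg * (1 - normc b)) <= 2 ^+ lev b * (sg * normc (1 - conjc b * c)).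
    by rewrite ler_pM2l // ler_pM2l.
  lra.
have : (size [seq code b | b <- s] <= #|{: 'I_j.+1 * ('I_B.+1 * 'I_B.+1)}|)%N.
  have /card_uniqP <- : uniq [seq code b | b <- s] by rewrite map_inj_in_uniq.
  exact: max_card.
by rewrite size_map !card_prod !card_ord mulnC.
Qed.

(** psi counts the sets that contain a point.  Its integral is the sum of the
    measures, and it dominates half the number of the levels (i + 1) / 2 below it,
    which makes the measures of its half-integer superlevel sets summable. *)
Lemma layer_cake (S : nat -> set R) (M : R) :
  (forall k, measurable (S k)) -> (forall k, S k `<=` @period R) ->
  (forall n, (\sum_(k < n) mu (S k) <= M%:E)%E) ->
  let psi t := (\sum_(k <oo) (\1_(S k) t : R)%:E)%E in
  [/\ forall x : R, measurable (@period R `&` [set t | (x%:E <= psi t)%E]),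
     forall N, (\sum_(i < N) mu (@period R `&` [set t | (((i.+1)%:R / 2)%:E <= psi t)%E])
        <= (2 * M)%:E)%E &
     forall t (s : seq nat), uniq s -> (forall k, k \in s -> S k t) ->
       ((size s)%:R%:E <= psi t)%E].
Proof.
move=> mS Sp SM psi.
have mp : measurable (@period R) by exact: measurable_itv.
have m1 k : measurable_fun (@period R) (EFin \o (\1_(S k) : R -> R)).
  by apply/measurable_EFinP; exact: measurable_indic.
have n1 k t : (0 <= (\1_(S k) t : R)%:E)%E by rewrite lee_fin.
have psi0 t : (0 <= psi t)%E by apply: nneseries_ge0 => k _ _; exact: n1.
have mpsi : measurable_fun (@period R) psi.
  exact: (@ge0_emeasurable_sum _ _ _ _ (fun k t => (\1_(S k) t : R)%:E) xpredT
    (fun k t _ _ => n1 k t) (fun k _ => m1 k)).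
have mA (x : R) : measurable (@period R `&` [set t | (x%:E <= psi t)%E]).
  exact: emeasurable_fun_c_infty.
split=> // [N|t s us sS].
  pose A i := @period R `&` [set t | (((i.+1)%:R / 2)%:E <= psi t)%E].
  have mAi i : measurable (A i) by exact: mA.
  have E : (\sum_(i < N) mu (A i) =
      \int[mu]_(t in @period R) (\sum_(i < N) (\1_(A i) t : R)%:E))%E.
    apply/esym; apply: eq_trans.
      apply: (@ge0_integral_sum _ _ _ mu _ mp _ (fun (i : 'I_N) t => (\1_(A i) t : R)%:E)).
        by move=> i; apply/measurable_EFinP; apply: measurable_indic; exact: mAi.
      by move=> i t _; rewrite lee_fin.
    apply: eq_bigr => i _; rewrite integral_indic //; last exact: mAi.
    by congr (mu _); apply: setIidl => t [].
  rewrite -/(A _) E.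
  apply: le_trans (_ : (\int[mu]_(t in @period R) (2%:E * psi t) <= _)%E).
    apply: ge0_le_integral => //.
    - by move=> t _; apply: sume_ge0 => i _; rewrite lee_fin.
    - apply: emeasurable_sum => i; apply/measurable_EFinP; apply: measurable_indic; exact: mAi.
    - exact: measurable_funeM.
    move=> t _; have := psi0 t; case pE: (psi t) => [x| |] // x0; last first.
      by rewrite mulry gtr0_sg // mul1e leey.
    rewrite -EFinM sumEFin lee_fin; rewrite lee_fin in x0.
    suff H n : \sum_(i < n) (\1_(A i) t : R) <= 2 * x /\ \sum_(i < n) (\1_(A i) t : R) <= n%:R.
      by have [] := H N.
    elim: n => [|n [h1 h2]]; first by rewrite big_ord0; split=> //; lra.
    rewrite big_ord_recr /= indicE.
    have [|] := boolP (t \in A n); rewrite ?inE => tA /=.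
      case: tA => _; rewrite /= pE lee_fin => h3; rewrite -natr1.
      move: h3; rewrite -natr1; split; lra.
    by rewrite addr0 -natr1; split; lra.
  rewrite ge0_integralZl_EFin // integral_nneseries //.
  rewrite EFinM; apply: lee_wpmul2l => //.
  apply: lime_le.
    by apply: is_cvg_ereal_nneg_natsum => k _; apply: integral_ge0.
  apply: nearW => n; rewrite big_mkord; apply: le_trans (SM n).
  apply: lee_sum => k _; rewrite integral_indic //; last exact: mS.
  have -> : S k `&` @period R = S k by apply: setIidl; exact: Sp.
  exact: lexx.
pose n := (\max_(k <- s) k.+1)%N.
apply: le_trans (_ : (\sum_(0 <= k < n) (\1_(S k) t : R)%:E <= _)%E); last first.
  exact: nneseries_lim_ge.
rewrite sumEFin lee_fin big_mkord.
have -> : (size s)%:R = \sum_(k <- s) (\1_(S k) t : R).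
  rewrite big_seq (eq_bigr (fun=> 1)); last by move=> k ks; rewrite indicE mem_set //; exact: sS.
  by rewrite -big_seq big_const_seq count_predT iter_addr_0.
rewrite -(big_mkord xpredT (fun k => \1_(S k) t : R)).
rewrite [leRHS](bigID (mem s)) /=.
rewrite -[leLHS]addr0 lerD ?sumr_ge0 //.
rewrite -[leRHS]big_filter le_eqVlt; apply/orP; left; apply/eqP.
apply: perm_big; apply: uniq_perm => //; first by rewrite filter_uniq // iota_uniq.
move=> k; rewrite mem_filter mem_index_iota /=.
have [ks|//] := boolP (k \in s); rewrite /= /n.
by rewrite (@leq_bigmax_seq _ _ xpredT (fun k => k.+1)).
Qed.

End Counting.

(** * The decay function on dyadic circles *)

Section GTilde.
Variables (R : realType) (g : R -> R).
Hypothesis hg : minorant_function g.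

Lemma powR2N (j : nat) : 2 `^ (- j%:R) = (2 ^+ j)^-1 :> R.
Proof. by rewrite powRN powR_mulrn. Qed.

Lemma dyadic_radius (j : nat) : 0 <= (1 - (2 ^+ j)^-1 : R) < 1.
Proof.
have p := pow2_gt0 R j; have : (2 ^+ j)^-1 <= 1 :> R.
  by rewrite invf_le1 // exprn_ege1 // ler1n.
have : 0 < (2 ^+ j)^-1 :> R by rewrite invr_gt0.
by move=> ? ?; apply/andP; split; lra.
Qed.

Lemma pow2_small (d : R) : 0 < d -> exists j : nat, (2 ^+ j)^-1 < d.
Proof.
move=> d0; have q1 : `|2^-1| < 1 :> R by rewrite ger0_norm ?invr_ge0 // invf_lt1 // ltr1n.
have := @cvg_geometric R 1 _ q1.
move=> /cvgrPdist_lt/(_ _ d0)[n _ /(_ n (leqnn n))].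
rewrite /geometric /= mul1r sub0r normrN ger0_norm ?exprn_ge0 ?invr_ge0 //.
by rewrite exprVn; exists n.
Qed.

Lemma g_dyadic (j : nat) : g (1 - (2 ^+ j)^-1) = expR (- gtilde g j%:R).
Proof.
have [gb _ _] := hg; have /andP[g0 _] := gb _ (dyadic_radius j).
by rewrite /gtilde powR2N div1r lnV ?posrE // opprK lnK.
Qed.

Lemma gtilde_ge0 (j : nat) : 0 <= gtilde g j%:R.
Proof.
have [gb _ _] := hg; have /andP[g0 g1] := gb _ (dyadic_radius j).
by rewrite /gtilde powR2N div1r lnV ?posrE // oppr_ge0 ln_le0.
Qed.

Lemma gtilde_homo (i j : nat) : (i <= j)%N -> gtilde g i%:R <= gtilde g j%:R.
Proof.
move=> ij; rewrite -lerN2 -ler_expR -!g_dyadic.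
have [_ gm _] := hg; have /andP[i0 _] := dyadic_radius i.
have /andP[_ j1] := dyadic_radius j.
apply: gm => //; rewrite lerB // lef_pV2 ?posrE ?pow2_gt0 //.
by rewrite ler_eXn2l // ltr1n.
Qed.

Lemma gtilde_unbounded (M : R) : exists j : nat, M < gtilde g j%:R.
Proof.
have [gb gm gl] := hg.
have e0 : 0 < expR (- M) by exact: expR_gt0.
move/cvgrPdist_lt : gl => /(_ _ e0).
rewrite /prop_near1 /at_left /within /= => /nbhs_ballP[d /= d0 dP].
have [j jd] := pow2_small d0.
exists j; have pj : 0 < (2 ^+ j)^-1 :> R by rewrite invr_gt0 pow2_gt0.
have := dP (1 - (2 ^+ j)^-1); rewrite /ball /=.
rewrite (_ : 1 - (1 - _) = (2 ^+ j)^-1); last by ring.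
rewrite gtr0_norm // => /(_ jd)/(_ _)/wrap[]; first by lra.
rewrite sub0r normrN g_dyadic gtr0_norm ?expR_gt0 // ltr_expR ltrN2.
exact.
Qed.

End GTilde.

(** * Bound for the counting function *)

Section Sufficiency.
Variables (R : realType) (alpha : R) (g : R -> R) (a : nat -> R[i]).
Variables (f : R[i] -> R[i]) (z0 : R[i]).
Notation mu := (@lebesgue_measure R).
Hypothesis alpha0 : 0 < alpha.
Hypothesis hg : minorant_function g.
Hypothesis ha : separated_in_disk a.
Hypothesis fd : forall z, normc z < 1 -> cdiff f z.
Hypothesis f1 : forall z, normc z < 1 -> normc (f z) <= 1.
Hypothesis z01 : normc z0 < 1.
Hypothesis fz0 : f z0 != 0.
Hypothesis fa : forall k, normc (f (a k)) <= g (normc (a k)).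

Lemma quarter_expR (x : R) k : 2 * 2 ^+ k <= x -> expR (- x) <= (1 / 4) ^+ (2 ^ k).
Proof.
move=> h; apply: le_trans (_ : expR (- (2 * 2 ^+ k)) <= _).
  by rewrite ler_expR lerN2.
have e2 : expR (- 2) <= 1 / 4 :> R.
  rewrite expRN div1r lef_pV2 ?posrE ?expR_gt0 //.
  have := @expR_ge1Dx R 1 => h1; have -> : 2 = 1 + 1 :> R by [].
  by rewrite expRD; nra.
rewrite -mulrN mulrC mulNr -mulrN -natrX expRM_natl.
by rewrite lerXn2r ?nnegrE ?expR_ge0 ?divr_ge0.
Qed.

Lemma dyadic_scale (x : R) : 2 <= x -> exists k, 2 * 2 ^+ k <= x < 4 * 2 ^+ k.
Proof.
move=> x2; have [n nP] : exists n, x < 4 * 2 ^+ n.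
  have [n nx] : exists n : nat, x < n%:R.
    by exists (Num.truncn x).+1; have /andP[] := truncn_itv (le_trans (ler0n _ 2) x2).
  exists n; apply: (lt_trans nx); rewrite -natrX -natrM ltr_nat.
  have := ltn_expl n (isT : (1 < 2)%N); lia.
elim: n nP => [|n IH] nP; first by exists 0%N; rewrite expr0 in nP *; apply/andP; split; lra.
have [/IH //|h] := ltP x (4 * 2 ^+ n).
by exists n.+1; rewrite nP andbT exprS; lra.
Qed.

(** Every zero of f (or the base point) lies in the disk of at most one of the
    separated points, so the points that are not clear inherit the Blaschke
    condition from the zeros of f. *)
Lemma unclear_blaschke (sg delta : R) : 0 < delta -> delta <= 1 / 2 -> delta <= sg / 2 ->
  (forall j k, j != k -> sg * normc (1 - conjc (a j) * a k) <= normc (a j - a k)) ->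
  exists2 S : R, 0 <= S & forall u : seq nat, uniq u ->
    (forall k, k \in u -> ~ clear f z0 delta (a k)) ->
    \sum_(k <- u) (1 - normc (a k)) <= S.
Proof.
move=> d0 d12 dsg gap; have ad k : normc (a k) < 1 by exact: ha.1.
have dk k : 0 < 1 - normc (a k) by rewrite subr_gt0.
have [zt ztP] : exists zt : nat -> R[i], forall k, ~ clear f z0 delta (a k) ->
    normc (zt k - a k) < delta * (1 - normc (a k)) /\ (f (zt k) = 0 \/ zt k = z0).
  suff /choice[zt ?] : forall k, exists z, ~ clear f z0 delta (a k) ->
      normc (z - a k) < delta * (1 - normc (a k)) /\ (f z = 0 \/ z = z0) by exists zt.
  move=> k; have [cl|ncl] := pselect (clear f z0 delta (a k)); first by exists 0.
  have : ~ forall z, normc (z - a k) < delta * (1 - normc (a k)) -> f z != 0 /\ z != z0.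
    by move=> h; apply: ncl; split.
  move=> /existsNP[z /not_implyP[h1 /not_andP h2]]; exists z => _; split=> //.
  by case: h2 => /negP/negPn/eqP; [left|right].
have inj j k : ~ clear f z0 delta (a j) -> ~ clear f z0 delta (a k) ->
    zt j = zt k -> j = k.
  move=> /ztP[hj _] /ztP[hk _] E; apply/eqP; apply/negPn/negP => jk.
  have := gap j k jk; apply/negP; rewrite -ltNge.
  have h1 := bl_den_ge (a j) (ltW (ad k)); have h2 := bl_den_ge_sym (a k) (ltW (ad j)).
  have h3 := normc_tri (a j) (zt j) (a k); rewrite {2}E (normc_sub (a j) (zt j)) in h3.
  have [e1 e2] := (dk j, dk k).
  have : delta * (1 - normc (a j)) <= sg / 2 * normc (1 - conjc (a j) * a k).
    by apply: ler_pM => //; exact: ltW.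
  have : delta * (1 - normc (a k)) <= sg / 2 * normc (1 - conjc (a j) * a k).
    by apply: ler_pM => //; exact: ltW.
  lra.
pose A := log_base f z0 / base_cst z0.
have A0 : 0 <= A by rewrite divr_ge0 ?(ltW (base_cst_gt0 z01)) // (log_base_ge0 f1).
exists (2 * A + 1) => [|u us ub]; first by lra.
rewrite (bigID (fun k => f (zt k) == 0)) /= lerD //.
  rewrite -big_filter; set v := [seq k <- u | _].
  have vP k : k \in v -> ~ clear f z0 delta (a k) /\ f (zt k) = 0.
    by rewrite mem_filter => /andP[/eqP ? /ub].
  have vd k : k \in v -> normc (zt k) < 1 /\ 1 - normc (a k) <= 2 * (1 - normc (zt k)).
    move=> /vP[/ztP[h _] _]; have := normc_lower (zt k) (a k).
    have := ler_wpM2r (ltW (dk k)) d12; have := dk k; lra.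
  apply: le_trans (_ : 2 * \sum_(k <- v) (1 - normc (zt k)) <= _).
    rewrite mulr_sumr big_seq [leRHS]big_seq; apply: ler_sum => k /vd[_].
    exact.
  rewrite ler_pM2l // -(big_map zt xpredT (fun z => 1 - normc z)).
  apply: zeros_blaschke_sum => //.
  - rewrite map_inj_in_uniq ?filter_uniq // => j k /vP[hj _] /vP[hk _].
    exact: inj.
  - by move=> b /mapP[k /vd[h _] ->].
  - by move=> b /mapP[k /vP[_ h] ->].
rewrite -big_filter; set v := [seq k <- u | _].
have vP k : k \in v -> ~ clear f z0 delta (a k) /\ zt k = z0.
  rewrite mem_filter => /andP[/eqP nz /ub nc]; split=> //.
  by have [_ []] := ztP k nc.
have : uniq v by rewrite filter_uniq.
case: v vP => [|k [|j v]] vP; first by rewrite big_nil.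
  by rewrite big_seq1; have := normc_ge0 (a k); lra.
rewrite /= inE => /andP[/norP[/eqP kj _] _]; exfalso; apply: kj.
have [h1 e1] := vP k (mem_head _ _).
have [|h2 e2] := vP j; first by rewrite !inE eqxx orbT.
by apply: inj; rewrite // e1 e2.
Qed.

(** The set where the Stolz angle contains at least n points splits in two: either
    the angle contains a clear point at depth 2^-(n/C), which is a weak-type
    event for log 1/|f|, or half of the n points are not clear, and those obey
    the Blaschke condition. *)
Lemma sufficiency_core : exists (C : nat) (K : R) (e : nat -> R) (S : R),
  [/\ (0 < C)%N, forall n, 0 <= e n, forall N, \sum_(i < N) e i <= S &
   forall n, exists kp : R, [/\ 0 <= kp, kp * gtilde g (n %/ C)%:R <= K &
     (m alpha a n <= (kp + e n)%:E)%E]].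
Proof.
have [sg sg0 gap] := separated_gap ha.
have ad k : normc (a k) < 1 by exact: ha.1.
have dk k : 0 < 1 - normc (a k) by rewrite subr_gt0.
pose delta := Num.min (1 / 2) (sg / 2).
have d0 : 0 < delta by rewrite lt_min !divr_gt0.
have d12 : delta <= 1 / 2 by rewrite ge_min lexx.
have dsg : delta <= sg / 2 by rewrite ge_min lexx orbT.
have ainj j k : a j = a k -> j = k.
  move=> E; apply/eqP; apply/negPn/negP => /gap; apply/negP.
  rewrite E subrr normc0 -ltNge mulr_gt0 //.
  by rewrite normc_gt0 bl_den_neq0 // ltW.
have [C0 C0P] := stolz_count alpha0 sg0.
(* With C > 2 C0, fewer than half of n points fit into the first n / C layers. *)
pose C := (2 * C0).+1.
have [C1 C10 C1P] := weak_measure alpha0 fd f1 z01 fz0 d0 d12.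
have [Sb Sb0 SbP] := unclear_blaschke d0 d12 dsg gap.
pose S k := [set t | ~ clear f z0 delta (a k) /\ shadow alpha (a k) t].
have Sp k : S k `<=` @period R by move=> t [_ []].
have a1 : 0 <= 1 + alpha by have := alpha0; lra.
have SE k : S k = if `[< clear f z0 delta (a k) >] then set0 else shadow alpha (a k).
  case: asboolP => h; apply/seteqP; split=> t //; first by move=> [].
  by move=> [].
have mS k : measurable (S k).
  by rewrite SE; case: asboolP => _; [exact: measurable0|exact: measurable_arc].
have SM n : (\sum_(k < n) mu (S k) <= (32 * (1 + alpha) * Sb)%:E)%E.
  apply: le_trans (_ : (\sum_(k < n) (if `[< clear f z0 delta (a k) >] then 0
      else 32 * (1 + alpha) * (1 - normc (a k)))%:E <= _)%E).
    apply: lee_sum => k _; rewrite SE; case: ifPn => _; first by rewrite measure0.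
    exact: shadow_measure.
  rewrite sumEFin lee_fin -(big_mkord xpredT (fun k => if `[< clear f z0 delta (a k) >]
     then 0 else 32 * (1 + alpha) * (1 - normc (a k)))).
  rewrite (eq_bigr (fun k => if ~~ `[< clear f z0 delta (a k) >]
     then 32 * (1 + alpha) * (1 - normc (a k)) else 0)); last by move=> k _; case: ifP.
  rewrite -big_mkcond -mulr_sumr -big_filter ler_wpM2l ?mulr_ge0 //.
  apply: SbP; first by rewrite filter_uniq // iota_uniq.
  by move=> k; rewrite mem_filter => /andP[/asboolPn].
have := layer_cake mS Sp SM; set psi := (fun t : R => _) => /= -[mA sumA cntA].
pose A (n : nat) := @period R `&` [set t | ((n%:R / 2)%:E <= psi t)%E].
have mAn n : measurable (A n) by exact: mA.
have Afin n : (mu (A n) <= 8%:E)%E by apply: period_measure_le => // t [].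
have finE (B : set R) : (mu B <= 8%:E)%E -> mu B = (fine (mu B))%:E.
  move=> h; rewrite fineK // ge0_fin_numE //; exact: le_lt_trans h (ltry _).
pose e n := fine (mu (A n)).
have eE n : mu (A n) = (e n)%:E by exact: finE.
have e0 n : 0 <= e n by rewrite fine_ge0.
exists C, (16 + 4 * C1), e, (8 + 2 * (32 * (1 + alpha) * Sb)); split=> //.
  move=> [|N]; first by rewrite big_ord0 addr_ge0 // !mulr_ge0.
  rewrite big_ord_recl lerD //; first by rewrite -lee_fin -eE.
  rewrite -lee_fin -sumEFin; apply: le_trans (sumA N).
  by apply: lee_sum => i _; rewrite -eE.
move=> n; set j := (n %/ C)%N.
pose P k := clear f z0 delta (a k) /\ 1 - normc (a k) <= (2 ^+ j)^-1.
pose G := [set t | exists k, P k /\ shadow alpha (a k) t].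
have Pcl k : P k -> clear f z0 delta (a k) by case.
have Pf k : P k -> normc (f (a k)) <= expR (- gtilde g j%:R).
  move=> [_ h]; rewrite -(g_dyadic hg); apply: le_trans (fa k) _.
  have [_ gm _] := hg; have /andP[r0 _] := dyadic_radius R j.
  apply: gm => //; lra.
have mG : measurable G.
  have -> : G = \bigcup_(k in P) shadow alpha (a k).
    by apply/seteqP; split=> t; [move=> [k [Pk h]]; exists k|move=> [k Pk h]; exists k].
  by apply: bigcup_measurable => k _; exact: measurable_arc.
have G8 : (mu G <= 8%:E)%E by apply: period_measure_le => // t [k [_ []]].
pose kp := fine (mu G).
have kpE : mu G = kp%:E by exact: finE.
have kp0 : 0 <= kp by rewrite fine_ge0.
have gt0 := gtilde_ge0 hg j.
exists kp; split=> //.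
  (* Below 2 the trivial bound by the length of the period suffices. *)
  have [g2|g2] := ltP (gtilde g j%:R) 2.
    have : kp <= 8 by rewrite -lee_fin -kpE.
    have := mulr_ge0 kp0 gt0; nra.
  have [k /andP[k1 k2]] := dyadic_scale g2.
  have [|h _] := C1P k a P Pcl.
    by move=> i /Pf h; apply: (le_trans h); exact: quarter_expR.
  rewrite -/G kpE lee_fin in h.
  have p0 := pow2_gt0 R k; move: h; rewrite ler_pdivlMr // => h.
  have : kp * gtilde g j%:R <= kp * (4 * 2 ^+ k) by rewrite ler_wpM2l // ltW.
  lra.
have mAG : measurable (G `|` A n) by exact: measurableU.
apply: le_trans (_ : mu (G `|` A n) <= _)%E; last first.
  by rewrite EFinD -kpE -eE; exact: (measureU2 mu mG (mAn n)).
rewrite /m; apply: le_mu_ext => t [tp tn].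
have tP : @period R t by rewrite /period /= in_itv.
have [Gt|nG] := pselect (G t); [by left|right; split=> //=].
have [s [us sn sP]] := counting_list tn.
have [ix ixP] : exists ix : R[i] -> nat, forall b, b \in s -> a (ix b) = b.
  suff /choice[ix ?] : forall b, exists k, b \in s -> a k = b by exists ix.
  move=> b; have [/sP[[k _ <-] _]|_] := boolP (b \in s); first by exists k.
  by exists 0%N.
pose u := [seq ix b | b <- s].
have uu : uniq u.
  rewrite map_inj_in_uniq // => b c /ixP hb /ixP hc E.
  by rewrite -hb -hc E.
have uP k : k \in u -> shadow alpha (a k) t.
  move=> /mapP[b bs ->]; rewrite ixP //; have [[k' _ kb] st] := sP b bs.
  have b1 : normc b < 1 by rewrite -kb; exact: ad.
  by split; [exact: tP|exact: (proj1 (stolzP alpha t b1) st)].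
pose cl k := `[< clear f z0 delta (a k) >].
pose u1 := [seq k <- u | cl k]; pose u2 := [seq k <- u | ~~ cl k].
have su : (size u1 + size u2 = n)%N.
  by rewrite !size_filter count_predC size_map sn.
have s1 : (size u1 <= C0 * j)%N.
  have -> : size u1 = size [seq a k | k <- u1] by rewrite size_map.
  apply: (C0P t).
  - rewrite map_inj_in_uniq ?filter_uniq // => k l _ _; exact: ainj.
  - move=> b /mapP[k]; rewrite mem_filter => /andP[/asboolP ck ku] ->.
    split=> //; first by have [] := uP k ku.
    rewrite ltNge; apply/negP => h; apply: nG; exists k.
    by split; [|exact: uP].
  - move=> b c /mapP[k _ ->] /mapP[l _ ->] kl; apply: gap.
    by apply: contraNneq kl => ->.
have s2 : (n <= 2 * size u2)%N.
  have Cj : (C * j <= n)%N by rewrite mulnC leq_divM.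
  rewrite -su mul2n -addnn leq_add2r -(leq_add2l (size u1)) su addnn -mul2n.
  apply: leq_trans Cj; rewrite /C [leqRHS]mulSn -mulnA.
  by rewrite (leq_trans _ (leq_addl _ _)) // leq_mul2l.
have := cntA t u2 (filter_uniq _ uu).
move=> /(_ _)/wrap[|]; last first.
  apply: le_trans; rewrite lee_fin ler_pdivrMr // -natrM ler_nat mulnC.
  exact: s2.
move=> k; rewrite mem_filter => /andP[/asboolPn ck ku].
by split=> //; exact: uP.
Qed.

End Sufficiency.

(** * Limits of holomorphic functions and infinite Blaschke products *)

Section Limits.
Variable R : realType.
Implicit Types (u : nat -> R[i]) (z w h a : R[i]) (f : R[i] -> R[i]).

Definition clim u l := forall e : R, 0 < e -> exists N, forall n, (N <= n)%N ->
  normc (u n - l) < e.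

Lemma real_cauchy (x : nat -> R) :
  (forall e : R, 0 < e -> exists N, forall n m, (N <= n)%N -> (N <= m)%N ->
     `|x n - x m| <= e) ->
  exists l, forall e : R, 0 < e -> exists N, forall n, (N <= n)%N -> `|x n - l| <= e.
Proof.
move=> H; pose E := [set y | exists N, forall n, (N <= n)%N -> y <= x n].
exists (sup E) => e e0; have e2 : 0 < e / 2 by rewrite divr_gt0.
have [N NP] := H _ e2; exists N => n Nn.
have lo : E (x n - e / 2).
  by exists N => k Nk; have := NP n k Nn Nk; rewrite ler_norml; lra.
have up : ubound E (x n + e / 2).
  move=> y [M MP]; pose k := maxn N M.
  have := MP k (leq_maxr _ _); have := NP n k Nn (leq_maxl _ _).
  by rewrite ler_norml; lra.
have h1 : x n - e / 2 <= sup E by apply: ub_le_sup => //; exists (x n + e / 2).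
have h2 : sup E <= x n + e / 2 by apply: ge_sup => //; exists (x n - e / 2).
by rewrite ler_norml; lra.
Qed.

Lemma complex_cauchy u :
  (forall e : R, 0 < e -> exists N, forall n m, (N <= n)%N -> (N <= m)%N ->
     normc (u n - u m) <= e) -> exists l, clim u l.
Proof.
move=> H.
have [|x xP] := @real_cauchy (fun n => complex.Re (u n)).
  move=> e /H[N NP]; exists N => n m Nn Nm.
  by rewrite -raddfB; apply: le_trans (normc_leRe _) (NP n m Nn Nm).
have [|y yP] := @real_cauchy (fun n => complex.Im (u n)).
  move=> e /H[N NP]; exists N => n m Nn Nm.
  by rewrite -raddfB; apply: le_trans (normc_leIm _) (NP n m Nn Nm).
exists (Complex x y) => e e0; have e3 : 0 < e / 3 by rewrite divr_gt0.
have [N NP] := xP _ e3; have [M MP] := yP _ e3; exists (maxn N M) => n.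
rewrite geq_max => /andP[/NP h1 /MP h2]; apply: le_lt_trans (normc_le_ReIm _) _.
by rewrite !raddfB /=; lra.
Qed.

Lemma clim_increments u (S : nat -> R) (B : R) : (forall n, S n <= B) ->
  (forall n, normc (u n.+1 - u n) <= S n.+1 - S n) -> exists l, clim u l.
Proof.
move=> SB inc; have tail n k : normc (u (n + k)%N - u n) <= S (n + k)%N - S n.
  elim: k => [|k IH]; first by rewrite addn0 !subrr normc0.
  rewrite addnS; have := normc_tri (u (n + k).+1) (u (n + k)%N) (u n).
  have := inc (n + k)%N; lra.
pose E := range S.
have E0 : has_sup E by split; [exists (S 0%N), 0%N|exists B => _ [n _ <-]].
apply: complex_cauchy => e e0; have e2 : 0 < e / 2 by rewrite divr_gt0.
have [_ [N _ <-] SN] := sup_adherent e2 E0.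
have near n : (N <= n)%N -> normc (u n - u N) <= e / 2.
  move=> Nn; rewrite -(subnKC Nn); apply: le_trans (tail _ _) _.
  have : S (N + (n - N))%N <= sup E by apply: ub_le_sup; [exact: E0.2|exists (N + (n - N))%N].
  lra.
exists N => n m /near h1 /near h2.
have := normc_tri (u n) (u N) (u m); rewrite (normc_sub (u N)); lra.
Qed.

Lemma clim_unique u l l' : clim u l -> clim u l' -> l = l'.
Proof.
move=> H H'; apply/eqP; rewrite -subr_eq0 -normc_eq0 eq_le normc_ge0 andbT.
apply/ler_addgt0Pr => e e0; rewrite add0r; have e2 : 0 < e / 2 by rewrite divr_gt0.
have [N NP] := H _ e2; have [M MP] := H' _ e2.
have := NP _ (leq_maxl N M); have := MP _ (leq_maxr N M).
have := normc_tri l (u (maxn N M)) l'; rewrite (normc_sub l (u _)); lra.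
Qed.

Lemma clim_const u l c : clim u l -> (exists N, forall n, (N <= n)%N -> u n = c) -> l = c.
Proof.
move=> ul [N NP]; apply: (@clim_unique u) => // e e0; exists N => n /NP ->.
by rewrite subrr normc0.
Qed.

Lemma clim_normc_le u l (M : R) : clim u l -> (forall n, normc (u n) <= M) ->
  normc l <= M.
Proof.
move=> H uM; apply/ler_addgt0Pr => e /H[N /(_ N (leqnn N)) h].
have := normc_lower l (u N); rewrite normc_sub; have := uM N; lra.
Qed.

Lemma clim_normc_ge u l (M : R) : clim u l -> (forall n, M <= normc (u n)) ->
  M <= normc l.
Proof.
move=> H uM; apply/ler_addgt0Pr => e /H[N /(_ N (leqnn N)) h].
have := normc_lower (u N) l; have := uM N; lra.
Qed.

Lemma clim_Re_ge u l (M : R) : clim u l ->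
  (exists N, forall n, (N <= n)%N -> M <= complex.Re (u n)) -> M <= complex.Re l.
Proof.
move=> H [N0 uM]; apply/ler_addgt0Pr => e /H[N /(_ _ (leq_maxl N N0)) h].
have := uM _ (leq_maxr N N0); have := normc_leRe (u (maxn N N0) - l).
by rewrite raddfB /= ler_norml => /andP[]; lra.
Qed.

(** The uniform second-order remainders make the derivatives at z a Cauchy sequence,
    whose limit is the derivative of the pointwise limit. *)
Lemma limit_cdiff (F : nat -> R[i] -> R[i]) (D : nat -> R[i]) f z (r C : R) :
  0 < r -> 0 <= C ->
  (forall n w, normc (w - z) < r ->
     normc (F n w - F n z - D n * (w - z)) <= C * normc (w - z) ^+ 2) ->
  (forall w, normc (w - z) < r -> clim (F^~ w) (f w)) -> cdiff f z.
Proof.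
move=> r0 C0 rem lim.
have zr : normc (z - z) < r by rewrite subrr normc0.
have [l Dl] : exists l, clim D l.
  apply: complex_cauchy => e e0; (* At the increment x the remainders are at most e x / 4 each. *)
  pose x := Num.min (r / 2) (e / (4 * (C + 1))).
  have C1 : 0 < 4 * (C + 1) by lra.
  have x0 : 0 < x by rewrite lt_min !divr_gt0.
  have xr : x < r by apply: le_lt_trans (_ : r / 2 < r); [rewrite ge_min lexx|lra].
  have xe : x * (4 * (C + 1)) <= e by rewrite -ler_pdivlMr // ge_min lexx orbT.
  pose w := z + x%:C%C.
  have wz : w - z = x%:C%C by rewrite /w addrC addKr.
  have nx : normc (x%:C%C : R[i]) = x by rewrite normc_real gtr0_norm.
  have wr : normc (w - z) < r by rewrite wz nx.
  have q0 : 0 < e * x / 8 by rewrite divr_gt0 // mulr_gt0.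
  have [N NP] := lim w wr _ q0; have [M MP] := lim z zr _ q0.
  exists (maxn N M) => n m; rewrite !geq_max => /andP[/NP a1 /MP a2] /andP[/NP b1 /MP b2].
  have := rem n w wr; have := rem m w wr; rewrite wz nx => c1 c2.
  have : normc ((D n - D m) * x%:C%C) <= e * x.
    have -> : (D n - D m) * x%:C%C = (F n w - f w) - (F m w - f w) - (F n z - f z) +
      (F m z - f z) - (F n w - F n z - D n * x%:C%C) + (F m w - F m z - D m * x%:C%C).
      by ring.
    have xx : C * x ^+ 2 <= e * x / 4.
      have := mulr_ge0 C0 (ltW x0); have := ler_wpM2r (ltW x0) xe; nra.
    apply: le_trans (normcD _ _) _.
    apply: le_trans (lerD (normcB _ _) (lexx _)) _.
    apply: le_trans (lerD (lerD (normcD _ _) (lexx _)) (lexx _)) _.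
    apply: le_trans (lerD (lerD (lerD (normcB _ _) (lexx _)) (lexx _)) (lexx _)) _.
    apply: le_trans (lerD (lerD (lerD (lerD (normcB _ _) (lexx _)) (lexx _)) (lexx _)) (lexx _)) _.
    lra.
  by rewrite normcM nx ler_pM2r.
have limrem w : normc (w - z) < r ->
    normc (f w - f z - l * (w - z)) <= C * normc (w - z) ^+ 2.
  move=> wr; apply/ler_addgt0Pr => e e0; have e4 : 0 < e / 3 by rewrite divr_gt0.
  have p1 : 0 < normc (w - z) + 1 by rewrite ltr_wpDl ?normc_ge0.
  have e5 : 0 < e / 3 / (normc (w - z) + 1) by rewrite divr_gt0.
  have [N NP] := lim w wr _ e4; have [M MP] := lim z zr _ e4; have [P PP] := Dl _ e5.
  pose n := maxn N (maxn M P).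
  have h1 := NP n (leq_maxl _ _).
  have h2 := MP n (leq_trans (leq_maxl _ _) (leq_maxr _ _)).
  have h3 := PP n (leq_trans (leq_maxr _ _) (leq_maxr _ _)).
  have -> : f w - f z - l * (w - z) = (F n w - F n z - D n * (w - z)) -
     (F n w - f w) + (F n z - f z) + (D n - l) * (w - z) by ring.
  apply: le_trans (normcD _ _) _.
  apply: le_trans (lerD (normcD _ _) (lexx _)) _.
  apply: le_trans (lerD (lerD (normcB _ _) (lexx _)) (lexx _)) _.
  have : normc ((D n - l) * (w - z)) <= e / 3.
    rewrite normcM; move: h3; rewrite ltr_pdivlMr // => h3.
    have := normc_ge0 (D n - l); lra.
  have := rem n w wr; lra.
apply: (@cdiff_eps _ _ _ l) => e e0.
have C1 : 0 < C + 1 by lra.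
exists (Num.min r (e / (C + 1))); first by rewrite lt_min r0 divr_gt0.
move=> w; rewrite lt_min => /andP[wr we]; apply: (le_trans (limrem w wr)).
rewrite expr2 mulrA ler_wpM2r ?normc_ge0 //.
move: we; rewrite ltr_pdivlMr //; have := normc_ge0 (w - z); lra.
Qed.

(** The Moebius factor with zero a, rotated to be positive at the origin: then it
    is within O(1 - |a|) of 1 on compact subsets of the disk. *)
Definition nbl a z : R[i] := - (normc a)%:C%C / a * bl a z.

Lemma nbl_rot a : a != 0 -> normc (- (normc a)%:C%C / a) = 1.
Proof.
move=> a0; rewrite normcf_div normcN normc_real ger0_norm ?normc_ge0 //.
by rewrite divff // normc_eq0.
Qed.

Lemma nbl_le1 a z : a != 0 -> normc a < 1 -> normc z <= 1 -> normc (nbl a z) <= 1.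
Proof. by move=> a0 a1 z1; rewrite normcM nbl_rot // mul1r bl_le1. Qed.

Lemma nbl_near1 a z : a != 0 -> normc a < 1 -> normc z < 1 ->
  normc (nbl a z - 1) <= 2 / (1 - normc z) * (1 - normc a).
Proof.
move=> a0 a1 z1; have dn := bl_den_neq0 a1 (ltW z1).
have na : 0 < normc a by rewrite normc_gt0.
have aE : conjc a = (normc a ^+ 2)%:C%C / a.
  apply: (mulIf a0); rewrite divfK // normc_sqr.
  by case: (a) => x y; apply/eqP; rewrite eq_complex /=; apply/andP; split; apply/eqP; ring.
have E : nbl a z - 1 = - ((1 - normc a)%:C%C * (a + (normc a)%:C%C * z) /
    (a * (1 - conjc a * z))).
  rewrite /nbl /bl; rewrite aE in dn *.
  rewrite rmorphB rmorphXn /= in dn *; move: dn; move: ((normc a)%:C%C) => n dn.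
  have dn' : a - n ^+ 2 * z != 0.
    apply: contraNneq dn => h; have -> : 1 - n ^+ 2 / a * z = (a - n ^+ 2 * z) / a by field.
    by rewrite h mul0r.
  by field; rewrite a0.
rewrite E normcN normcf_div !normcM normc_real ger0_norm; last by rewrite subr_ge0 ltW.
have h1 : normc (a + (normc a)%:C%C * z) <= 2 * normc a.
  apply: le_trans (normcD _ _) _; rewrite normcM normc_real ger0_norm ?(ltW na) //.
  have := ler_pM2l na (normc z) 1; rewrite mulr1 (ltW z1) => h; lra.
have h2 := bl_den_ge_sym z (ltW a1).
have r0 : 0 < 1 - normc z by rewrite subr_gt0.
have d0 : 0 <= 1 - normc a by rewrite subr_ge0 ltW.
rewrite ler_pdivrMr ?mulr_gt0 // ?(lt_le_trans r0 h2) //.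
have -> : 2 / (1 - normc z) * (1 - normc a) * (normc a * normc (1 - conjc a * z)) =
  (1 - normc a) * (2 * normc a) * (normc (1 - conjc a * z) / (1 - normc z)) by field; rewrite gt_eqF.
rewrite -[leLHS]mulr1; apply: ler_pM => //.
- by rewrite mulr_ge0 // normc_ge0.
- by rewrite ler_wpM2l.
- by rewrite ler_pdivlMr // mul1r.
Qed.

Definition quad_cst z : R := 4 / (1 - normc z) ^+ 3.

Lemma quad_cst_ge0 z : normc z < 1 -> 0 <= quad_cst z.
Proof. by move=> z1; rewrite divr_ge0 ?exprn_ge0 // subr_ge0 ltW. Qed.

(** The differences of nbl a have a factor conj a a - 1, of size O(1 - |a|), so that
    the remainders of an infinite product are summable. *)
Lemma nbl_quad a z : a != 0 -> normc a < 1 -> normc z < 1 -> exists D,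
  normc D <= quad_cst z * (1 - normc a) /\ forall w, normc (w - z) < (1 - normc z) / 2 ->
   normc (nbl a w - nbl a z) <= quad_cst z * (1 - normc a) * normc (w - z) /\
   normc (nbl a w - nbl a z - D * (w - z)) <=
     quad_cst z * (1 - normc a) * normc (w - z) ^+ 2.
Proof.
move=> a0 a1 z1; set c := - (normc a)%:C%C / a.
have nc : normc c = 1 by exact: nbl_rot.
have dn := bl_den_neq0 a1 (ltW z1).
have r0 : 0 < 1 - normc z by rewrite subr_gt0.
have r1 : 1 - normc z <= 1 by have := normc_ge0 z; lra.
have d0 : 0 <= 1 - normc a by rewrite subr_ge0 ltW.
set k : R[i] := conjc a * a - 1.
have nk : normc k <= 2 * (1 - normc a).
  have -> : k = - (1 - normc a ^+ 2)%:C%C.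
    rewrite /k normc_sqr; case: (a) => x y; apply/eqP; rewrite eq_complex /=.
    by apply/andP; split; apply/eqP; ring.
  rewrite normcN normc_real ger0_norm; last by rewrite subr_ge0 sqr_le1 ?normc_ge0 // ltW.
  by have := normc_ge0 a; nra.
have h0 : 1 - normc z <= normc (1 - conjc a * z) by exact: bl_den_ge_sym (ltW a1).
have i0 : (normc (1 - conjc a * z))^-1 <= (1 - normc z)^-1.
  by rewrite lef_pV2 ?posrE // (lt_le_trans r0).
have ir : 0 < (1 - normc z)^-1 by rewrite invr_gt0.
have ir1 : 1 <= (1 - normc z)^-1 by rewrite invf_ge1.
set rho := (1 - normc z)^-1 in i0 ir ir1.
have qE : quad_cst z = 4 * rho ^+ 3 by rewrite /quad_cst /rho exprVn.
have y0 : 0 <= (normc (1 - conjc a * z))^-1 by rewrite invr_ge0 normc_ge0.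
have k0 := normc_ge0 k.
have rho0 := ltW ir.
have y2 : (normc (1 - conjc a * z))^-1 ^+ 2 <= rho ^+ 2 by rewrite lerXn2r ?nnegrE.
have y20 : 0 <= (normc (1 - conjc a * z))^-1 ^+ 2 by exact: sqr_ge0.
have r23 : rho ^+ 2 <= rho ^+ 3 by rewrite exprS ler_peMl // sqr_ge0.
pose D := - c * k / (1 - conjc a * z) ^+ 2.
exists D; split.
  rewrite /D normcM normcM normcN nc mul1r normcV normcX -exprVn qE.
  apply: le_trans (_ : 2 * (1 - normc a) * rho ^+ 2 <= _); first exact: ler_pM.
  have := ler_wpM2l d0 r23; have := mulr_ge0 d0 (exprn_ge0 3 rho0); lra.
move=> w wz.
have w1 : normc w <= (1 + normc z) / 2 by have := normc_lower w z; lra.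
have w2 : normc w < 1 by lra.
have dw := bl_den_neq0 a1 (ltW w2).
have h0w : (1 - normc z) / 2 <= normc (1 - conjc a * w).
  by apply: le_trans (bl_den_ge_sym w (ltW a1)); lra.
have i0w : (normc (1 - conjc a * w))^-1 <= 2 * rho.
  have -> : 2 * rho = ((1 - normc z) / 2)^-1 by rewrite invfM invrK mulrC.
  have r2 : 0 < (1 - normc z) / 2 by rewrite divr_gt0.
  by rewrite lef_pV2 ?posrE // (lt_le_trans r2).
have yw0 : 0 <= (normc (1 - conjc a * w))^-1 by rewrite invr_ge0 normc_ge0.
have n0 := normc_ge0 (w - z).
have E1 : nbl a w - nbl a z = - c * k * (w - z) / ((1 - conjc a * w) * (1 - conjc a * z)).
  by rewrite /nbl -/c /bl /k; field; rewrite dn dw.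
have E2 : nbl a w - nbl a z - D * (w - z) =
    - c * k * (w - z) * (conjc a * (w - z)) / ((1 - conjc a * w) * (1 - conjc a * z) ^+ 2).
  by rewrite E1 /D; field; rewrite dn dw.
split.
  rewrite E1 normcf_div !normcM normcN nc mul1r invfM qE.
  apply: le_trans (_ : 2 * (1 - normc a) * normc (w - z) * ((2 * rho) * rho) <= _).
    by apply: ler_pM; rewrite ?mulr_ge0 //; apply: ler_pM.
  have := ler_wpM2l (mulr_ge0 d0 n0) r23; lra.
rewrite E2 normcf_div !normcM normcN nc mul1r normc_conj !invfM -expr2 qE.
apply: le_trans (_ : 2 * (1 - normc a) * normc (w - z) * (1 * normc (w - z)) *
    ((2 * rho) * rho ^+ 2) <= _).
  apply: ler_pM; rewrite ?mulr_ge0 ?normc_ge0 //.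
    apply: ler_pM; rewrite ?mulr_ge0 ?normc_ge0 //; first exact: ler_pM.
    by rewrite ler_wpM2r // ltW.
  exact: ler_pM.
by rewrite le_eqVlt; apply/orP; left; apply/eqP; ring.
Qed.

Definition nblprod (s : seq R[i]) z : R[i] := \prod_(a <- s) nbl a z.

Definition punctured (s : seq R[i]) := forall a, a \in s -> a != 0 /\ normc a < 1.

Lemma punctured_cons a s : punctured (a :: s) -> [/\ a != 0, normc a < 1 & punctured s].
Proof.
move=> H; have [a0 a1] := H a (mem_head _ _); split=> // b bs.
by apply: H; rewrite inE bs orbT.
Qed.

Lemma nblprod_le1 s z : punctured s -> normc z <= 1 -> normc (nblprod s z) <= 1.
Proof.
move=> + z1; elim: s => [_|a s IH /punctured_cons[a0 a1 /IH h]].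
  by rewrite /nblprod big_nil normc1.
by rewrite /nblprod big_cons normcM mulr_ile1 ?normc_ge0 // nbl_le1.
Qed.

Lemma nblprod_near1 s z : punctured s -> normc z < 1 ->
  normc (nblprod s z - 1) <= 2 / (1 - normc z) * \sum_(a <- s) (1 - normc a).
Proof.
move=> + z1; elim: s => [_|a s IH /punctured_cons[a0 a1 ps]].
  by rewrite /nblprod !big_nil subrr normc0 mulr0.
have := IH ps; rewrite /nblprod !big_cons mulrDr => h.
have -> : nbl a z * (\prod_(j <- s) nbl j z) - 1 =
  (nbl a z - 1) + nbl a z * (\prod_(j <- s) nbl j z - 1) by ring.
apply: le_trans (normcD _ _) _; apply: lerD; first exact: nbl_near1.
rewrite normcM; apply: le_trans h; rewrite ler_piMl ?normc_ge0 //.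
by rewrite nbl_le1 // ltW.
Qed.

Lemma nblprod_at0 s : punctured s -> (forall a, a \in s -> 1 - normc a <= 1 / 2) ->
  expR (- (2 * \sum_(a <- s) (1 - normc a))) <= normc (nblprod s 0).
Proof.
elim: s => [_ _|a s IH /punctured_cons[a0 a1 ps] H].
  by rewrite /nblprod !big_nil mulr0 oppr0 expR0 normc1.
have h : forall b, b \in s -> 1 - normc b <= 1 / 2.
  by move=> b bs; apply: H; rewrite inE bs orbT.
rewrite /nblprod !big_cons mulrDr opprD expRD normcM; apply: ler_pM; rewrite ?expR_ge0 //.
  have -> : normc (nbl a 0) = 1 - (1 - normc a).
    rewrite normcM nbl_rot // /bl mulr0 subr0 divr1 sub0r normcN; ring.
  by apply: expR_le_1B; [rewrite subr_ge0 ltW|apply: H; exact: mem_head].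
exact: IH.
Qed.

(** Product rule by induction: S bounds the derivative, and the cross terms of the
    first-order differences add up to S^2. *)
Lemma nblprod_quad s z : punctured s -> normc z < 1 ->
  let S := quad_cst z * \sum_(a <- s) (1 - normc a) in
  exists D, normc D <= S /\ forall w, normc (w - z) < (1 - normc z) / 2 ->
    normc (nblprod s w - nblprod s z - D * (w - z)) <= (S + S ^+ 2) * normc (w - z) ^+ 2.
Proof.
move=> + z1; elim: s => [_|a s IH /punctured_cons[a0 a1 ps]] S.
  exists 0; split; first by rewrite normc0 /S big_nil mulr0.
  move=> w _; rewrite /nblprod !big_nil subrr mul0r subr0 normc0.
  by rewrite /S big_nil mulr0 expr0n addr0 mul0r.
have [D [D1 D2]] := IH ps; have [E [E1 E2]] := nbl_quad a0 a1 z1.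
set S' := quad_cst z * _ in D1 D2; set t := quad_cst z * _ in E1 E2.
have SE : S = t + S' by rewrite /S big_cons mulrDr.
have t0 : 0 <= t by exact: le_trans (normc_ge0 _) E1.
have S0 : 0 <= S' by exact: le_trans (normc_ge0 _) D1.
have b1 := nbl_le1 a0 a1 (ltW z1); have P1 := nblprod_le1 ps (ltW z1).
exists (D * nbl a z + nblprod s z * E); split.
  apply: le_trans (normcD _ _) _.
  rewrite (normcM D) (normcM (nblprod s z)) SE addrC; apply: lerD.
    by rewrite -[leRHS]mul1r ler_pM ?normc_ge0.
  by rewrite -[leRHS]mulr1 ler_pM ?normc_ge0.
move=> w wz; have [F1 F2] := E2 w wz; have G := D2 w wz.
have w1 : normc w <= 1 by have := normc_lower w z; lra.
have bw := nbl_le1 a0 a1 w1.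
have -> : nblprod (a :: s) w - nblprod (a :: s) z -
    (D * nbl a z + nblprod s z * E) * (w - z) =
  nbl a w * (nblprod s w - nblprod s z - D * (w - z)) +
  D * (w - z) * (nbl a w - nbl a z) +
  nblprod s z * (nbl a w - nbl a z - E * (w - z)).
  by rewrite /nblprod !big_cons; ring.
apply: le_trans (normcD _ _) _.
apply: le_trans (lerD (normcD _ _) (lexx _)) _.
rewrite (normcM (nbl a w)) (normcM (D * _)) (normcM D) (normcM (nblprod s z)) SE.
set x := normc (w - z) in F1 F2 G *; have x0 : 0 <= x by exact: normc_ge0.
have T1 : normc (nbl a w) * normc (nblprod s w - nblprod s z - D * (w - z)) <=
    (S' + S' ^+ 2) * x ^+ 2.
  by rewrite -[leRHS]mul1r ler_pM ?normc_ge0.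
have T2 : normc D * x * normc (nbl a w - nbl a z) <= S' * x * (t * x).
  by apply: ler_pM; rewrite ?mulr_ge0 ?normc_ge0 //; apply: ler_pM; rewrite ?normc_ge0.
have T3 : normc (nblprod s z) * normc (nbl a w - nbl a z - E * (w - z)) <= t * x ^+ 2.
  by rewrite -[leRHS]mul1r ler_pM ?normc_ge0.
have := mulr_ge0 (mulr_ge0 S0 t0) (sqr_ge0 x).
have := mulr_ge0 (sqr_ge0 t) (sqr_ge0 x).
lra.
Qed.

(** Infinite Blaschke products, as limits of partial products over an increasing
    union of finite levels. *)
Lemma infinite_blaschke (pts : nat -> seq R[i]) (S : R) :
  (forall j, punctured (pts j)) ->
  (forall j a, a \in pts j -> 1 - normc a <= 1 / 2) ->
  (forall n, \sum_(j < n) \sum_(a <- pts j) (1 - normc a) <= S) ->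
  exists B : R[i] -> R[i], [/\ forall z, normc z < 1 -> cdiff B z,
    forall z, normc z < 1 -> normc (B z) <= 1, B 0 != 0 &
    forall j a, a \in pts j -> B a = 0].
Proof.
move=> pp ph pS; pose cum n := flatten [seq pts j | j <- iota 0 n].
have cumS n : cum n.+1 = cum n ++ pts n.
  by rewrite /cum -addn1 iotaD map_cat flatten_cat /= cats0.
have cumP n a : a \in cum n -> exists2 j, (j < n)%N & a \in pts j.
  by move=> /flatten_mapP[j]; rewrite mem_iota /= add0n => jn aj; exists j.
have pc n : punctured (cum n) by move=> a /cumP[j _]; exact: pp.
have sumE n : \sum_(a <- cum n) (1 - normc a) = \sum_(j < n) \sum_(a <- pts j) (1 - normc a).
  elim: n => [|n IH]; first by rewrite big_ord0 big_nil.
  by rewrite cumS big_cat /= IH big_ord_recr.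
have sumS n : \sum_(a <- cum n) (1 - normc a) <= S by rewrite sumE.
pose F n z := nblprod (cum n) z.
have lim z : normc z < 1 -> exists l, clim (F^~ z) l.
  move=> z1; have c0 : 0 <= 2 / (1 - normc z) by rewrite divr_ge0 // subr_ge0 ltW.
  apply: (@clim_increments _ (fun n => 2 / (1 - normc z) * \sum_(a <- cum n) (1 - normc a))
     (2 / (1 - normc z) * S)) => n; first exact: ler_wpM2l.
  have -> : 2 / (1 - normc z) * \sum_(a <- cum n.+1) (1 - normc a) -
      2 / (1 - normc z) * \sum_(a <- cum n) (1 - normc a) =
      2 / (1 - normc z) * \sum_(a <- pts n) (1 - normc a).
    by rewrite cumS big_cat /=; ring.
  rewrite /F /nblprod cumS big_cat /=.
  rewrite -/(nblprod (cum n) z) -/(nblprod (pts n) z) -[X in _ - X]mulr1 -mulrBr normcM.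
  apply: le_trans (nblprod_near1 (pp n) z1).
  by rewrite ler_piMl ?normc_ge0 // nblprod_le1 // ltW.
have [B BP] : exists B : R[i] -> R[i], forall z, normc z < 1 -> clim (F^~ z) (B z).
  suff /choice[B ?] : forall z, exists l, normc z < 1 -> clim (F^~ z) l by exists B.
  move=> z; have [/lim[l lP]|_] := boolP (normc z < 1); first by exists l.
  by exists 0.
exists B; split.
- move=> z z1; have q0 := quad_cst_ge0 z1; pose M := quad_cst z * S.
  have [D DP] : exists D : nat -> R[i], forall n w, normc (w - z) < (1 - normc z) / 2 ->
      normc (F n w - F n z - D n * (w - z)) <= (M + M ^+ 2) * normc (w - z) ^+ 2.
    suff /choice[D ?] : forall n, exists D, forall w, normc (w - z) < (1 - normc z) / 2 ->
      normc (F n w - F n z - D * (w - z)) <= (M + M ^+ 2) * normc (w - z) ^+ 2 by exists D.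
    move=> n; have [D [D1 D2]] := nblprod_quad (pc n) z1; exists D => w /D2 h.
    apply: (le_trans h); rewrite ler_wpM2r ?sqr_ge0 //.
    have s0 := le_trans (normc_ge0 _) D1.
    have sM : quad_cst z * \sum_(a <- cum n) (1 - normc a) <= M by exact: ler_wpM2l.
    by apply: lerD => //; rewrite lerXn2r ?nnegrE // (le_trans s0).
  have S0 : 0 <= S by have := pS 0%N; rewrite big_ord0.
  have M0 : 0 <= M by exact: mulr_ge0.
  have r0 : 0 < (1 - normc z) / 2 by rewrite divr_gt0 // subr_gt0.
  apply: (limit_cdiff r0 _ DP); first by rewrite addr_ge0 // sqr_ge0.
  move=> w wz; apply: BP; have := normc_lower w z; lra.
- move=> z z1; apply: (clim_normc_le (BP z z1)) => n.
  by apply: nblprod_le1 => //; exact: ltW.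
- have z1 : normc (0 : R[i]) < 1 by rewrite normc0.
  rewrite -normc_gt0; apply: lt_le_trans (expR_gt0 (- (2 * S))) _.
  apply: (clim_normc_ge (BP 0 z1)) => n.
  apply: le_trans (_ : expR (- (2 * \sum_(a <- cum n) (1 - normc a))) <= _).
    by rewrite ler_expR lerN2 ler_pM2l.
  by apply: nblprod_at0 => // a /cumP[j _]; exact: ph.
- move=> j a aj; have [a0 a1] := pp j a aj.
  apply: (clim_const (BP a a1)); exists j.+1 => n jn; apply/eqP.
  rewrite /F /nblprod prodf_seq_eq0; apply/hasP; exists a.
    by apply/flatten_mapP; exists j; rewrite // mem_iota.
  by rewrite /= /nbl /bl subrr mul0r mulr0.
Qed.

(** * The Herglotz kernel *)

(** Its real part is the Poisson kernel. *)
Definition herglotz (th : R) z : R[i] := (expi th + z) / (expi th - z).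

Lemma herglotz_den th z : normc z < 1 -> 1 - normc z <= normc (expi th - z).
Proof. by move=> z1; have := normc_lower (expi th) z; rewrite normc_expi. Qed.

Lemma herglotz_den_neq0 th z : normc z < 1 -> expi th - z != 0.
Proof.
move=> z1; rewrite -normc_gt0; apply: lt_le_trans (herglotz_den th z1).
by rewrite subr_gt0.
Qed.

Lemma Re_herglotz th z : normc z < 1 ->
  complex.Re (herglotz th z) = (1 - normc z ^+ 2) / normc (expi th - z) ^+ 2.
Proof.
move=> z1; have dn := herglotz_den_neq0 th z1; set w := expi th - z in dn *.
have nw : normc w != 0 by rewrite normc_eq0.
have -> : herglotz th z = (expi th + z) * conjc w / (normc w ^+ 2)%:C%C.
  have wE : w * conjc w = (normc w ^+ 2)%:C%C.
    rewrite normc_sqr; case: (w) => x y; apply/eqP; rewrite eq_complex /=.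
    by apply/andP; split; apply/eqP; ring.
  rewrite -wE /herglotz -/w; field; rewrite dn /=.
  by rewrite andbT -normc_eq0 normc_conj.
have -> : forall (x : R[i]) (r : R), complex.Re (x / r%:C%C) = complex.Re x / r.
  move=> x r; have [->|r0] := eqVneq r 0; first by rewrite !invr0 !mulr0.
  apply: (mulIf r0); rewrite divfK //.
  have -> : complex.Re (x / r%:C%C) * r = complex.Re (x / r%:C%C * r%:C%C).
    by case: (x / _) => p q /=; ring.
  by rewrite divfK // -normc_eq0 normc_real normr_eq0.
congr (_ / _); rewrite normc_sqr /w; have := cos2Dsin2 th.
move=> cs; rewrite -cs; case: (z) => x y /=; ring.
Qed.

Lemma Re_herglotz_ge0 th z : normc z < 1 -> 0 <= complex.Re (herglotz th z).
Proof.
move=> z1; rewrite Re_herglotz // divr_ge0 ?sqr_ge0 // subr_ge0 sqr_le1 ?normc_ge0 //.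
exact: ltW.
Qed.

Lemma normc2 : normc (2 : R[i]) = 2.
Proof.
by rewrite -[2 : R[i]](rmorph_nat (real_complex R)) normc_real ger0_norm.
Qed.

Lemma herglotz_inv_den th z : normc z < 1 ->
  (normc (expi th - z))^-1 <= (1 - normc z)^-1.
Proof.
move=> z1; have h := herglotz_den th z1.
by rewrite lef_pV2 ?posrE ?subr_gt0 // (lt_le_trans _ h) // subr_gt0.
Qed.

Lemma herglotz_lip s t z : normc z < 1 ->
  normc (herglotz s z - herglotz t z) <= 2 / (1 - normc z) ^+ 2 * `|s - t|.
Proof.
move=> z1; have ds := herglotz_den_neq0 s z1; have dt := herglotz_den_neq0 t z1.
have -> : herglotz s z - herglotz t z = 2 * z * (expi t - expi s) /
    ((expi s - z) * (expi t - z)) by rewrite /herglotz; field; rewrite ds dt.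
have r0 : 0 < 1 - normc z by rewrite subr_gt0.
have e1 : normc (expi t - expi s) <= `|s - t| by rewrite normc_sub normc_expiB_le.
rewrite normcf_div (normcM (2 * z)) (normcM 2) (normcM (expi s - z)) normc2 invfM.
have hs := herglotz_inv_den s z1; have ht := herglotz_inv_den t z1.
have z0 := normc_ge0 z; have e0 := normc_ge0 (expi t - expi s).
have -> : 2 / (1 - normc z) ^+ 2 * `|s - t| =
    2 * `|s - t| * ((1 - normc z)^-1 * (1 - normc z)^-1).
  by rewrite expr2 invfM; ring.
apply: ler_pM.
- by rewrite !mulr_ge0.
- by rewrite mulr_ge0 // invr_ge0 normc_ge0.
- have : 0 <= `|s - t| by exact: normr_ge0.
  have := ltW z1; nra.
- by apply: ler_pM; rewrite ?invr_ge0 ?normc_ge0.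
Qed.

Lemma herglotz_quad th z w : normc z < 1 -> normc (w - z) < (1 - normc z) / 2 ->
  normc (herglotz th w - herglotz th z - 2 * expi th / (expi th - z) ^+ 2 * (w - z)) <=
    quad_cst z * normc (w - z) ^+ 2.
Proof.
move=> z1 wz; have r0 : 0 < 1 - normc z by rewrite subr_gt0.
have w1 : normc w <= (1 + normc z) / 2 by have := normc_lower w z; lra.
have w2 : normc w < 1 by lra.
have dz := herglotz_den_neq0 th z1; have dw := herglotz_den_neq0 th w2.
have -> : herglotz th w - herglotz th z - 2 * expi th / (expi th - z) ^+ 2 * (w - z) =
    2 * expi th * (w - z) ^+ 2 / ((expi th - w) * (expi th - z) ^+ 2).
  by rewrite /herglotz; field; rewrite dz dw.
rewrite normcf_div (normcM (2 * expi th)) (normcM 2) (normcM (expi th - w)) normc_expi normc2.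
rewrite !(normcX _ 2) mulr1 invfM -exprVn.
set x := normc (w - z) ^+ 2; have x0 : 0 <= x by exact: sqr_ge0.
have iz := herglotz_inv_den th z1; have iw := herglotz_inv_den th w2.
have iw' : (normc (expi th - w))^-1 <= 2 * (1 - normc z)^-1.
  apply: (le_trans iw); have -> : 2 * (1 - normc z)^-1 = ((1 - normc z) / 2)^-1.
    by rewrite invfM invrK mulrC.
  by rewrite lef_pV2 ?posrE ?divr_gt0 ?subr_gt0 //; lra.
have -> : quad_cst z * x = 2 * x * (2 * (1 - normc z)^-1 * (1 - normc z)^-1 ^+ 2).
  by rewrite /quad_cst -exprVn; ring.
have y0 : 0 <= (normc (expi th - z))^-1 by rewrite invr_ge0 normc_ge0.
have p0 : 0 <= (1 - normc z)^-1 by rewrite invr_ge0 ltW.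
apply: ler_wpM2l; first by rewrite mulr_ge0.
apply: ler_pM; rewrite ?invr_ge0 ?normc_ge0 ?sqr_ge0 //.
by rewrite lerXn2r ?nnegrE.
Qed.

End Limits.

(** * Dyadic mass distributions *)

Section MassTree.
Variables (R : realType) (p : nat -> nat) (s : nat).
Hypothesis p0 : p 0%N = 0%N.
Hypothesis pS : forall j, (p j <= p j.+1 <= (p j).+1)%N.

(** The intervals of length 2^-(s+j) that carry mass: all of them at the start; a
    step of p erases every second child, so that the surviving mass per interval
    does not shrink, and otherwise both children survive. *)
Fixpoint alive (j k : nat) : bool :=
  if j is j'.+1 then ((p j == p j') || ~~ odd k) && alive j' k./2 else true.

(** Normalized so that the total mass of each level is 1, see mass_total. *)
Definition mass (j k : nat) : R := (alive j k)%:R * (2 ^+ p j / 2 ^+ (s + j)).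

Lemma mass_ge0 j k : 0 <= mass j k.
Proof. by rewrite /mass mulr_ge0 // divr_ge0 // exprn_ge0. Qed.

Lemma alive0 j : alive j 0.
Proof. by elim: j => //= j ->; rewrite orbT. Qed.

Lemma mass_children j k : mass j.+1 k.*2 + mass j.+1 k.*2.+1 = mass j k.
Proof.
rewrite /mass /= odd_double /= uphalf_double doubleK orbT /=.
have q0 : 2 ^+ (s + j) != 0 :> R by rewrite expf_neq0.
have [->|pj] := eqVneq (p j.+1) (p j); rewrite /= ?mul0r ?addr0 addnS exprS.
  by field.
have -> : p j.+1 = (p j).+1.
  by have := pS j; rewrite leq_eqVlt eq_sym (negbTE pj) /= => h; apply/eqP; rewrite eqn_leq andbC.
by rewrite exprS; field.
Qed.

Lemma sum_pairs (V : zmodType) (F : nat -> V) N :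
  \sum_(k < N.*2) F k = \sum_(k < N) (F k.*2 + F k.*2.+1).
Proof.
elim: N => [|N IH]; first by rewrite !big_ord0.
by rewrite doubleS !big_ord_recr /= IH addrA.
Qed.

Lemma pow2S n : (2 ^ n.+1 = (2 ^ n).*2)%N.
Proof. by rewrite expnS mul2n. Qed.

(** Conservation of mass along the tree, tested on functions of the ancestor at
    level j. *)
Lemma mass_descend (F : nat -> R) j i :
  \sum_(k < 2 ^ (s + (j + i))) mass (j + i) k * F (k %/ 2 ^ i)%N =
  \sum_(k < 2 ^ (s + j)) mass j k * F k.
Proof.
elim: i => [|i IH].
  by rewrite addn0; apply: eq_bigr => k _; rewrite expn0 divn1.
rewrite -IH !addnS pow2S.
rewrite (sum_pairs (fun k => mass (j + i).+1 k * F (k %/ 2 ^ i.+1)%N)).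
apply: eq_bigr => k _; rewrite -(mass_children (j + i) k) mulrDl expnS !divnMA.
by rewrite !divn2 doubleK /= uphalf_double.
Qed.

Lemma mass_total j : \sum_(k < 2 ^ (s + j)) mass j k = 1.
Proof.
have := mass_descend (fun=> 1) 0 j; rewrite add0n.
under eq_bigr do rewrite mulr1.
move=> ->; rewrite addn0 /mass /= p0 expr0 addn0.
rewrite sumr_const card_ord -[LHS]mulr_natl natrX !mul1r mulr1 mulfV // expf_neq0.
Qed.

Lemma alive_count j : \sum_(k < 2 ^ (s + j)) (alive j k)%:R = 2 ^+ (s + j) / 2 ^+ p j :> R.
Proof.
have q0 : 2 ^+ (s + j) != 0 :> R by rewrite expf_neq0.
have r0 : 2 ^+ p j != 0 :> R by rewrite expf_neq0.
have := mass_total j; rewrite /mass -mulr_suml => h.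
by apply: (mulIf (mulf_neq0 r0 (invr_neq0 q0))); rewrite h mulf_div (mulrC (2 ^+ (s + j))) divff // mulf_neq0.
Qed.

(** The Herglotz integral of the level-n mass distribution. *)
Definition herglotz_sum (n : nat) (z : R[i]) : R[i] :=
  \sum_(k < 2 ^ (s + n)) (mass n k)%:C%C * herglotz (k%:R / 2 ^+ (s + n)) z.

Lemma normc_sum (I : Type) (r : seq I) (F : I -> R[i]) :
  normc (\sum_(i <- r) F i) <= \sum_(i <- r) normc (F i).
Proof.
elim: r => [|i r IH]; first by rewrite !big_nil normc0.
by rewrite !big_cons; apply: le_trans (normcD _ _) _; rewrite lerD2l.
Qed.

Lemma Re_sum (I : Type) (r : seq I) (F : I -> R[i]) :
  complex.Re (\sum_(i <- r) F i) = \sum_(i <- r) complex.Re (F i).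
Proof. exact: raddf_sum. Qed.

Lemma Re_scale (x : R) (z : R[i]) : complex.Re (x%:C%C * z) = x * complex.Re z.
Proof. by case: z => u v /=; rewrite mul0r subr0. Qed.

Lemma mass_average n (F : nat -> R[i]) (M : R) : (forall k, normc (F k) <= M) ->
  normc (\sum_(k < 2 ^ (s + n)) (mass n k)%:C%C * F k) <= M.
Proof.
move=> FM; apply: le_trans (normc_sum _ _) _.
have -> : M = \sum_(k < 2 ^ (s + n)) mass n k * M.
  by rewrite -mulr_suml mass_total mul1r.
apply: ler_sum => k _.
by rewrite normcM normc_real ger0_norm ?mass_ge0 // ler_wpM2l // mass_ge0.
Qed.

(** Halving the intervals moves mass only from an interval to its odd half, by the
    distance 2^-(s+n+1), and the kernel is Lipschitz in the boundary point. *)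
Lemma herglotz_sum_step n z : normc z < 1 ->
  normc (herglotz_sum n.+1 z - herglotz_sum n z) <=
    2 / (1 - normc z) ^+ 2 * (2 ^+ n.+1)^-1.
Proof.
move=> z1; rewrite /herglotz_sum addnS pow2S.
rewrite (sum_pairs (fun k => (mass n.+1 k)%:C%C * herglotz (k%:R / 2 ^+ (s + n).+1) z)).
rewrite -sumrB.
have q0 : 2 ^+ (s + n) != 0 :> R by rewrite expf_neq0.
have M0 : 0 <= 2 / (1 - normc z) ^+ 2 by rewrite divr_ge0 // sqr_ge0.
apply: le_trans (normc_sum _ _) _.
set c := 2 / _ * _; have -> : c = \sum_(k < 2 ^ (s + n)) mass n k * c.
  by rewrite -mulr_suml mass_total mul1r.
apply: ler_sum => k _; rewrite -(mass_children n k) rmorphD /=.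
have -> : k.*2%:R / 2 ^+ (s + n).+1 = k%:R / 2 ^+ (s + n) :> R.
  by rewrite -muln2 natrM exprS; field.
set x := (mass _ k.*2)%:C%C; set y := (mass _ k.*2.+1)%:C%C.
set h := herglotz _ z; set h' := herglotz _ z.
rewrite (_ : _ - _ = y * (h' - h)); last by ring.
rewrite normcM normc_real ger0_norm ?mass_ge0 //.
apply: ler_pM; rewrite ?mass_ge0 ?normc_ge0 //; first by rewrite lerDr mass_ge0.
apply: le_trans (herglotz_lip _ _ z1) _; apply: ler_wpM2l => //.
have -> : k.*2.+1%:R / 2 ^+ (s + n).+1 - k%:R / 2 ^+ (s + n) = (2 ^+ (s + n).+1)^-1 :> R.
  by rewrite -addn1 natrD -muln2 natrM exprS; field.
rewrite ger0_norm ?invr_ge0 ?exprn_ge0 // lef_pV2 ?posrE ?pow2_gt0 //.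
by rewrite ler_eXn2l ?ltr1n // ltnS leq_addl.
Qed.

Definition dyadic_point (j : nat) (t : R) : R[i] := (1 - (2 ^+ j)^-1)%:C%C * expi t.

Lemma inv_pow2_gt0 j : 0 < (2 ^+ j)^-1 :> R.
Proof. by rewrite invr_gt0 pow2_gt0. Qed.

Lemma normc_dyadic_point j t : normc (dyadic_point j t) = 1 - (2 ^+ j)^-1.
Proof.
rewrite normcM normc_real normc_expi mulr1 ger0_norm //.
by have /andP[] := dyadic_radius R j.
Qed.

Lemma dyadic_point_disk j t : normc (dyadic_point j t) < 1.
Proof. by rewrite normc_dyadic_point; have /andP[] := dyadic_radius R j. Qed.

Lemma dyadic_point_near j c t :
  normc (expi c - dyadic_point j t) <= `|c - t| + (2 ^+ j)^-1.
Proof.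
apply: le_trans (normc_tri _ (expi t) _) _; apply: lerD; first exact: normc_expiB_le.
have -> : expi t - dyadic_point j t = ((2 ^+ j)^-1)%:C%C * expi t.
  by rewrite /dyadic_point rmorphB rmorph1; ring.
by rewrite normcM normc_real normc_expi mulr1 ger0_norm // ltW // inv_pow2_gt0.
Qed.

(** Over an arc of length comparable to the distance 2^-j to the circle the Poisson
    kernel is at least a multiple of 2^j. *)
Lemma Re_herglotz_near j c t : `|c - t| <= (2 ^+ j)^-1 ->
  2 ^+ j / 4 <= complex.Re (herglotz c (dyadic_point j t)).
Proof.
move=> ct; have z1 := dyadic_point_disk j t; rewrite Re_herglotz //.
have := herglotz_den_neq0 c z1; rewrite -normc_gt0 => d0.
have := dyadic_point_near j c t; set d := normc _ in d0 * => dn.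
rewrite normc_dyadic_point ler_pdivlMr ?exprn_gt0 //.
have := inv_pow2_gt0 j; have /andP[] := dyadic_radius R j.
have : 2 ^+ j * (2 ^+ j)^-1 = 1 :> R by rewrite mulfV // expf_neq0.
have := pow2_gt0 R j.
move: ct dn; set x := 2 ^+ j; set y := x^-1 => ct dn x0 xy y1 y2 y0.
have : d ^+ 2 <= (2 * y) ^+ 2 by rewrite lerXn2r ?nnegrE ?mulr_ge0 //; lra.
have : x * (4 * y ^+ 2) = 4 * y by rewrite expr2 -[in RHS](mul1r y) -xy; ring.
nra.
Qed.

Lemma dyadic_points_gap (j j' : nat) (c t t' : R) : (0 < j)%N -> (j <= j')%N ->
  0 < c -> c <= 1 / 2 -> `|t - t'| <= 1 ->
  (j = j' -> 4 * c * (2 ^+ j)^-1 <= `|t - t'|) ->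
  c * (2 ^+ j)^-1 <= normc (dyadic_point j t - dyadic_point j' t').
Proof.
move=> j0 jj c0 c12 tt gap; have yj := inv_pow2_gt0 j.
have [E|ne] := eqVneq j j'.
  have := gap E; rewrite -E => h.
  have -> : dyadic_point j t - dyadic_point j t' =
      (1 - (2 ^+ j)^-1)%:C%C * (expi t - expi t') by rewrite /dyadic_point; ring.
  rewrite normcM normc_real ger0_norm; last by have /andP[] := dyadic_radius R j.
  have y1 : (2 ^+ j)^-1 <= 2^-1 :> R.
    by rewrite lef_pV2 ?posrE ?pow2_gt0 // -[leLHS]expr1 ler_eXn2l // ltr1n.
  have e0 := normc_ge0 (expi t - expi t').
  apply: le_trans (_ : 1 / 2 * normc (expi t - expi t') <= _).
    have := normc_expiB_ge tt; lra.
  by apply: ler_wpM2r => //; lra.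
have jl : (j < j')%N by rewrite ltn_neqAle ne.
apply: le_trans (normc_dist _ _); rewrite !normc_dyadic_point.
have : (2 ^+ j')^-1 <= (2 ^+ j.+1)^-1 :> R.
  by rewrite lef_pV2 ?posrE ?pow2_gt0 // ler_eXn2l // ltr1n.
rewrite exprS invfM => h.
have := ler_wpM2r (ltW yj) c12; have := inv_pow2_gt0 j'.
by rewrite distrC ger0_norm; lra.
Qed.

(** Because |1 - conj z w| = |(1 - |z|^2) + conj z (z - w)| is at most
    2 d + |z - w|. *)
Lemma pseudo_hyperbolic_gap (z w : R[i]) (c d : R) : 0 < c -> c <= 1 -> 0 < d ->
  normc z < 1 -> normc w <= 1 -> 1 - normc z <= d -> c * d <= normc (z - w) ->
  c / 3 <= normc ((z - w) / (1 - conjc z * w)).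
Proof.
move=> c0 c1 d0 z1 w1 zd zw.
have n0 : 0 < normc (z - w) by apply: lt_le_trans zw; exact: mulr_gt0.
have : normc (1 - conjc z * w) <= 2 * d + normc (z - w).
  have -> : 1 - conjc z * w = (1 - normc z ^+ 2)%:C%C + conjc z * (z - w).
    rewrite normc_sqr; case: (z) (w) => x y [u v]; apply/eqP; rewrite eq_complex /=.
    by apply/andP; split; apply/eqP; ring.
  apply: le_trans (normcD _ _) _; rewrite normcM normc_conj normc_real.
  have := normc_ge0 z; rewrite ger0_norm; last by rewrite subr_ge0 sqr_le1 ?normc_ge0 // ltW.
  nra.
have x0 : 0 < normc (1 - conjc z * w) by rewrite normc_gt0 bl_den_neq0.
rewrite normcf_div ler_pdivlMr //; nra.
Qed.

(** The level-n mass distributions refine each other, so their Herglotz integrals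
    converge.  The mass 2^(p j) / 2^(s+j) of a surviving interval stays on it, and
    this is felt by the real part at the points above the interval. *)
Lemma herglotz_limit : exists H : R[i] -> R[i], [/\ forall z, normc z < 1 -> cdiff H z,
  forall z, normc z < 1 -> 0 <= complex.Re (H z) &
  forall j k t, (k < 2 ^ (s + j))%N -> alive j k ->
    k%:R / 2 ^+ (s + j) <= t < k.+1%:R / 2 ^+ (s + j) ->
    2 ^+ p j / (4 * 2 ^+ s) <= complex.Re (H (dyadic_point j t))].
Proof.
have [H HP] : exists H : R[i] -> R[i], forall z, normc z < 1 -> clim (herglotz_sum^~ z) (H z).
  suff /choice[H ?] : forall z, exists l, normc z < 1 -> clim (herglotz_sum^~ z) l by exists H.
  move=> z; have [z1|_] := boolP (normc z < 1); last by exists 0.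
  set c := 2 / (1 - normc z) ^+ 2.
  have c0 : 0 <= c by rewrite divr_ge0 // sqr_ge0.
  have [] := @clim_increments R (herglotz_sum^~ z) (fun n => - (c * (2 ^+ n)^-1)) 0.
  - by move=> n; rewrite oppr_le0 mulr_ge0 // ltW // inv_pow2_gt0.
  - move=> n; apply: le_trans (herglotz_sum_step n z1) _.
    by rewrite -/c exprS invfM; have := mulr_ge0 c0 (ltW (inv_pow2_gt0 n)); lra.
  by move=> l lP; exists l.
have Rs n z : complex.Re (herglotz_sum n z) =
    \sum_(k < 2 ^ (s + n)) mass n k * complex.Re (herglotz (k%:R / 2 ^+ (s + n)) z).
  by rewrite Re_sum; apply: eq_bigr => k _; rewrite Re_scale.
exists H; split.
- move=> z z1; have r0 : 0 < (1 - normc z) / 2 by rewrite divr_gt0 // subr_gt0.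
  apply: (@limit_cdiff _ herglotz_sum (fun n => \sum_(k < 2 ^ (s + n)) (mass n k)%:C%C *
    (2 * expi (k%:R / 2 ^+ (s + n)) / (expi (k%:R / 2 ^+ (s + n)) - z) ^+ 2)) H z _ _ r0
    (quad_cst_ge0 z1)).
    move=> n w wz; rewrite mulr_suml /herglotz_sum -!sumrB.
    under eq_bigr do rewrite -mulrBr -mulrA -mulrBr.
    apply: (@mass_average n (fun k => herglotz (k%:R / 2 ^+ (s + n)) w -
      herglotz (k%:R / 2 ^+ (s + n)) z - 2 * expi (k%:R / 2 ^+ (s + n)) /
      (expi (k%:R / 2 ^+ (s + n)) - z) ^+ 2 * (w - z))) => k.
    exact: herglotz_quad.
  move=> w wz; apply: HP; have := normc_lower w z; lra.
- move=> z z1; apply: (clim_Re_ge (HP z z1)); exists 0%N => n _.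
  by rewrite Rs sumr_ge0 // => k _; rewrite mulr_ge0 ?mass_ge0 // Re_herglotz_ge0.
- move=> j k t kj ak /andP[t1 t2]; have z1 := dyadic_point_disk j t.
  apply: (clim_Re_ge (HP _ z1)); exists j => n jn.
  rewrite -(subnKC jn); set i := (n - j)%N.
  have -> : 2 ^+ p j / (4 * 2 ^+ s) =
      \sum_(l < 2 ^ (s + j)) mass j l * ((l == k :> nat)%:R * (2 ^+ j / 4)) :> R.
    rewrite (bigD1 (Ordinal kj)) //= eqxx big1 => [|l lk]; last first.
      rewrite (_ : (l == k :> nat) = false) ?mul0r ?mulr0 //.
      by apply: contraNF lk => /eqP lk; apply/eqP/val_inj.
    rewrite addr0 mul1r /mass ak mul1r exprD; field.
    by rewrite !expf_neq0.
  rewrite -(mass_descend (fun l => (l == k)%:R * (2 ^+ j / 4)) j i) Rs; apply: ler_sum => l _.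
  apply: ler_wpM2l; first exact: mass_ge0.
  have [lk|_] := eqVneq (l %/ 2 ^ i)%N k; last by rewrite mul0r Re_herglotz_ge0.
  rewrite mul1r; apply: Re_herglotz_near.
  have q0 : 0 < 2 ^+ (s + j) :> R by exact: pow2_gt0.
  have i0 : 0 < 2 ^+ i :> R by exact: pow2_gt0.
  have h1 : k%:R <= l%:R / 2 ^+ i :> R.
    by rewrite ler_pdivlMr // -natrX -natrM ler_nat -lk leq_divM.
  have h2 : l%:R / 2 ^+ i < k.+1%:R :> R.
    by rewrite ltr_pdivrMr // -natrX -natrM ltr_nat -lk ltn_ceil // expn_gt0.
  have -> : l%:R / 2 ^+ (s + (j + i)) = l%:R / 2 ^+ i / 2 ^+ (s + j) :> R.
    have -> : 2 ^+ (s + (j + i)) = 2 ^+ (s + j) * 2 ^+ i :> R by rewrite addnA exprD.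
    by rewrite invfM; ring.
  have w1 : k%:R / 2 ^+ (s + j) <= l%:R / 2 ^+ i / 2 ^+ (s + j) :> R.
    by rewrite ler_pM2r // invr_gt0.
  have w2 : l%:R / 2 ^+ i / 2 ^+ (s + j) < k.+1%:R / 2 ^+ (s + j) :> R.
    by rewrite ltr_pM2r // invr_gt0.
  have w3 : k.+1%:R / 2 ^+ (s + j) = k%:R / 2 ^+ (s + j) + (2 ^+ (s + j))^-1 :> R.
    by rewrite -addn1 natrD mulrDl mul1r.
  have w4 : (2 ^+ (s + j))^-1 <= (2 ^+ j)^-1 :> R.
    by rewrite lef_pV2 ?posrE ?pow2_gt0 // ler_eXn2l ?ltr1n // leq_addl.
  by rewrite ler_norml; apply/andP; split; lra.
Qed.

End MassTree.

(** * Separated points above a mass distribution *)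

Section TreePoints.
Variables (R : realType) (p : nat -> nat) (s L : nat).
Hypothesis L0 : (0 < L)%N.
Implicit Types (j k i : nat) (x y : nat * nat * nat).

(** L equally spaced angles in the k-th interval of length 2^-(s+j). *)
Definition tree_angle j k i : R := (k * L + i)%:R / (L%:R * 2 ^+ (s + j)).

Definition tree_index : set (nat * nat * nat) :=
  [set x | [/\ (0 < x.1.1)%N, (x.1.2 < 2 ^ (s + x.1.1))%N, alive p x.1.1 x.1.2 & (x.2 < L)%N]].

Definition tree_point x : R[i] := dyadic_point x.1.1 (tree_angle x.1.1 x.1.2 x.2).

Lemma LR0 : 0 < L%:R :> R. Proof. by rewrite ltr0n. Qed.

Lemma tree_angle_itv j k i : (i < L)%N ->
  k%:R / 2 ^+ (s + j) <= tree_angle j k i < k.+1%:R / 2 ^+ (s + j).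
Proof.
move=> iL; have l0 := LR0; have q0 := pow2_gt0 R (s + j).
have E n : n%:R / 2 ^+ (s + j) = (n * L)%:R / (L%:R * 2 ^+ (s + j)) :> R.
  by rewrite natrM; field; rewrite !gt_eqF ?pow2_gt0.
have r0 : 0 < (L%:R * 2 ^+ (s + j))^-1 :> R by rewrite invr_gt0 mulr_gt0.
rewrite !E /tree_angle ler_pM2r // ltr_pM2r // ler_nat ltr_nat leq_addr /=.
by rewrite mulSn addnC ltn_add2r.
Qed.

Lemma tree_angle_unit j k i : (i < L)%N -> (k < 2 ^ (s + j))%N ->
  0 <= tree_angle j k i < 1.
Proof.
move=> iL kj; have /andP[h1 h2] := tree_angle_itv j k iL.
apply/andP; split; first by apply: le_trans h1; rewrite divr_ge0 // exprn_ge0.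
apply: (lt_le_trans h2); rewrite ler_pdivrMr ?pow2_gt0 // mul1r -natrX ler_nat.
exact: kj.
Qed.

Lemma tree_angle_gap j k i k' i' : (i < L)%N -> (i' < L)%N -> (k, i) != (k', i') ->
  (L%:R * 2 ^+ (s + j))^-1 <= `|tree_angle j k i - tree_angle j k' i'|.
Proof.
move=> iL iL' ne; have r0 : 0 < (L%:R * 2 ^+ (s + j))^-1 :> R.
  by rewrite invr_gt0 mulr_gt0 ?LR0 ?pow2_gt0.
rewrite /tree_angle -mulrBl normrM (gtr0_norm r0) ler_peMl ?(ltW r0) //.
have : (k * L + i)%N != (k' * L + i')%N.
  apply: contra ne => /eqP E; apply/eqP; congr pair.
    by have := congr1 (divn^~ L) E; rewrite !divnMDl // !divn_small // !addn0.
  by have := congr1 (modn^~ L) E; rewrite !modnMDl !modn_small.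
rewrite neq_ltn => /orP[] h.
  by rewrite distrC -natrB ?(ltnW h) // ger0_norm ?ler0n // ler1n subn_gt0.
by rewrite -natrB ?(ltnW h) // ger0_norm ?ler0n // ler1n subn_gt0.
Qed.

(** The Euclidean gap between points of the family, relative to the distance to the
    circle. *)
Definition tree_gap : R := (4 * (L%:R * 2 ^+ s))^-1.

Lemma tree_gap_gt0 : 0 < tree_gap.
Proof. by rewrite invr_gt0 !mulr_gt0 ?LR0 ?pow2_gt0. Qed.

Lemma tree_gap_le : tree_gap <= 1 / 2.
Proof.
rewrite div1r lef_pV2 ?posrE ?mulr_gt0 ?LR0 ?pow2_gt0 //.
have : 1 <= L%:R :> R by rewrite ler1n.
have : 1 <= 2 ^+ s :> R by rewrite exprn_ege1 // ?ler1n.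
by move=> h1 h2; have := ler_pM ler01 ler01 h1 h2; rewrite mulr1; lra.
Qed.

Lemma tree_point_dist x y : tree_index x -> tree_index y -> x != y ->
  (x.1.1 <= y.1.1)%N ->
  tree_gap * (2 ^+ x.1.1)^-1 <= normc (tree_point x - tree_point y).
Proof.
case: x => [[j k] i]; case: y => [[j' k'] i'] [/= j0 kj ak iL] [/= j0' kj' ak' iL'] /= ne jj.
apply: dyadic_points_gap => //; first exact: tree_gap_gt0; first exact: tree_gap_le.
  have := tree_angle_unit iL kj; have := tree_angle_unit iL' kj'.
  by move=> /andP[? ?] /andP[? ?]; rewrite ler_norml; apply/andP; split; lra.
move=> /= E; move: ne; rewrite -E => ne.
apply: le_trans (tree_angle_gap j iL iL' _); last first.
  by apply: contra ne => /eqP[-> ->].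
rewrite /tree_gap exprD le_eqVlt; apply/orP; left; apply/eqP.
by field; rewrite !gt_eqF ?LR0 ?pow2_gt0.
Qed.

Lemma tree_points_separated x y : tree_index x -> tree_index y -> x != y ->
  tree_gap / 3 <= normc ((tree_point x - tree_point y) /
                         (1 - conjc (tree_point x) * tree_point y)).
Proof.
have half z w : tree_index z -> tree_index w -> z != w -> (z.1.1 <= w.1.1)%N ->
    tree_gap / 3 <= normc ((tree_point z - tree_point w) /
                           (1 - conjc (tree_point z) * tree_point w)).
  move=> zI wI zw jj; have gl := tree_gap_le.
  apply: (pseudo_hyperbolic_gap tree_gap_gt0 _ (inv_pow2_gt0 R z.1.1)); first by lra.
  - exact: dyadic_point_disk.
  - exact/ltW/dyadic_point_disk.
  - by rewrite normc_dyadic_point; lra.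
  - exact: tree_point_dist.
move=> xI yI xy; have [/half|/ltnW jj] := leqP x.1.1 y.1.1; first exact.
have := half y x yI xI; rewrite eq_sym xy jj => /(_ isT isT).
rewrite !normcf_div (normc_sub (tree_point y)).
rewrite -(normc_conj (1 - conjc (tree_point y) * tree_point x)).
rewrite (_ : conjc (1 - _) = 1 - conjc (tree_point x) * tree_point y) //.
case: (tree_point x) (tree_point y) => t u [q r]; apply/eqP; rewrite eq_complex /=.
by apply/andP; split; apply/eqP; ring.
Qed.

Lemma tree_enumeration : exists a : nat -> nat * nat * nat, set_bij setT tree_index a.
Proof.
apply/card_set_bijP; rewrite card_eq_sym; apply: eq_card_nat.
  exact: countableP.
have finj : {in (fun j => (j.+1, 0, 0)%N) @^-1` tree_index &,
    injective (fun j => (j.+1, 0, 0)%N : nat * nat * nat)} by move=> j j' _ _ [].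
move=> /(finite_preimage finj); rewrite (_ : _ @^-1` _ = setT); first exact: infinite_nat.
by apply/seteqP; split=> // j _; split; rewrite //= ?expn_gt0 ?alive0 ?orbT.
Qed.

End TreePoints.

(** * Measure of the surviving set *)

Section Construction.
Variables (R : realType) (alpha : R) (p : nat -> nat) (s L : nat).
Notation mu := (@lebesgue_measure R).
Hypothesis L0 : (0 < L)%N.
Hypothesis s_alpha : (2 ^+ s)^-1 < alpha.
Hypothesis p0 : p 0%N = 0%N.
Hypothesis pS : forall j, (p j <= p j.+1 <= (p j).+1)%N.

Definition tree_cell (j k : nat) : set R :=
  [set t | k%:R / 2 ^+ (s + j) <= t < k.+1%:R / 2 ^+ (s + j)].

Lemma tree_cell_parent j k : tree_cell j.+1 k `<=` tree_cell j k./2.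
Proof.
have q0 := pow2_gt0 R (s + j).
have E n : n%:R / 2 ^+ (s + j) = n.*2%:R / 2 ^+ (s + j.+1) :> R.
  by rewrite addnS exprS -muln2 natrM; field; rewrite gt_eqF.
have r0 : 0 < (2 ^+ (s + j.+1))^-1 :> R by exact: inv_pow2_gt0.
have h := odd_double_half k; have o1 : (odd k <= 1)%N by case: odd.
move=> t; rewrite /tree_cell /= !E => /andP[t1 t2]; apply/andP; split.
  by apply: le_trans t1; rewrite ler_pM2r // ler_nat -{2}h leq_addl.
apply: (lt_le_trans t2); rewrite ler_pM2r // ler_nat doubleS -{1}h.
by rewrite -addn1 -addn2; lia.
Qed.

Lemma tree_point_stolz j k i t : (i < L)%N -> tree_cell j k t ->
  stolz alpha t (tree_point R s L (j, k, i)).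
Proof.
move=> iL /andP[t1 t2]; have z1 : normc (tree_point R s L (j, k, i)) < 1.
  exact: dyadic_point_disk.
apply/stolzP => //; apply: le_lt_trans (dyadic_point_near _ _ _) _.
rewrite normc_dyadic_point /=; have /andP[c1 c2] := tree_angle_itv R s L0 j k iL.
have y0 := inv_pow2_gt0 R j.
have w : k.+1%:R / 2 ^+ (s + j) = k%:R / 2 ^+ (s + j) + (2 ^+ s)^-1 * (2 ^+ j)^-1 :> R.
  by rewrite -invfM -exprD -addn1 natrD mulrDl mul1r.
have sa : (2 ^+ s)^-1 * (2 ^+ j)^-1 < alpha * (2 ^+ j)^-1 by rewrite ltr_pM2r.
have : `|t - tree_angle R s L j k i| <= (2 ^+ s)^-1 * (2 ^+ j)^-1.
  by rewrite ler_norml; apply/andP; split; lra.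
lra.
Qed.

(** The ancestors of a surviving interval survive, and each of the j levels above
    the circle contributes L points to the Stolz angles on it. *)
Lemma tree_stolz_list j k t : (k < 2 ^ (s + j))%N -> alive p j k -> tree_cell j k t ->
  exists u : seq R[i], [/\ uniq u, size u = (L * j)%N & forall z, z \in u ->
    [/\ exists2 x, tree_index p s L x & z = tree_point R s L x, stolz alpha t z &
        normc z <= 1 - (2 ^+ j)^-1]].
Proof.
elim: j k => [|j IH] k kj ak tk; first by exists [::]; rewrite muln0.
have ak' : alive p j k./2 by case/andP: ak.
have kj' : (k./2 < 2 ^ (s + j))%N.
  by rewrite addnS pow2S in kj; have := odd_double_half k; lia.
have [u [uu us uP]] := IH _ kj' ak' (tree_cell_parent tk).
pose F i := tree_point R s L (j.+1, k, i).
have y : (2 ^+ j.+1)^-1 < (2 ^+ j)^-1 :> R.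
  by rewrite ltf_pV2 ?posrE ?pow2_gt0 // ltr_eXn2l // ltr1n.
have idx i : (i < L)%N -> tree_index p s L (j.+1, k, i) by [].
exists (u ++ [seq F i | i <- iota 0 L]); split.
- rewrite cat_uniq uu /=; apply/andP; split.
    apply/hasPn => _ /mapP[i _ ->]; apply/negP => /uP[_ _].
    by rewrite normc_dyadic_point /=; lra.
  rewrite map_inj_in_uniq ?iota_uniq // => i i'; rewrite !mem_iota /= !add0n => iL iL' FE.
  apply/eqP; apply: contraT => ne.
  have ne' : (j.+1, k, i) != (j.+1, k, i') by apply: contra ne => /eqP[->].
  have := tree_points_separated R L0 (idx _ iL) (idx _ iL') ne'.
  rewrite -/(F i) -/(F i') FE subrr mul0r normc0.
  by have := tree_gap_gt0 R s L0; lra.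
- by rewrite size_cat us size_map size_iota mulnS addnC.
- move=> z; rewrite mem_cat => /orP[zu|].
    by have [h1 h2 h3] := uP z zu; split=> //; lra.
  move=> zm; have [i iL ->] : exists2 i, i \in iota 0 L & z = F i by exact/mapP.
  rewrite mem_iota /= add0n in iL; split; first by exists (j.+1, k, i); [exact: idx|].
    exact: tree_point_stolz.
  by rewrite normc_dyadic_point.
Qed.

(** Distinct cells of one level are disjoint. *)
Lemma cells_measure j (P : pred nat) N :
  let U := [set t : R | exists2 k, (k < N)%N && P k & tree_cell j k t] in
  measurable U /\ mu U = ((\sum_(k < N) (P k)%:R) / 2 ^+ (s + j))%:E.
Proof.
have q0 := pow2_gt0 R (s + j).
have cE k : tree_cell j k = `[k%:R / 2 ^+ (s + j), k.+1%:R / 2 ^+ (s + j)[%classic.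
  by apply/seteqP; split=> t; rewrite /tree_cell /= in_itv.
elim: N => [|N [mU muU]] U.
  have -> : U = set0 by apply/seteqP; split=> // t [].
  by rewrite big_ord0 mul0r measure0.
move: mU muU; set V := [set _ | _] => mV muV.
rewrite big_ord_recr /= mulrDl.
have [PN|PN] := boolP (P N); last first.
  have -> : U = V.
    apply/seteqP; split=> t [k /andP[kN Pk] tk]; exists k => //; last by rewrite Pk (leq_trans kN).
    rewrite Pk andbT; move: kN; rewrite ltnS leq_eqVlt => /predU1P[E|//].
    by rewrite -E Pk in PN.
  by rewrite mul0r addr0.
have muC : mu (tree_cell j N) = (1 / 2 ^+ (s + j))%:E.
  rewrite cE lebesgue_measure_itv /= lte_fin.
  rewrite ltr_pM2r ?invr_gt0 // ltr_nat ltnSn -EFinB; congr EFin.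
  by rewrite -addn1 natrD; ring.
have mC : measurable (tree_cell j N) by rewrite cE; exact: measurable_itv.
have -> : U = V `|` tree_cell j N.
  apply/seteqP; split=> t.
    move=> [k /andP[]]; rewrite ltnS leq_eqVlt => /predU1P[->|kN] Pk tk; first by right.
    by left; exists k; rewrite ?kN.
  by move=> [[k /andP[kN Pk] tk]|tN]; [exists k; rewrite // Pk ltnS ltnW|exists N; rewrite // ltnSn].
split; first exact: measurableU.
rewrite (measureU mu mV mC).
  rewrite EFinD; congr (_ + _)%E; first exact: muV.
  exact: muC.
apply/seteqP; split=> // t [[k /andP[kN _] /andP[_ t2]] /andP[t1 _]].
have h : k.+1%:R / 2 ^+ (s + j) <= N%:R / 2 ^+ (s + j) :> R.
  by rewrite ler_pM2r ?invr_gt0 // ler_nat.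
by have := lt_le_trans (le_lt_trans t1 t2) h; rewrite ltxx.
Qed.

Lemma tree_measure (a : nat -> nat * nat * nat) j : set_bij setT (tree_index p s L) a ->
  (((2 ^+ p j)^-1)%:E <= m alpha (tree_point R s L \o a) (L * j))%E.
Proof.
move=> [_ _ asurj].
have [_ muU] := cells_measure j (alive p j) (2 ^ (s + j)).
move: muU; rewrite alive_count // mulrAC divff ?mul1r; last by rewrite expf_neq0.
move=> <-; apply: le_mu_ext => t [k /andP[kj ak] tk]; split.
  have /andP[t1 t2] := tk; have pi0 := pi_ge2 R.
  apply/andP; split; first by apply: le_trans t1; rewrite divr_ge0 // exprn_ge0.
  apply: (lt_le_trans t2); apply: le_trans (_ : 1 <= _); last by lra.
  by rewrite ler_pdivrMr ?pow2_gt0 // mul1r -natrX ler_nat.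
have [u [uu <- uP]] := tree_stolz_list kj ak tk.
apply: list_counting => // z /uP[[x xI ->] st _]; split=> //.
by have [n _ <-] := asurj x xI; exists n.
Qed.

End Construction.

(** * Sequences that do not see the decay *)

(** At the levels where gtilde g j is at most a multiple of 2^(p j), a singular inner
    function with the limit of the mass tree as its measure is small enough; the
    points of the other levels satisfy the Blaschke condition and are made zeros. *)
Lemma invisible_sequence (R : realType) (alpha : R) (g : R -> R) (p : nat -> nat)
    (L : nat) (bad : pred nat) (S K : R) :
  0 < alpha -> minorant_function g -> (0 < L)%N -> 0 <= K ->
  p 0%N = 0%N -> (forall j, (p j <= p j.+1 <= (p j).+1)%N) ->
  (forall N, \sum_(j < N | bad j) (2 ^+ p j)^-1 <= S) ->
  (forall j, ~~ bad j -> gtilde g j%:R <= K * 2 ^+ p j) ->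
  exists a f, [/\ separated_in_disk a, Hinfty f,
    forall k, normc (f (a k)) <= g (normc (a k)), exists2 z, disk z & f z <> 0 &
    forall j, (((2 ^+ p j)^-1)%:E <= m alpha a (L * j))%E].
Proof.
move=> alpha0 hg L0 K0 p0 pS badS good.
have [s s_alpha] := pow2_small alpha0.
have [a abij] := tree_enumeration p s L0; have [aI ainj _] := abij.
have [H [Hd HRe Hbig]] := @herglotz_limit R p s p0 pS.
pose tp := tree_point R s L.
pose pts j := if (0 < j)%N && bad j then
  [seq tp (j, k, i) | k <- [seq k <- iota 0 (2 ^ (s + j)) | alive p j k], i <- iota 0 L]
  else [::].
have ptsP j z : z \in pts j -> (0 < j)%N /\ normc z = 1 - (2 ^+ j)^-1.
  rewrite /pts; case: ifP => // /andP[j0 _] /allpairsP[[k i] [_ _ ->]].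
  by rewrite normc_dyadic_point.
have half j : (0 < j)%N -> (2 ^+ j)^-1 <= 1 / 2 :> R.
  move=> j0; rewrite div1r lef_pV2 ?posrE ?pow2_gt0 // -[leLHS]expr1.
  by rewrite ler_eXn2l // ltr1n.
have [] := @infinite_blaschke R pts (L%:R * 2 ^+ s * S).
- move=> j z /ptsP[j0 zE]; have := half j j0; have := inv_pow2_gt0 R j.
  by rewrite -normc_gt0 zE; split; lra.
- by move=> j z /ptsP[j0 ->]; have := half j j0; lra.
- move=> N; apply: le_trans (_ : \sum_(j < N | bad j) L%:R * 2 ^+ s * (2 ^+ p j)^-1 <= _).
    rewrite [leRHS]big_mkcond; apply: ler_sum => j _; rewrite /pts.
    have [bj|nbj] := boolP (bad j); last by rewrite andbF big_nil.
    rewrite andbT; case: ifP => [j0|_]; last first.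
      by rewrite big_nil !mulr_ge0 // invr_ge0 exprn_ge0.
    rewrite big_allpairs_dep big_filter.
    have E k : \sum_(i <- iota 0 L) (1 - normc (tp (j : nat, k, i))) = L%:R * (2 ^+ j)^-1.
      under eq_bigr do rewrite normc_dyadic_point opprB addrCA subrr addr0.
      by rewrite /= big_const_seq count_predT size_iota iter_addr_0 mulr_natl.
    under eq_bigr do rewrite E.
    rewrite big_mkcond.
    rewrite (_ : \sum_(k <- _) _ = \sum_(k < 2 ^ (s + j)) (alive p j k)%:R * (L%:R * (2 ^+ j)^-1)).
      rewrite -mulr_suml alive_count // exprD le_eqVlt; apply/orP; left; apply/eqP.
      by field; rewrite !gt_eqF ?pow2_gt0.
    rewrite -(big_mkord xpredT (fun k => (alive p j k)%:R * (L%:R * (2 ^+ j)^-1))).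
    rewrite /index_iota subn0; apply: eq_bigr => k _.
    by case: alive; rewrite ?mul1r ?mul0r.
  by rewrite -mulr_sumr ler_wpM2l // mulr_ge0 // exprn_ge0.
move=> B [Bd B1 B0 Bz].
(* The real part of H at the points of level j is at least 2^(p j) / (4 2^s). *)
pose kappa := 4 * 2 ^+ s * K.
have kappa0 : 0 <= kappa by rewrite !mulr_ge0 // exprn_ge0.
pose f z := B z * cexp ((- kappa)%:C%C * H z).
have fE z : normc (f z) = normc (B z) * expR (- kappa * complex.Re (H z)).
  by rewrite normcM normc_cexp Re_scale.
have fle z : normc z < 1 -> normc (f z) <= expR (- kappa * complex.Re (H z)).
  by move=> z1; rewrite fE ler_piMl ?expR_ge0 // B1.
exists (tp \o a), f; split.
- split=> [k|]; first exact: dyadic_point_disk.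
  have c0 := tree_gap_gt0 R s L0.
  apply: lt_le_trans (_ : tree_gap R s L / 3 <= _); first by rewrite divr_gt0.
  apply: lb_le_inf; first by eexists; exists (0, 1)%N.
  move=> _ [[j k] /= jk <-]; apply: tree_points_separated => //; try exact: aI.
  by apply: contra jk => /eqP E; apply/eqP/ainj; rewrite ?inE.
- split=> [z z1|].
    have h : cdiff (fun w => (- kappa)%:C%C * H w) z.
      by apply: cdiffM; [exact: cdiff_cst|exact: Hd].
    exact/cdiffP/(cdiffM (Bd z z1))/(cdiff_comp h (cdiff_cexp _)).
  exists 1 => z z1; apply: (le_trans (fle z z1)).
  by rewrite -[leRHS]expR0 ler_expR mulNr oppr_le0 mulr_ge0 // HRe.
- move=> n; have [] := aI n I; rewrite /=; move: (a n) => [[j k] i] /= j0 kj ak iL.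
  have nt : normc (tp (j, k, i)) = 1 - (2 ^+ j)^-1 by exact: normc_dyadic_point.
  have [bj|/good gj] := boolP (bad j).
    have -> : f (tp (j, k, i)) = 0.
      rewrite /f (Bz j) ?mul0r // /pts j0 bj; apply/allpairsP; exists (k, i).
      by rewrite mem_filter !mem_iota ak.
    by rewrite normc0 nt g_dyadic // expR_ge0.
  rewrite nt g_dyadic //; apply: le_trans (fle (tp (j, k, i)) _) _.
    exact: dyadic_point_disk.
  rewrite ler_expR mulNr lerN2.
  apply: (le_trans gj).
  have := Hbig _ _ _ kj ak (tree_angle_itv R s L0 j k iL).
  move=> /(ler_wpM2l kappa0); apply: le_trans.
  rewrite le_eqVlt; apply/orP; left; apply/eqP; rewrite /kappa.
  by field; rewrite gt_eqF ?pow2_gt0.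
- exists 0; first by rewrite /disk /= normc0.
  by apply/eqP; rewrite mulf_neq0 // cexp_neq0.
- by move=> j; exact: tree_measure.
Qed.

(** * Series, exponents and measures *)

Section Growth.
Variable R : realType.
Implicit Types (u v : nat -> R) (P : pred nat) (T : R).

Lemma series_bounded u P : (forall n, 0 <= u n) ->
  ((\sum_(0 <= n <oo | P n) (u n)%:E < +oo)%E <->
   exists T, forall N, \sum_(n < N | P n) u n <= T).
Proof.
move=> u0; have u0' n : (0 <= n)%N -> P n -> (0 <= (u n)%:E)%E by rewrite lee_fin.
have E N : (\sum_(0 <= n < N | P n) (u n)%:E)%E = (\sum_(n < N | P n) u n)%:E.
  by rewrite sumEFin big_mkord.
split=> [fin|[T TP]].
  have ge N := @nneseries_lim_ge R (EFin \o u) P 0 N u0'.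
  have nn : (0 <= \sum_(0 <= n <oo | P n) (u n)%:E)%E by exact: nneseries_ge0.
  exists (fine (\sum_(0 <= n <oo | P n) (u n)%:E)%E) => N.
  by rewrite -lee_fin fineK ?ge0_fin_numE // -E; exact: ge.
apply: le_lt_trans (ltry T); apply: lime_le; first exact: is_cvg_nneseries.
by apply: nearW => N; rewrite E lee_fin.
Qed.

Lemma series_infinite u : (forall n, 0 <= u n) ->
  ((\sum_(0 <= n <oo) (u n)%:E = +oo)%E <->
   ~ exists T, forall N, \sum_(n < N) u n <= T).
Proof.
move=> u0; have sb : (\sum_(0 <= n <oo) (u n)%:E < +oo)%E <->
    exists T, forall N, \sum_(n < N) u n <= T := series_bounded xpredT u0.
split.
  by move=> sE /sb; rewrite sE.
by move=> nb; apply/eqP; rewrite -[_ == _]negbK -ltey; apply/negP => /sb.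
Qed.

Lemma sum_blocks u C N : (0 < C)%N ->
  \sum_(n < C * N) u (n %/ C)%N = C%:R * \sum_(q < N) u q.
Proof.
move=> C0; elim: N => [|N IH]; first by rewrite muln0 !big_ord0 mulr0.
rewrite big_ord_recr mulrDr -IH mulnS addnC.
rewrite -(big_mkord xpredT (fun n => u (n %/ C)%N)) (@big_cat_nat _ _ _ (C * N)) ?leq_addr //=.
rewrite big_mkord; congr (_ + _); rewrite -{1}[(C * N)%N]add0n big_addn addKn big_mkord.
rewrite (eq_bigr (fun=> u N)) => [|i _]; last by rewrite mulnC divnDMl // divn_small.
by rewrite sumr_const card_ord mulr_natl.
Qed.

Lemma sum_multiples u C N : (0 < C)%N -> (forall n, 0 <= u n) ->
  \sum_(j < N) u (C * j)%N <= \sum_(n < C * N) u n.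
Proof.
move=> C0 u0; elim: N => [|N IH]; first by rewrite muln0 !big_ord0.
rewrite big_ord_recr mulnS addnC -[leRHS](big_mkord xpredT u).
rewrite (@big_cat_nat _ _ _ (C * N)) ?leq_addr //= big_mkord; apply: lerD => //.
rewrite big_ltn ?lerDl; last by rewrite -[ltnLHS]addn0 ltn_add2l.
by apply: sumr_ge0.
Qed.

Lemma sum_prefix_le u (N N' : nat) : (forall n, 0 <= u n) -> (N <= N')%N ->
  \sum_(n < N) u n <= \sum_(n < N') u n.
Proof.
move=> u0 NN; rewrite -!(big_mkord xpredT u) [leRHS](@big_cat_nat _ _ _ N) //= lerDl.
exact: sumr_ge0.
Qed.

Lemma sum_truncate u (J N : nat) : (forall n, 0 <= u n) ->
  \sum_(n < N) (if (n < J)%N then u n else 0) <= \sum_(n < J) u n.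
Proof.
move=> u0; pose c n := if (n < J)%N then u n else 0.
apply: le_trans (_ : \sum_(n < N + J) c n <= _).
  by apply: (@sum_prefix_le c); [move=> n; rewrite /c; case: ifP|exact: leq_addr].
rewrite -(big_mkord xpredT c) (@big_cat_nat _ _ _ J) ?leq_addl //= big_mkord.
have -> : \sum_(J <= i < N + J) c i = 0.
  by rewrite big_nat big1 // => i /andP[h _]; rewrite /c ltnNge h.
by rewrite addr0; apply: ler_sum => i _; rewrite /c ltn_ord.
Qed.

(** Taking the least exponents gives both the monotonicity and the upper bound. *)
Lemma pow2_ceiling (h : nat -> R) : (forall i j, (i <= j)%N -> h i <= h j) ->
  exists G : nat -> nat, [/\ forall i j, (i <= j)%N -> (G i <= G j)%N,
    forall j, h j <= 2 ^+ G j & forall j, 2 ^+ G j <= Num.max 1 (2 * h j)].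
Proof.
move=> hh; have [G GP] : exists G : nat -> nat, forall j, h j <= 2 ^+ G j /\
    forall k, h j <= 2 ^+ k -> (G j <= k)%N.
  suff /choice[G ?] : forall j, exists n, h j <= 2 ^+ n /\
    forall k, h j <= 2 ^+ k -> (n <= k)%N by exists G.
  move=> j; have ex : exists n, h j <= 2 ^+ n.
    have h0 : 0 < (Num.max 1 (h j))^-1 by rewrite invr_gt0 lt_max ltr01.
    have [n nh] := pow2_small h0.
    exists n; move: nh; rewrite ltf_pV2 ?posrE ?pow2_gt0 ?lt_max ?ltr01 //.
    by move=> /ltW; rewrite ge_max => /andP[].
  by case: (ex_minnP ex) => n h1 h2; exists n.
exists G; split=> [i j ij|j|j]; last 2 first.
- by have [] := GP j.
- have [_ Gmin] := GP j; case E : (G j) => [|k]; first by rewrite expr0 le_max lexx.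
  rewrite le_max exprS ler_pM2l //; apply/orP; right; rewrite leNgt; apply/negP => /ltW.
  by move=> /Gmin; rewrite E ltnn.
- by have [_] := GP i; apply; apply: le_trans (hh _ _ ij) _; have [] := GP j.
Qed.

(** Let p climb towards G by one step at a time whenever it can: while it is below
    the target it climbs at every step, so that the sum over these times is
    geometric. *)
Lemma speed_limit (G : nat -> nat) : (forall i j, (i <= j)%N -> (G i <= G j)%N) ->
  exists p : nat -> nat, [/\ p 0%N = 0%N, forall j, (p j <= p j.+1 <= (p j).+1)%N,
    forall j, (p j <= G j)%N &
    forall N, \sum_(j < N | (p j < G j)%N) (2 ^+ p j)^-1 <= 2 :> R].
Proof.
move=> Gm; pose p := fix p n := if n is n'.+1 then
  (if (p n' < G n)%N then (p n').+1 else p n') else 0%N.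
have pS j : p j.+1 = if (p j < G j.+1)%N then (p j).+1 else p j by [].
have pG j : (p j <= G j)%N.
  elim: j => [//|j IH]; rewrite pS; case: ifP => // _.
  by apply: leq_trans IH _; exact: Gm.
have pm j : (p j <= p j.+1 <= (p j).+1)%N by rewrite pS; case: ifP; rewrite !leqnn leqnSn.
exists p; split=> // N.
have key n : \sum_(j < n.+1 | (p j < G j)%N) (2 ^+ p j)^-1 <= 2 - (2 ^+ p n)^-1 :> R.
  elim: n => [|n IH].
    by rewrite big_mkcond big_ord1 expr0 invr1; case: ifP => _; lra.
  rewrite big_mkcond big_ord_recr /= -big_mkcond.
  have le : (2 ^+ p n.+1)^-1 <= (2 ^+ p n)^-1 :> R.
    rewrite lef_pV2 ?posrE ?pow2_gt0 // ler_eXn2l ?ltr1n //.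
    by have /andP[] := pm n.
  case: ifP => [pn|_]; last by apply: le_trans (lerD IH (lexx 0)) _; lra.
  have E : p n.+1 = (p n).+1.
    rewrite pS ifT //; apply: leq_ltn_trans pn; by have /andP[] := pm n.
  have : (2 ^+ p n)^-1 = 2 * (2 ^+ p n.+1)^-1 :> R.
    by rewrite E exprS invfM mulrA divff ?mul1r.
  by move: IH; set x := \sum_(_ < _ | _) _; lra.
case: N => [|n]; first by rewrite big_ord0.
apply: (le_trans (key n)); have : 0 < (2 ^+ p n)^-1 :> R by rewrite invr_gt0 pow2_gt0.
by lra.
Qed.

Lemma m_real (alpha : R) (a : nat -> R[i]) : exists x : nat -> R,
  [/\ forall n, m alpha a n = (x n)%:E, forall n, 0 <= x n <= 8 &
      forall i j, (i <= j)%N -> x j <= x i].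
Proof.
have mp n : (0 <= m alpha a n <= 8%:E)%E.
  apply/andP; split; first exact: measure_ge0.
  apply: le_trans (period_measure_le _ (@subset_refl _ (@period R))); last first.
    exact: measurable_itv.
  by apply: le_mu_ext => t [tp _]; rewrite /period /= in_itv.
have mE n : m alpha a n = (fine (m alpha a n))%:E.
  have /andP[m0 m8] := mp n; rewrite fineK // ge0_fin_numE //.
  exact: le_lt_trans m8 (ltry _).
exists (fun n => fine (m alpha a n)); split=> // [n|i j ij].
  by have := mp n; rewrite mE !lee_fin.
rewrite -lee_fin -!mE; apply: le_mu_ext => t [tp tj]; split=> //.
by apply: le_trans tj; rewrite lee_fin ler_nat.
Qed.

End Growth.

(** * The criterion for divergent series *)

Section Criteria.
Variables (R : realType) (alpha : R) (g : R -> R).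
Hypothesis alpha0 : 0 < alpha.
Hypothesis hg : minorant_function g.

(** The estimate for bounded functions, by normalizing the bound to 1. *)
Lemma counting_function_bound (a : nat -> R[i]) (f : R[i] -> R[i]) z0 (x : nat -> R) :
  separated_in_disk a -> Hinfty f -> (forall k, normc (f (a k)) <= g (normc (a k))) ->
  disk z0 -> f z0 <> 0 -> (forall n, m alpha a n = (x n)%:E) ->
  exists (C : nat) (K : R) (e : nat -> R) (S : R),
    [/\ (0 < C)%N, 0 <= K, forall n, 0 <= e n, forall N, \sum_(i < N) e i <= S &
     forall n, exists kp : R, [/\ 0 <= kp, kp * gtilde g (n %/ C)%:R <= K & x n <= kp + e n]].
Proof.
move=> ha [fd [M fM]] fa z01 /eqP fz0 xE; (* Dividing by at least 1 preserves the bounds at the points of the sequence. *)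
pose c := Num.max 1 M.
have c1 : 1 <= c by rewrite le_max lexx.
have c0 : 0 < c by exact: lt_le_trans c1.
have nc z : normc (f z * (c^-1)%:C%C) = normc (f z) / c.
  by rewrite normcM normc_real ger0_norm // invr_ge0 ltW.
have [|||k|C [K [e [S [C0 e0 eS H]]]]] := @sufficiency_core R alpha g a
   (fun z => f z * (c^-1)%:C%C) z0 alpha0 hg ha _ _ z01.
- by move=> z /fd /cdiffP h; apply: cdiffM => //; exact: cdiff_cst.
- move=> z z1; rewrite nc ler_pdivrMr // mul1r; apply: (le_trans (fM z z1)).
  by rewrite le_max lexx orbT.
- rewrite mulf_neq0 // -normc_eq0 normc_real normr_eq0 invr_eq0; exact: lt0r_neq0.
- rewrite nc; apply: le_trans (fa k); rewrite ler_pdivrMr //.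
  by rewrite ler_peMr // normc_ge0.
exists C, K, e, S; split=> //.
  have [kp [kp0 kpK _]] := H 0%N; apply: le_trans kpK; rewrite mulr_ge0 //.
  exact: gtilde_ge0.
by move=> n; have [kp [? ?]] := H n; rewrite xE lee_fin; exists kp.
Qed.

Lemma series_S (a : nat -> R[i]) (x w : nat -> R) : (forall n, m alpha a n = (x n)%:E) ->
  (\sum_(0 <= n <oo) (m alpha a n * (w n)%:E) =
   \sum_(0 <= n <oo) (x n * w n)%:E)%E.
Proof. by move=> xE; apply: eq_eseriesr => n _; rewrite xE EFinM. Qed.

Section ClassS.
Variable w : nat -> R.
Hypothesis w0 : forall n, 0 <= w n.
Hypothesis w_noninc : forall i j, (i <= j)%N -> w j <= w i.

(** Convergence of the sum of w n / gtilde n leaves room only for summable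
    contributions to the sum of m n * w n. *)
Lemma class_S_sufficient :
  (\sum_(0 <= n <oo | gtilde g n%:R != 0%R) (w n / gtilde g n%:R)%:E < +oo)%E ->
  essential_minorant g (class_S alpha w).
Proof.
pose b n := w n / gtilde g n%:R.
have gt0 j := gtilde_ge0 hg j.
have b0 n : 0 <= b n by rewrite divr_ge0.
have bN n : gtilde g n%:R = 0 -> b n = 0 by move=> h; rewrite /b h invr0 mulr0.
move=> /(series_bounded _ b0)[T0 T0P].
have [T TP] : exists T, forall N, \sum_(n < N) b n <= T.
  exists T0 => N; apply: le_trans (T0P N); rewrite [leRHS]big_mkcond; apply: ler_sum => n _.
  by case: ifP => // /negbFE/eqP/bN ->.
split=> // a [ha aS] f fH fa z z1; apply/eqP; apply: contraT => /eqP fz.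
have [x [xE xb xm]] := m_real alpha a.
have [C [K [e [S [C0 K0 e0 eS H]]]]] := counting_function_bound ha fH fa z1 fz xE.
move: aS; rewrite (series_S _ xE) => /series_infinite; case.
  by move=> n; rewrite mulr_ge0 //; have /andP[] := xb n.
have [J Jpos] := gtilde_unbounded hg 0.
pose W := w 0%N; have W0 : 0 <= W by exact: w0.
have wW n : w n <= W by exact: w_noninc.
(* Finitely many n have gtilde (n / C) = 0; for those m n <= 8 is good enough. *)
pose small n : R := if (n < C * J)%N then 1 else 0.
have xw n : x n * w n <= K * b (n %/ C)%N + W * e n + 8 * W * small n.
  have [kp [kp0 kpK xk]] := H n; have /andP[x0 x8] := xb n.
  have [h|h] := eqVneq (gtilde g (n %/ C)%:R) 0.
    have nJ : (n < C * J)%N.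
      rewrite ltnNge; apply/negP => /(leq_div2r C); rewrite mulKn // => /(gtilde_homo hg).
      by rewrite h leNgt Jpos.
    rewrite bN // mulr0 add0r /small nJ mulr1.
    have : x n * w n <= 8 * W by exact: ler_pM.
    have := mulr_ge0 W0 (e0 n); lra.
  have q0 : 0 < gtilde g (n %/ C)%:R by rewrite lt_neqAle eq_sym h gt0.
  have s0 : 0 <= 8 * W * small n by rewrite !mulr_ge0 // /small; case: ifP.
  have : kp * w n <= K * b (n %/ C)%N.
    apply: le_trans (_ : kp * w (n %/ C)%N <= _).
      by apply: ler_wpM2l => //; apply: w_noninc; exact: leq_div.
    rewrite /b mulrA (mulrAC K) ler_wpM2r // ler_pdivlMr //.
  have : e n * w n <= W * e n by rewrite mulrC ler_wpM2r.
  have : x n * w n <= (kp + e n) * w n by apply: ler_wpM2r.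
  lra.
exists (K * (C%:R * T) + W * S + 8 * W * (C * J)%:R) => N.
apply: le_trans (_ : \sum_(n < N) (K * b (n %/ C)%N + W * e n + 8 * W * small n) <= _).
  exact: ler_sum.
rewrite !big_split /= -!mulr_sumr; apply: lerD; [apply: lerD|].
- apply: ler_wpM2l => //; apply: le_trans (_ : \sum_(n < C * N) b (n %/ C)%N <= _).
    by apply: (@sum_prefix_le _ (fun n => b (n %/ C)%N)) => //; rewrite leq_pmull.
  by rewrite sum_blocks // ler_wpM2l.
- exact: (ler_wpM2l W0 (eS N)).
- apply: ler_wpM2l; first by rewrite mulr_ge0.
  apply: (le_trans (sum_truncate (u := fun=> 1) _ _ _)) => //.
  by rewrite sumr_const card_ord.
Qed.

(** The inverse powers of two just below 1 / gtilde n, followed at unit speed, are an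
    admissible measure profile; if the sum of w n / gtilde n diverges, then so does
    the sum of m n * w n. *)
Lemma class_S_necessary :
  essential_minorant g (class_S alpha w) ->
  (\sum_(0 <= n <oo | gtilde g n%:R != 0%R) (w n / gtilde g n%:R)%:E < +oo)%E.
Proof.
move=> [_ ess].
have b0 n : 0 <= w n / gtilde g n%:R by rewrite divr_ge0 // gtilde_ge0.
have [G [Gm hG Gmax]] := @pow2_ceiling R (fun j => gtilde g j%:R) (@gtilde_homo _ _ hg).
have [p [p0 pS pG psum]] := speed_limit R Gm.
have good j : ~~ (p j < G j)%N -> gtilde g j%:R <= 1 * 2 ^+ p j.
  by rewrite -leqNgt mul1r => h; rewrite (_ : p j = G j) //; apply/eqP; rewrite eqn_leq pG.
have [a [f [ha fH fa [z z1 fz] am]]] :=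
  invisible_sequence alpha0 hg (ltn0Sn 0) ler01 p0 pS psum good.
have [x [xE xb xm]] := m_real alpha a.
have xw0 n : 0 <= x n * w n by rewrite mulr_ge0 //; have /andP[] := xb n.
apply/series_bounded => //.
have [[T TP]|nb] := pselect (exists T, forall N, \sum_(n < N) x n * w n <= T); last first.
  exfalso; apply: fz; apply: (ess a) => //; split=> //.
  by rewrite (series_S _ xE); apply/series_infinite.
have [J Jpos] := gtilde_unbounded hg 1.
pose c n := if (n < J)%N then w n / gtilde g n%:R else 0.
have c0 n : 0 <= c n by rewrite /c; case: ifP.
exists (\sum_(n < J) w n / gtilde g n%:R + 2 * T) => N.
apply: le_trans (_ : \sum_(n < N) (c n + 2 * (x n * w n)) <= _).
  rewrite big_mkcond; apply: ler_sum => n _.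
  have h : 0 <= c n + 2 * (x n * w n) by rewrite addr_ge0 // mulr_ge0.
  case: ifP => // _; rewrite /c; case: ltnP => nJ; first by rewrite lerDl mulr_ge0.
  have g1 : 1 < gtilde g n%:R by apply: lt_le_trans Jpos _; exact: gtilde_homo.
  have : 2 ^+ G n <= 2 * gtilde g n%:R.
    by have := Gmax n; rewrite le_max => /orP[|//]; lra.
  move=> Gn; rewrite add0r.
  have xG : (2 ^+ G n)^-1 <= x n.
    apply: le_trans (_ : (2 ^+ p n)^-1 <= _).
      by rewrite lef_pV2 ?posrE ?pow2_gt0 // ler_eXn2l // ltr1n.
    by have := am n; rewrite mul1n xE lee_fin.
  have iG : (gtilde g n%:R)^-1 <= 2 * (2 ^+ G n)^-1.
    rewrite -[leLHS]mul1r ler_pdivrMr; last by lra.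
    by rewrite mulrAC ler_pdivlMr ?pow2_gt0 // mul1r.
  have := ler_wpM2l (w0 n) iG; have := ler_wpM2r (w0 n) xG; lra.
rewrite big_split /= -mulr_sumr; apply: lerD; last exact: (ler_wpM2l _ (TP N)).
exact: (@sum_truncate _ (fun n => w n / gtilde g n%:R) J N b0).
Qed.
End ClassS.
End Criteria.

(** * Lower and upper limits *)

Section LimitBounds.
Variable R : realType.
Implicit Types (u h : nat -> R) (E : set nat).

Lemma limn_einf_gt0 u : (0 < limn_einf (fun n => (u n)%:E))%E <->
  exists2 c : R, 0 < c & exists n0, forall n, (n0 <= n)%N -> c <= u n.
Proof.
rewrite limn_einf_lim; set U := fun n => (u n)%:E; split.
  rewrite (cvg_lim (@ereal_hausdorff R) (@cvg_einfs_sup R U)) => /ereal_sup_gt[_ [n0 _ <-]].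
  rewrite /einfs /= => pos.
  have le n : (n0 <= n)%N -> (ereal_inf (sdrop U n0) <= (u n)%:E)%E.
    by move=> nn; apply: ereal_inf_lbound; exists n.
  move: pos le; case: (ereal_inf _) => [c|_ /(_ n0 (leqnn _))|//]; last by rewrite leNgt ltry.
  by rewrite lte_fin => c0 le; exists c => //; exists n0 => n /le.
move=> [c c0 [n0 H]]; apply: lt_le_trans (_ : c%:E <= _)%E; first by rewrite lte_fin.
apply: lime_ge; first exact: is_cvg_einfs.
exists n0 => // n /= nn; apply: le_ereal_inf_tmp => _ [k /= nk <-].
by rewrite lee_fin H // (leq_trans nn).
Qed.

Lemma limf_esup_lty h E :
  limf_esup (fun n => (h n)%:E) (within (~` E) \oo) <> +oo%E <->
  exists (K : R) n0, forall n, (n0 <= n)%N -> ~ E n -> h n <= K.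
Proof.
split=> [|[K [n0 H]] eq].
  move=> /eqP; rewrite -ltey /limf_esup => /ereal_inf_lt[_ [A [n0 _ An0] <-] Alt].
  have le n : (n0 <= n)%N -> ~ E n -> ((h n)%:E <= ereal_sup ((fun n => (h n)%:E) @` A))%E.
    by move=> nn nE; apply: ereal_sup_ubound; exists n => //; exact: An0.
  move: Alt le; case: (ereal_sup _) => [K|//|] _ le.
    by exists K, n0 => n nn nE; rewrite -lee_fin le.
  by exists 0, n0 => n nn nE; have := le n nn nE; rewrite leeNy_eq.
have : (limf_esup (fun n => (h n)%:E) (within (~` E) \oo) <= K%:E)%E.
  apply: le_trans (ereal_inf_lbound _) _.
    exists [set n | (n0 <= n)%N /\ ~ E n] => //.
    by exists n0 => // n nn nE.
  by apply: ge_ereal_sup => _ [n [nn nE] <-]; rewrite lee_fin H.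
by rewrite eq leye_eq.
Qed.

Lemma esum_bounded u E : (forall n, 0 <= u n) ->
  ((\esum_(n in E) (u n)%:E < +oo)%E <->
   exists T, forall N, \sum_(n < N | `[< E n >]) u n <= T).
Proof.
move=> u0; rewrite (_ : \esum_(n in E) _ = \sum_(0 <= n <oo | `[< E n >]) (u n)%:E)%E.
  exact: series_bounded.
rewrite nneseries_esum; last by move=> n _; rewrite lee_fin.
by congr esum; apply/seteqP; split=> n /= /asboolP.
Qed.

End LimitBounds.

(** * The criterion for lower bounds *)

Section ClassL.
Variables (R : realType) (alpha : R) (g : R -> R) (v : nat -> R).
Hypothesis alpha0 : 0 < alpha.
Hypothesis hg : minorant_function g.
Hypothesis v0 : forall n, 0 < v n.
Hypothesis v_noninc : forall i j, (i <= j)%N -> v j <= v i.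

Lemma limn_einf_ratio (a : nat -> R[i]) (x : nat -> R) :
  (forall n, m alpha a n = (x n)%:E) ->
  ((0 < limn_einf (fun n => m alpha a n * ((v n)^-1)%:E))%E <->
   exists2 c : R, 0 < c & exists n0, forall n, (n0 <= n)%N -> c * v n <= x n).
Proof.
move=> xE; rewrite (_ : (fun n => _) = fun n => (x n / v n)%:E); last first.
  by apply/funext => n; rewrite xE EFinM.
by rewrite limn_einf_gt0; split=> -[c c0 [n0 H]]; exists c => //; exists n0 => n nn;
  have := H n nn; rewrite ler_pdivlMr.
Qed.

(** The summable part of the counting function can only dominate v on a set E over
    which v is summable; off E the other part does. *)
Lemma class_L_sufficient :
  (forall (E : set nat) (C : nat), (\esum_(n in E) (v n)%:E < +oo)%E -> (0 < C)%N ->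
    limf_esup (fun n : nat => (gtilde g (n %/ C)%:R * v n)%:E)
      (within (~` E) \oo) = +oo%E) ->
  essential_minorant g (class_L alpha v).
Proof.
move=> cond; split=> // a [ha aL] f fH fa z z1; apply/eqP; apply: contraT => /eqP fz.
have [x [xE xb xm]] := m_real alpha a.
have [C [K [e [S [C0 K0 e0 eS H]]]]] := counting_function_bound alpha0 hg ha fH fa z1 fz xE.
have [c c0 [n0 cv]] := (limn_einf_ratio xE).1 aL.
have c2 : 0 < c / 2 by rewrite divr_gt0.
(* Where e n takes less than half of c * v n, the other half is left for kp. *)
pose E : set nat := [set n | c / 2 * v n <= e n].
have vE : (\esum_(n in E) (v n)%:E < +oo)%E.
  apply/(esum_bounded E (fun n => ltW (v0 n))); exists (S / (c / 2)) => N.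
  rewrite ler_pdivlMr // mulr_suml; apply: le_trans (eS N).
  rewrite big_mkcond; apply: ler_sum => n _; case: asboolP => // h.
  by rewrite mulrC.
suff : limf_esup (fun n => (gtilde g (n %/ C)%:R * v n)%:E) (within (~` E) \oo) <> +oo%E.
  by case; exact: cond.
apply/limf_esup_lty; exists (K / (c / 2)), n0 => n nn nE.
have [kp [kp0 kpK xk]] := H n; have q0 := gtilde_ge0 hg (n %/ C).
have h : c / 2 * v n <= kp.
  by have := cv n nn; move/negP: nE; rewrite /= -ltNge; lra.
rewrite ler_pdivlMr //; have := ler_wpM2r q0 h; lra.
Qed.

(** If gtilde (n / C) is bounded by a multiple of 1 / v n off a set E over which v is
    summable, then the inverse powers of two just below v (C j) are a legitimate
    measure profile, with the levels j for which C j is in E as additional bad ones. *)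
Lemma class_L_necessary : essential_minorant g (class_L alpha v) ->
  forall (E : set nat) (C : nat), (\esum_(n in E) (v n)%:E < +oo)%E -> (0 < C)%N ->
    limf_esup (fun n : nat => (gtilde g (n %/ C)%:R * v n)%:E)
      (within (~` E) \oo) = +oo%E.
Proof.
move=> [_ ess] E C vE C0; apply: contrapT => /limf_esup_lty[K1 [n0 KP1]].
pose K := Num.max K1 0; have K0 : 0 <= K by rewrite le_max lexx orbT.
have KP n : (n0 <= n)%N -> ~ E n -> gtilde g (n %/ C)%:R * v n <= K.
  by move=> nn nE; rewrite le_max KP1.
have [T TP] := (esum_bounded E (fun n => ltW (v0 n))).1 vE.
have hm i j : (i <= j)%N -> (v (C * i)%N)^-1 <= (v (C * j)%N)^-1.
  by move=> ij; rewrite lef_pV2 ?posrE // v_noninc // leq_mul2l ij orbT.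
have [Q [Qm hQ Qmax]] := pow2_ceiling hm.
have [p [p0 pS pQ psum]] := speed_limit R Qm.
pose inE j := `[< E (C * j)%N >].
pose bad j := [|| (p j < Q j)%N, inE j | (C * j < n0)%N].
have vQ j : (2 ^+ Q j)^-1 <= v (C * j)%N.
  by rewrite -[leRHS]invrK lef_pV2 ?posrE ?pow2_gt0 ?invr_gt0.
have pow1 k : (2 ^+ k)^-1 <= 1 :> R.
  by rewrite invf_le1 ?pow2_gt0 // exprn_ege1 // ler1n.
have badS N : \sum_(j < N | bad j) (2 ^+ p j)^-1 <= 2 + T + n0%:R :> R.
  pose vE' n := if `[< E n >] then v n else 0.
  have vE0 n : 0 <= vE' n by rewrite /vE'; case: ifP => // _; exact: ltW.
  apply: le_trans (_ : \sum_(j < N) ((if (p j < Q j)%N then (2 ^+ p j)^-1 else 0) +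
     vE' (C * j)%N + (if (j < n0)%N then 1 else 0)) <= _).
    rewrite big_mkcond; apply: ler_sum => j _; rewrite /bad.
    have y0 : 0 <= (2 ^+ p j)^-1 :> R by rewrite invr_ge0 exprn_ge0.
    have u0 : 0 <= (if (j < n0)%N then 1 else 0) :> R by case: ifP.
    have w0 := vE0 (C * j)%N.
    case: ltnP => /= pj; first by rewrite -addrA lerDl addr_ge0.
    have pE : p j = Q j by apply/eqP; rewrite eqn_leq pQ.
    rewrite add0r; case: ifP => [/orP[jE|jn]|_]; last by rewrite addr_ge0.
      by apply: (le_trans _ (lerD (lexx _) u0)); rewrite addr0 pE /vE' -/(inE j) jE.
    have -> : (j < n0)%N by apply: leq_ltn_trans jn; rewrite leq_pmull.
    by apply: le_trans (pow1 _) _; rewrite lerDr.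
  rewrite !big_split /=; apply: lerD; [apply: lerD|].
  - by apply: le_trans (psum N); rewrite [leRHS]big_mkcond.
  - apply: le_trans (sum_multiples N C0 vE0) _; apply: le_trans (TP (C * N)%N).
    by rewrite [leRHS]big_mkcond.
  - apply: le_trans (@sum_truncate R (fun=> 1) n0 N _) _ => //.
    by rewrite sumr_const card_ord.
have good j : ~~ bad j -> gtilde g j%:R <= K * 2 ^+ p j.
  rewrite /bad negb_or => /andP[]; rewrite -leqNgt negb_or => pj /andP[/asboolP jE].
  rewrite -leqNgt => jn.
  have -> : p j = Q j by apply/eqP; rewrite eqn_leq pQ.
  have := KP _ jn jE; rewrite mulKn // -ler_pdivlMr // => h.
  by apply: (le_trans h); apply: ler_wpM2l.
have L0 : (0 < 2 * C)%N by rewrite muln_gt0.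
have [a [f [ha fH fa [z z1 fz] am]]] :=
  invisible_sequence alpha0 hg L0 K0 p0 pS badS good.
apply: fz; apply: (ess a) => //; split=> //.
have [x [xE xb xm]] := m_real alpha a.
apply/(limn_einf_ratio xE).
pose c := (v 0%N + 2)^-1; have v00 := v0 0%N.
have c0 : 0 < c by rewrite invr_gt0 ltr_wpDr // ltW.
(* The profile is known at the multiples of L = 2 C; the next multiple L j after n
   still has C j <= n, so that v (C j) >= v n. *)
exists c => //; exists (2 * C)%N => n nn.
pose j := (n %/ (2 * C)).+1.
have jn : (C * j <= n)%N.
  have := leq_divM n (2 * C); have : (1 <= n %/ (2 * C))%N by rewrite divn_gt0.
  by rewrite /j; nia.
have nj : (n <= 2 * C * j)%N by rewrite /j mulnC ltnW // ltn_ceil.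
apply: le_trans (_ : c * v (C * j)%N <= _); first by rewrite ler_pM2l // v_noninc.
apply: le_trans (xm _ _ nj).
apply: le_trans (_ : (2 ^+ Q j)^-1 <= _); last first.
  apply: le_trans (_ : (2 ^+ p j)^-1 <= _); last by rewrite -lee_fin -xE.
  by rewrite lef_pV2 ?posrE ?pow2_gt0 // ler_eXn2l // ltr1n.
have w0 := v0 (C * j)%N; have w1 : v (C * j)%N <= v 0%N by exact: v_noninc.
rewrite /c mulrC ler_pdivrMr; last by lra.
rewrite mulrC ler_pdivlMr ?pow2_gt0 //.
have : v (C * j)%N * 2 ^+ Q j <= Num.max (v (C * j)%N) 2.
  have := Qmax j; rewrite !le_max => /orP[h|h]; apply/orP; [left|right].
    by rewrite ler_piMr // ltW.
  by rewrite mulrC -ler_pdivlMr.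
rewrite le_max => /orP[]; lra.
Qed.

End ClassL.

(** * Characterization of essential minorants *)

Theorem theorem1 (R : realType) (alpha : R) (g : R -> R) (v w : nat -> R)
  (alpha_gt0 : 0 < alpha)
  (hg : minorant_function g)
  (v_ge0 : forall n, 0 <= v n)
  (w_ge0 : forall n, 0 <= w n)
  (v_noninc : forall p q : nat, (p <= q)%N -> v q <= v p)
  (w_noninc : forall p q : nat, (p <= q)%N -> w q <= w p)
  (v_bounded : exists M : R, forall n, v n <= M)
  (w_bounded : exists M : R, forall n, w n <= M)
  (v_sum : (\sum_(0 <= n <oo) (v n)%:E = +oo)%E)
  (w_sum : (\sum_(0 <= n <oo) (w n)%:E = +oo)%E) :
  (essential_minorant g (class_S alpha w) <->
     (\sum_(0 <= n <oo | gtilde g n%:R != 0%R) (w n / gtilde g n%:R)%:E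
        < +oo)%E)
  /\
  (essential_minorant g (class_L alpha v) <->
     (forall (E : set nat) (C : nat),
        (\esum_(n in E) (v n)%:E < +oo)%E ->
        (0 < C)%N ->
        limf_esup (fun n : nat => (gtilde g (n %/ C)%:R * v n)%:E)
                  (within (~` E) \oo) = +oo%E)).
Proof.
have v_gt0 n : 0 < v n.
  rewrite lt_neqAle v_ge0 andbT eq_sym; apply/eqP => vn.
  apply: ((series_infinite v_ge0).1 v_sum); exists (\sum_(k < n) v k) => N.
  apply: le_trans (sum_truncate n N v_ge0); apply: ler_sum => k _.
  by case: ltnP => // nk; rewrite -vn v_noninc.
split; split.
- exact: class_S_necessary.
- exact: class_S_sufficient.
- exact: class_L_necessary.
- exact: class_L_sufficient.
Qed.
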